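(* Let $d\ge1$ and let $V:\mathbb{R}^d\to\mathbb{R}_{\ge0}$ be continuous and $\mathbb{Z}^d$-periodic. For all $\theta>0$, $$\inf S_+(A_\theta)\le\mu(B_\theta).$$
   Context: For $\theta>0$ and $\eta\in\mathbb{R}^d$, the operator $A_{\theta,\eta}:\ell_2(\theta\mathbb{Z}^d)\to\ell_2(\theta\mathbb{Z}^d)$ is $$A_{\theta,\eta}f(k\theta)=2d\,f(k\theta)-\sum_{j\sim k}f(j\theta)+V(k\theta+\eta)f(k\theta),\qquad k\in\mathbb{Z}^d,$$ where $j\sim k$ means that $j,k\in\mathbb{Z}^d$ are nearest neighbours, i.e. $j-k=\pm e_i$ for some coordinate vector $e_i$; $A_\theta=A_{\theta,0}$. The union spectrum of $A_\theta$ is $S_+(A_\theta)=\bigcup_{\eta}\sigma(A_{\theta,\eta})$, the union being over all shifts $\eta\in\mathbb{R}^d$ and $\sigma$ denoting the spectrum. $B_\theta:H^2(\mathbb{R}^d)\to L^2(\mathbb{R}^d)$ is $B_\theta g=-\theta^2\Delta g+Vg$, and $\mu(B_\theta)$ is the infimum of its spectrum; equivalently $$\mu(B_\theta)=\inf_{g\in H^2(\mathbb{R}^d),\,\|g\|=1}\int_{\mathbb{R}^d}\theta^2\|\nabla g(x)\|^2+V(x)g(x)^2\,dx.$$ *)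

(* Defs.v *)
From HB Require Import structures.
From mathcomp Require Import all_boot all_order all_algebra.
From mathcomp Require Import all_classical all_reals all_analysis.
Import Order.TTheory GRing.Theory Num.Theory.
Import numFieldNormedType.Exports.
Set Implicit Arguments.
Unset Strict Implicit.
Unset Printing Implicit Defensive.
Local Open Scope classical_set_scope.
Local Open Scope ring_scope.

(** [R^n] is ['rV[R]_n]; its sigma-algebra is the one generated by the
    coordinates, i.e. the product of the Borel sigma-algebras. *)

Definition measure_rV_display : measure_display -> measure_display.
Proof. exact. Qed.

Section measurable_rV.
Context {d} {T : measurableType d}.
Variable n : nat.

Let coors : 'I_n -> 'rV[T]_n -> T := fun i x => x ord0 i.

Let rV_set0 : g_sigma_preimage coors set0.
Proof. exact: sigma_algebra0. Qed.

Let rV_setC A : g_sigma_preimage coors A -> g_sigma_preimage coors (~` A).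
Proof. exact: sigma_algebraC. Qed.

Let rV_bigcup (F : _^nat) : (forall i, g_sigma_preimage coors (F i)) ->
  g_sigma_preimage coors (\bigcup_i (F i)).
Proof. exact: sigma_algebra_bigcup. Qed.

HB.instance Definition _ := @isMeasurable.Build (measure_rV_display d)
  'rV[T]_n (g_sigma_preimage coors) rV_set0 rV_setC rV_bigcup.

End measurable_rV.

Section measurable_rV_theory.
Context {R : realType}.

Lemma measurable_rV_coord n (i : 'I_n) :
  measurable_fun [set: 'rV[R]_n] (fun x : 'rV[R]_n => x ord0 i).
Proof.
move=> _ Y mY; rewrite setTI; apply: sub_sigma_algebra => /=.
rewrite -bigcup_seq/=; exists i => /=; first by rewrite mem_index_enum.
by exists Y => //; rewrite setTI.
Qed.

Lemma measurable_fun_rV d (T : measurableType d) n (f : T -> 'rV[R]_n) :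
  (forall i, measurable_fun [set: T] (fun x => f x ord0 i)) ->
  measurable_fun [set: T] f.
Proof.
move=> mf _ A mA; rewrite setTI.
have : <<s preimage_set_system setT f (\big[setU/set0]_(i < n)
    preimage_set_system setT (fun x : 'rV[R]_n => x ord0 i) measurable) >>
    `<=` @measurable _ T.
  apply: smallest_sub; first exact: sigma_algebra_measurable.
  move=> B [C]; rewrite -bigcup_seq/= => -[i _ [D mD <-] <-].
  by rewrite !setTI; have := mf i measurableT _ mD; rewrite setTI.
apply; rewrite g_sigma_preimageE; exists A => //; exact: setTI.
Qed.

Definition cons_rV n (p : measurableTypeR R * 'rV[R]_n) : 'rV[R]_n.+1 :=
  \row_i (if unlift ord0 i is Some j then p.2 ord0 j else p.1).

Definition behead_rV n (x : 'rV[R]_n.+1) : measurableTypeR R * 'rV[R]_n :=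
  (x ord0 ord0, \row_i x ord0 (lift ord0 i)).

Lemma behead_rVK n : cancel (@behead_rV n) (@cons_rV n).
Proof.
move=> x; apply/rowP => i; rewrite mxE.
by case: unliftP => [j ->|->] //=; rewrite mxE.
Qed.

Lemma cons_rVK n : cancel (@cons_rV n) (@behead_rV n).
Proof.
move=> [a x]; rewrite /behead_rV mxE unlift_none/=; congr pair.
by apply/rowP => i; rewrite !mxE liftK.
Qed.

Lemma measurable_cons_rV n : measurable_fun setT (@cons_rV n).
Proof.
apply: measurable_fun_rV => i; rewrite /cons_rV.
case: (unliftP ord0 i) => [j ->|->].
  under eq_fun do rewrite mxE liftK.
  apply: (measurableT_comp (measurable_rV_coord j)); exact: measurable_snd.
under eq_fun do rewrite mxE unlift_none.
exact: measurable_fst.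
Qed.

Lemma measurable_behead_rV n : measurable_fun setT (@behead_rV n).
Proof.
apply/measurable_fun_pairP; split.
  exact: measurable_rV_coord.
apply: measurable_fun_rV => i.
rewrite [X in measurable_fun _ X](_ : _ =
  fun x : 'rV[R]_n.+1 => x ord0 (lift ord0 i)); first exact: measurable_rV_coord.
by apply/funext => x; rewrite /= mxE.
Qed.

End measurable_rV_theory.

Section lebesgue_rV.
Context {R : realType}.

Section step.
Variables (n : nat) (m : {sigma_finite_measure set 'rV[R]_n -> \bar R}).

Definition lebesgue_rV_step : set 'rV[R]_n.+1 -> \bar R :=
  pushforward (@lebesgue_measure R \x m)%E (@cons_rV R n).

HB.instance Definition _ := Measure.copy lebesgue_rV_step
  (measure_function_pushforward__canonical__measure_function_Measure
    (@lebesgue_measure R \x m)%E (@measurable_cons_rV R n)).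

Let lebesgue_rV_step_sigma_finite : sigma_finite setT lebesgue_rV_step.
Proof.
have /sigma_finiteP[F [TF ndF Foo]] := sigma_finiteT (@lebesgue_measure R).
have /sigma_finiteP[G [TG ndG Goo]] := sigma_finiteT m.
exists (fun k => @behead_rV R n @^-1` (F k `*` G k)).
  apply/esym; rewrite -subTset => x _.
  have [k _ Fk] : (\bigcup_k F k) (behead_rV x).1 by rewrite -TF.
  have [l _ Gl] : (\bigcup_k G k) (behead_rV x).2 by rewrite -TG.
  exists (maxn k l) => //; split.
    by move: Fk; exact/subsetPset/ndF/leq_maxl.
  by move: Gl; exact/subsetPset/ndG/leq_maxr.
move=> k; have [mFk Fkoo] := Foo k; have [mGk Gkoo] := Goo k; split.
  rewrite -[X in measurable X]setTI; apply: measurable_behead_rV => //.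
  exact: measurableX.
rewrite /lebesgue_rV_step /pushforward -comp_preimage.
rewrite (_ : _ \o _ = id); last by apply/funext => p; exact: cons_rVK.
by rewrite preimage_id product_measure1E// lte_mul_pinfty// ge0_fin_numE.
Qed.

HB.instance Definition _ := Measure_isSigmaFinite.Build _ _ _
  lebesgue_rV_step lebesgue_rV_step_sigma_finite.

End step.

Fixpoint lebesgue_rV n : {sigma_finite_measure set 'rV[R]_n -> \bar R} :=
  if n is n'.+1 then lebesgue_rV_step (lebesgue_rV n')
  else \d_(0 : 'rV[R]_0).

End lebesgue_rV.
Arguments lebesgue_rV {R} n.

Section spectrum.
Context d (T : measurableType d) (R : realType).
Variable mu : {measure set T -> \bar R}.

Definition L2 : set (T -> R) := [set f | f \in Lfun mu 2%:E].

(** Real [L^2] spaces are used: functions are real-valued and the spectrum is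
    a set of real numbers.  Elements of [L2] are square-integrable functions,
    almost everywhere equality playing the role of equality.

    [l] is in the resolvent set of [A : dom -> L2] when [A - l : dom -> L2] has
    a two-sided inverse [S : L2 -> dom] which is bounded. *)
Definition resolvent_set (dom : set (T -> R)) (A : (T -> R) -> T -> R) :
    set R := [set l |
  exists (S : (T -> R) -> T -> R) (C : R),
  [/\ forall h, L2 h -> dom (S h) /\
        (fun x => A (S h) x - l * S h x) = h %[ae mu],
      forall g, dom g -> S (fun x => A g x - l * g x) = g %[ae mu] &
      forall h, L2 h ->
        ('N[mu]_2%:E[EFin \o S h] <= C%:E * 'N[mu]_2%:E[EFin \o h])%E]].

Definition spectrum dom A : set R := ~` resolvent_set dom A.

End spectrum.

(** The point [k * theta] of [theta Z^n] is represented by its index [k], so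
    that [l_2(theta Z^n)] is [L2] of the counting measure on [lattice n]. *)
Definition lattice (n : nat) : Type := 'rV[int]_n.

HB.instance Definition _ n := GRing.Zmodule.on (lattice n).
HB.instance Definition _ n := isPointed.Build (lattice n) 0.
HB.instance Definition _ n := @isMeasurable.Build default_measure_display
  (lattice n) discrete_measurable discrete_measurable0
  discrete_measurableC discrete_measurableU.

Definition neighbour n (j k : lattice n) : Prop :=
  exists i : 'I_n, j - k = delta_mx 0 i \/ j - k = - delta_mx 0 i.

Section lattice_operator.
Context {R : realType} {n : nat}.
Variables (theta : R) (V : 'rV[R]_n -> R).

Definition lattice_op (eta : 'rV[R]_n) (f : lattice n -> R) : lattice n -> R :=
  fun k => (2 * n)%:R * f k - \sum_(j \in [set j | neighbour j k]) f j
    + V (theta *: map_mx intr (k : 'rV[int]_n) + eta) * f k.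

Definition lattice_spectrum (eta : 'rV[R]_n) : set R :=
  spectrum (@counting (lattice n) R) (L2 (@counting (lattice n) R))
    (lattice_op eta).

Definition union_spectrum : set R :=
  \bigcup_(eta in [set: 'rV[R]_n]) lattice_spectrum eta.

End lattice_operator.

Section sobolev.
Context {R : realType} {n : nat}.
Implicit Types (u v : 'rV[R]_n -> R) (i : 'I_n).

Definition partial i u : 'rV[R]_n -> R :=
  fun x => 'D_(delta_mx 0 i : 'rV[R]_n) (u : 'rV[R]_n -> R^o) x.

Definition partials (s : seq 'I_n) u := foldr partial u s.

(** Smooth functions with compact support; smoothness is the existence and
    continuity of the iterated partial derivatives of all orders. *)
Definition test_function (phi : 'rV[R]_n -> R) : Prop :=
  [/\ forall s i x, derivable (partials s phi : 'rV[R]_n -> R^o) x (delta_mx 0 i),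
      forall s, continuous (partials s phi) &
      compact (closure [set x | phi x != 0])].

Definition is_weak_partial i u v : Prop := forall phi, test_function phi ->
  \int[lebesgue_rV n]_x (u x * partial i phi x)
    = - \int[lebesgue_rV n]_x (v x * phi x).

(** The space [H^k(R^n)]: weak derivatives up to order [k] are in [L^2]. *)
Fixpoint sobolev (k : nat) : set ('rV[R]_n -> R) :=
  if k is k'.+1 then
    [set u | L2 (lebesgue_rV n) u /\
      forall i, exists v, sobolev k' v /\ is_weak_partial i u v]
  else L2 (lebesgue_rV n).

(** The weak derivative in [L^2], unique up to almost everywhere equality, if
    there is one; a junk value otherwise. *)
Definition weak_partial i u : 'rV[R]_n -> R :=
  xget (cst 0) [set v | L2 (lebesgue_rV n) v /\ is_weak_partial i u v].

Definition laplacian u : 'rV[R]_n -> R :=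
  fun x => \sum_(i < n) weak_partial i (weak_partial i u) x.

Definition schrodinger_op (theta : R) (V : 'rV[R]_n -> R) u : 'rV[R]_n -> R :=
  fun x => - theta ^+ 2 * laplacian u x + V x * u x.

Definition schrodinger_spectrum (theta : R) (V : 'rV[R]_n -> R) : set R :=
  spectrum (lebesgue_rV n) (sobolev 2) (schrodinger_op theta V).

End sobolev.

(** Infima of sets of reals, in the extended reals, so that neither emptiness
    nor unboundedness gives a junk value. *)
Definition inf_set {R : realType} (A : set R) : \bar R :=
  ereal_inf (EFin @` A).

(* Main.v *)
(* Let [lam] be smaller than some [m <= inf S_+(A_theta)]; we show that [lam] is
   in the resolvent set of [B_theta].  Every [A_{theta, eta}] has the half-line
   below [m] in its resolvent set, so its quadratic form is at least [m].
   Slicing [R^d] into the cosets of [theta Z^d] and integrating this over a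
   fundamental cell gives, for [g] in [L^2(R^d)],
     m |g|^2 <= sum_i |g (. + theta e_i) - g|^2 + int V g^2,
   and for a test function the difference is at most [theta |d_i g|] in norm.
   Hence [B_theta - lam] is coercive on test functions.  No regularity or density
   theorem is needed to deduce invertibility: mollification and cut-off show
   that a function of [L^2] orthogonal to the range of [B_theta - lam] on test
   functions vanishes, so this range is dense; coercivity and the identity
   [|D^2 phi| = |laplacian phi|] make preimages converge together with their
   derivatives up to order two, and the same uniqueness identifies the inverse. *)

Require Import Defs.
From mathcomp Require Import all_boot all_order all_algebra.
From mathcomp Require Import all_classical all_reals all_analysis.
From mathcomp Require Import measurable_realfun ring lra.
Import Order.TTheory GRing.Theory Num.Theory.
Import numFieldNormedType.Exports.
Set Implicit Arguments.
Unset Strict Implicit.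
Unset Printing Implicit Defensive.
Local Open Scope classical_set_scope.
Local Open Scope ring_scope.

(** * Square-integrable functions *)

(** Two passages between spectrum and quadratic form carry the argument. On the lattice side all
    shifts [eta] enter because [eta] is the base point of the slice [x + theta Z^d], and almost
    every slice is used. The result is one-sided because a finite difference over the distance
    [theta] only underestimates [theta] times the derivative, so the discrete kinetic energy stays
    below the continuous one. On [R^d] the obstacle is that a function [v] orthogonal to the range
    has no derivatives to which the form bound could be applied. Mollifying it leaves only the
    commutator of the mollification with multiplication by [V], which is small because a continuous
    periodic [V] is uniformly continuous; cutting off leaves only terms with a derivative of the
    cut-off function, small by scaling. The strict gap [m - lam] absorbs both errors, and its
    inverse bounds the resolvent. *)

Section L2_space.
Context d (T : measurableType d) (R : realType) (mu : {measure set T -> \bar R}).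
Implicit Types f g h : T -> R.

Local Notation int1 f := (mu.-integrable setT (EFin \o f)).

Lemma L2P f : L2 mu f <->
  measurable_fun setT f /\ int1 (fun x => f x ^+ 2).
Proof.
split=> [/= f2|[mf /integrableP[_ fi]]].
  split; last exact: Lfun2_integrable_sqr.
  by have /sub_Lfun_mfun := f2; rewrite inE.
rewrite /L2 /= inE; apply/andP; split; rewrite inE//=.
rewrite /finite_norm unlock poweR_lty//; move: fi; congr (_ < _)%E.
apply: eq_integral => x _ /=.
by rewrite powR_mulrn// normrX.
Qed.

Lemma L2_measurable f : L2 mu f -> measurable_fun setT f.
Proof. by move/L2P => []. Qed.

Lemma L2_mul f g : L2 mu f -> L2 mu g -> int1 (fun x => f x * g x).
Proof. by move=> f2 g2; apply/Lfun1_integrable; exact: Lfun2_mul_Lfun1. Qed.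

Lemma EFin_integrableD f g : int1 f -> int1 g -> int1 (fun x => f x + g x).
Proof. by move=> fi gi; exact: (integrableD measurableT fi gi). Qed.

Lemma EFin_integrableZ c f : int1 f -> int1 (fun x => c * f x).
Proof. by move=> fi; exact: (integrableZl measurableT c fi). Qed.

Lemma EFin_integrableB f g : int1 f -> int1 g -> int1 (fun x => f x - g x).
Proof. by move=> fi gi; exact: (integrableB measurableT fi gi). Qed.

Lemma L2D f g : L2 mu f -> L2 mu g -> L2 mu (fun x => f x + g x).
Proof.
move=> f2 g2; have [mf fi] := (L2P _).1 f2; have [mg gi] := (L2P _).1 g2.
apply/L2P; split; first exact: measurable_funD.
rewrite (_ : (fun x => _) =
    (fun x => f x ^+ 2 + (2 * (f x * g x) + g x ^+ 2))).
  apply: EFin_integrableD => //; apply: EFin_integrableD => //.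
  by apply: EFin_integrableZ; exact: L2_mul.
by apply/funext => x; ring.
Qed.

Lemma L2Z c f : L2 mu f -> L2 mu (fun x => c * f x).
Proof.
move=> f2; have [mf fi] := (L2P _).1 f2.
apply/L2P; split; first exact: measurable_funM.
rewrite (_ : (fun x => _) = (fun x => c ^+ 2 * f x ^+ 2)).
  exact: EFin_integrableZ.
by apply/funext => x; rewrite exprMn.
Qed.

Lemma L2B f g : L2 mu f -> L2 mu g -> L2 mu (fun x => f x - g x).
Proof.
move=> f2 g2; rewrite (_ : (fun x => _) = (fun x => f x + -1 * g x)).
  by apply: L2D => //; exact: L2Z.
by apply/funext => x; rewrite mulN1r.
Qed.

Lemma L2_0 : L2 mu (cst 0).
Proof.
apply/L2P; split => //.
rewrite (_ : EFin \o _ = cst 0%E); first exact: integrable0.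
by apply/funext => x /=; rewrite expr0n.
Qed.

Lemma L2_sum (I : Type) (s : seq I) (F : I -> T -> R) :
  (forall i, L2 mu (F i)) -> L2 mu (fun x => \sum_(i <- s) F i x).
Proof.
move=> F2; elim: s => [|i s ih].
  by rewrite (_ : (fun x => _) = cst 0);
    [exact: L2_0|apply/funext => x; rewrite big_nil].
rewrite (_ : (fun x => _) = (fun x => F i x + \sum_(j <- s) F j x)).
  exact: L2D.
by apply/funext => x; rewrite big_cons.
Qed.

Lemma L2_le f g : measurable_fun setT f -> (forall x, `|f x| <= `|g x|) ->
  L2 mu g -> L2 mu f.
Proof.
move=> mf fg /L2P[mg gi]; apply/L2P; split => //.
apply: le_integrable gi => //.
  by apply/measurable_EFinP; exact: measurable_funX.
by move=> x _ /=; rewrite lee_fin !normrX lerXn2r ?nnegrE.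
Qed.

Lemma L2_bounded_mul (b : T -> R) (M : R) f : measurable_fun setT b ->
  (forall x, `|b x| <= M) -> L2 mu f -> L2 mu (fun x => b x * f x).
Proof.
move=> mb bM f2; apply: (@L2_le _ (fun x => M * f x)); last exact: L2Z.
  by apply: measurable_funM => //; exact: L2_measurable.
move=> x; rewrite !normrM ler_wpM2r//.
by rewrite (le_trans (bM x))// ler_norm.
Qed.

Definition inner f g := \int[mu]_x (f x * g x).

Lemma ipC f g : inner f g = inner g f.
Proof. by apply: eq_Rintegral => x _; rewrite mulrC. Qed.

Lemma ipDl f g h : L2 mu f -> L2 mu g -> L2 mu h ->
  inner (fun x => f x + g x) h = inner f h + inner g h.
Proof.
move=> f2 g2 h2; rewrite /inner -RintegralD//; try exact: L2_mul.
by apply: eq_Rintegral => x _; rewrite mulrDl.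
Qed.

Lemma ipZl c f h : L2 mu f -> L2 mu h -> inner (fun x => c * f x) h = c * inner f h.
Proof.
move=> f2 h2; rewrite /inner -RintegralZl//; try exact: L2_mul.
by apply: eq_Rintegral => x _; rewrite mulrA.
Qed.

Lemma ipBl f g h : L2 mu f -> L2 mu g -> L2 mu h ->
  inner (fun x => f x - g x) h = inner f h - inner g h.
Proof.
move=> f2 g2 h2; rewrite /inner -RintegralB//; try exact: L2_mul.
by apply: eq_Rintegral => x _; rewrite mulrBl.
Qed.

Lemma ipDr f g h : L2 mu f -> L2 mu g -> L2 mu h ->
  inner h (fun x => f x + g x) = inner h f + inner h g.
Proof. by move=> *; rewrite ipC ipDl// !(ipC h). Qed.

Lemma ipBr f g h : L2 mu f -> L2 mu g -> L2 mu h ->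
  inner h (fun x => f x - g x) = inner h f - inner h g.
Proof. by move=> *; rewrite ipC ipBl// !(ipC h). Qed.

Lemma ipZr c f h : L2 mu f -> L2 mu h -> inner h (fun x => c * f x) = c * inner h f.
Proof. by move=> *; rewrite ipC ipZl// (ipC h). Qed.

Lemma ip_suml (I : Type) (s : seq I) (F : I -> T -> R) h :
  (forall i, L2 mu (F i)) -> L2 mu h ->
  inner (fun x => \sum_(i <- s) F i x) h = \sum_(i <- s) inner (F i) h.
Proof.
move=> F2 h2; elim: s => [|i s ih].
  rewrite big_nil /inner /Rintegral.
  under eq_integral do rewrite big_nil mul0r.
  by rewrite integral0.
rewrite big_cons -ih -ipDl//; last exact: L2_sum.
by apply: eq_Rintegral => x _; rewrite big_cons.
Qed.

Lemma ip_ge0 f : 0 <= inner f f.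
Proof. by apply: Rintegral_ge0 => x _; rewrite -expr2 sqr_ge0. Qed.

Lemma eq_ip f g f' g' : f =1 f' -> g =1 g' -> inner f g = inner f' g'.
Proof. by move=> ff gg; apply: eq_Rintegral => x _; rewrite ff gg. Qed.

Lemma ae_eq_ip f g f' g' : L2 mu f -> L2 mu g -> L2 mu f' -> L2 mu g' ->
  f = f' %[ae mu] -> g = g' %[ae mu] -> inner f g = inner f' g'.
Proof.
move=> f2 g2 f2' g2' ff gg; congr fine; apply: ae_eq_integral => //.
- exact: measurable_int (L2_mul f2 g2).
- exact: measurable_int (L2_mul f2' g2').
- by near=> x => _ /=; congr EFin; congr (_ * _); near: x;
   [apply: filterS ff => x /(_ I)|apply: filterS gg => x /(_ I)].
Unshelve. all: by end_near. Qed.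

Lemma ip_sqrD (c : R) f g : L2 mu f -> L2 mu g ->
  inner (fun x => f x + c * g x) (fun x => f x + c * g x) =
  inner f f + c * inner f g *+ 2 + c ^+ 2 * inner g g.
Proof.
move=> f2 g2; have g2' := L2Z c g2.
have s2 := L2D f2 g2'.
by rewrite ipDl// !ipDr// !ipZl// !ipZr// (ipC g f); ring.
Qed.

Lemma ip_sqrB f g : L2 mu f -> L2 mu g ->
  inner (fun x => f x - g x) (fun x => f x - g x) =
  inner f f - inner f g *+ 2 + inner g g.
Proof.
move=> f2 g2; have s2 := L2B f2 g2.
by rewrite ipBl// !ipBr// (ipC g f); ring.
Qed.

(** The minimiser [t = - b / c] gives the claim when [c] is positive. Stated for bare numbers
    because it is applied to the inner product, to the form of [A - a], and to a minimising sequence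
    that only nearly attains its infimum. *)
Lemma disc_le0 (a b c : R) : 0 <= c ->
  (forall t : R, 0 <= a + t * b *+ 2 + t ^+ 2 * c) -> b ^+ 2 <= a * c.
Proof.
move=> c0 h; have [c00|cn0] := eqVneq c 0.
  rewrite {}c00 in h *; have [->|bn0] := eqVneq b 0.
    by rewrite expr0n mulr0.
  (* At this [t] the function, now affine, equals [- a - 2], while [t = 0] gives [0 <= a]. *)
  have := h (- (a + 1) / b); have := h 0.
  rewrite mulfVK// mul0r mul0rn !mulr0 !addr0 mulr2n => h0 h1.
  by exfalso; lra.
have {c0 cn0} cp : 0 < c by rewrite lt_def cn0.
have := h (- b / c).
rewrite (_ : _ + _ = (a * c - b ^+ 2) / c); last first.
  by field; rewrite gt_eqF.
by rewrite pmulr_lge0 ?invr_gt0// subr_ge0.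
Qed.

Lemma ip_CS f g : L2 mu f -> L2 mu g -> inner f g ^+ 2 <= inner f f * inner g g.
Proof.
move=> f2 g2; apply: disc_le0 => [|t]; first exact: ip_ge0.
by rewrite -ip_sqrD// ip_ge0.
Qed.

Lemma L2_integral_sqr f : L2 mu f ->
  (\int[mu]_x (f x ^+ 2)%:E)%E = (inner f f)%:E.
Proof.
move=> f2; rewrite /inner /Rintegral fineK; last first.
  by apply: integrable_fin_num => //; exact: L2_mul.
by apply: eq_integral => x _; rewrite expr2.
Qed.

Lemma Lnorm2E f : L2 mu f -> 'N[mu]_2%:E[EFin \o f]%E = (Num.sqrt (inner f f))%:E.
Proof.
move=> f2; rewrite unlock; under eq_integral do rewrite /= powR_mulrn// -normrX ger0_norm ?sqr_ge0//.
rewrite L2_integral_sqr//.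
by rewrite poweR_EFin powR12_sqrt// ip_ge0.
Qed.

End L2_space.

(** * Completeness of [L2] *)

Section L2_complete.
Context d (T : measurableType d) (R : realType) (mu : {measure set T -> \bar R}).
Implicit Types (f g h : T -> R) (u : nat -> T -> R).

(** Fatou's lemma for the squares: it yields at once that the limit is square-integrable and that
    the bound survives. *)
Lemma L2_fatou u f (e : R) : (forall n, measurable_fun setT (u n)) ->
  measurable_fun setT f ->
  (forall x, (u ^~ x) n @[n --> \oo] --> f x) ->
  (\forall n \near \oo, L2 mu (u n) /\ inner mu (u n) (u n) <= e) ->
  L2 mu f /\ inner mu f f <= e.
Proof.
move=> mu_ mf uf [N _ ue].
(* The shift by [N] discards the indices for which no bound is known. *)
pose F n x : \bar R := (u (n + N)%N x ^+ 2)%:E.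
have mF n : measurable_fun setT (F n).
  by apply/measurable_EFinP/measurable_funX.
have F0 n x : setT x -> (0 <= F n x)%E by move=> _; rewrite lee_fin sqr_ge0.
have Fe n : (\int[mu]_x F n x <= e%:E)%E.
  by have [? ?] := ue (n + N)%N (leq_addl _ _); rewrite L2_integral_sqr.
have limF x : limn_einf (F^~ x) = (f x ^+ 2)%:E.
  apply: (cvg_limn_einf_sup _).1; apply: cvg_EFin; first exact: nearW.
  rewrite (_ : fine \o _ = (fun n => u (n + N)%N x * u (n + N)%N x)).
    by rewrite expr2; apply: cvgM; rewrite (cvg_shiftn N (u ^~ x)); exact: uf.
  by apply/funext => n; rewrite /= expr2.
have fe : (\int[mu]_x (f x ^+ 2)%:E <= e%:E)%E.
  rewrite (eq_integral (fun x => limn_einf (F^~ x))); last by move=> x _; rewrite limF.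
  apply: (le_trans (fatou mu measurableT mF F0)).
  rewrite limn_einf_lim; apply: lime_le; first exact: is_cvg_einfs.
  by apply: nearW => n; apply: (@le_trans _ _ (\int[mu]_x F n x)%E) => //;
    apply: ereal_inf_lbound; exists n => /=.
have f2 : L2 mu f.
  apply/L2P; split => //; apply/integrableP; split.
    exact/measurable_EFinP/measurable_funX.
  rewrite (le_lt_trans _ (ltry e))//; apply: le_trans fe.
  rewrite le_eqVlt; apply/orP; left; apply/eqP; apply: eq_integral => x _ /=.
  by rewrite ger0_norm ?sqr_ge0.
by split => //; rewrite -lee_fin -L2_integral_sqr.
Qed.

(** Weighting the squared increments by [4 ^+ k] leaves integrals of size [(4 / 8) ^+ k], which are
    summable. The weighted series is therefore finite almost everywhere, and where it is finite the
    increments decay like [2 ^- k]. *)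
Lemma ae_cvg_rapid_L2 (v : nat -> T -> R) : (forall k, L2 mu (v k)) ->
  (forall k, inner mu (fun x => v k.+1 x - v k x) (fun x => v k.+1 x - v k x) <= 8^-1 ^+ k) ->
  {ae mu, forall x, cvgn (v ^~ x)}.
Proof.
move=> v2 vk; pose D k x := v k.+1 x - v k x.
have D2 k : L2 mu (D k) by exact: L2B.
pose F k x : \bar R := (4 ^+ k * D k x ^+ 2)%:E.
have mF k : measurable_fun setT (F k).
  apply/measurable_EFinP; apply: measurable_funM => //.
  by apply: measurable_funX; exact: L2_measurable (D2 k).
have p4 k : 0 <= 4 ^+ k :> R by rewrite exprn_ge0// ler0n.
have F0 k x : (0 <= F k x)%E by rewrite lee_fin mulr_ge0// sqr_ge0.
(* The bound is [2 ^- k], written as a term of the geometric series that is summed below. *)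
have iF k : (\int[mu]_x F k x <= (2 / (2 ^ (k + 1))%:R)%:E)%E.
  rewrite /F; under eq_integral do rewrite EFinM.
  rewrite ge0_integralZl//; last 2 first.
  - by apply/measurable_EFinP/measurable_funX; exact: L2_measurable (D2 k).
  - by move=> x _; rewrite lee_fin sqr_ge0.
  rewrite L2_integral_sqr// -EFinM lee_fin.
  apply: (@le_trans _ _ (4 ^+ k * 8^-1 ^+ k)).
    by rewrite ler_wpM2l//; exact: vk.
  rewrite -exprMn addn1 natrX exprS invfM mulrA divff// mul1r -exprVn le_eqVlt; apply/orP; left; apply/eqP.
  by congr (_ ^+ k); field.
pose G x := (\sum_(k <oo) F k x)%E.
have mG : measurable_fun setT G by exact: ge0_emeasurable_sum.
have iG : mu.-integrable setT G.
  apply/integrableP; split => //.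
  rewrite (eq_integral G); last first.
    by move=> x _; rewrite gee0_abs// nneseries_ge0.
  rewrite /G integral_nneseries//.
  apply: (@le_lt_trans _ _ (\sum_(k <oo) (2 / (2 ^ (k + 1))%:R)%:E)%E).
    apply: lee_nneseries => // k _ _; exact: integral_ge0.
  rewrite [X in (X < _)%E](_ : _ = (2 / 2 ^+ 0)%:E) ?ltry//.
  by apply/cvg_lim => //; exact: (@cvg_geometric_eseries_half R 2 0).
have := integrable_ae measurableT iG; apply: filterS => x /(_ I) Gx.
pose M := fine (G x).
have FM k : 4 ^+ k * D k x ^+ 2 <= M.
  rewrite -lee_fin /M fineK//; apply: (@le_trans _ _ (\sum_(0 <= i < k.+1) F i x)%E).
    by rewrite big_nat_recr//= leeDr// sume_ge0.
  exact: nneseries_lim_ge.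
have M0 : 0 <= M by rewrite fine_ge0// nneseries_ge0.
(* [M + 1] bounds the square root of [M]. *)
have DM k : `|D k x| <= geometric (M + 1) 2^-1 k.
  rewrite /geometric /=.
  have h : (2 ^+ k * `|D k x|) ^+ 2 <= (M + 1) ^+ 2.
    rewrite exprMn -normrX ger0_norm ?sqr_ge0// -exprM mulnC exprM.
    rewrite (_ : 2 ^+ 2 = 4 :> R); last by rewrite expr2; ring.
    by apply: le_trans (FM k) _; nra.
  rewrite exprVn ler_pdivlMr ?exprn_gt0// mulrC.
  rewrite -(@ler_pXn2r _ 2)// nnegrE ?addr_ge0//.
have : cvgn (series (telescope (v ^~ x))).
  apply: normed_cvg; apply: (@series_le_cvg _ _ (geometric (M + 1) 2^-1)).
  - by move=> n /=.
  - by move=> n; apply: geometric_ge0; rewrite ?invr_ge0// addr_ge0.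
  - by move=> n; exact: DM.
  - by apply: is_cvg_geometric_series; rewrite ger0_norm ?invr_ge0// invf_lt1// ltr1n.
move=> /cvg_ex[/= l dl]; apply/cvg_ex; exists (v 0 x + l).
rewrite (_ : (v ^~ x) = (fun n => v 0 x + series (telescope (v ^~ x)) n)).
  by apply: cvgD => //; exact: cvg_cst.
by apply/funext => n; rewrite -eq_sum_telescope.
Qed.

(** Riesz-Fischer: a rapidly converging subsequence has a limit almost everywhere, and Fatou's lemma
    for [u n - w k], as [k] grows, turns the Cauchy condition into convergence in norm. *)
Lemma L2_complete u : (forall n, L2 mu (u n)) ->
  (forall e, 0 < e -> exists N, forall m n, (N <= m)%N -> (N <= n)%N ->
    inner mu (fun x => u m x - u n x) (fun x => u m x - u n x) <= e) ->
  exists2 f, L2 mu f & forall e, 0 < e -> exists N, forall n, (N <= n)%N ->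
    inner mu (fun x => u n x - f x) (fun x => u n x - f x) <= e.
Proof.
move=> u2 cu.
have e0 k : 0 < 8^-1 ^+ k :> R by rewrite exprn_gt0// invr_gt0.
have [N Nk] := choice (fun k => cu _ (e0 k)).
(* Summing the thresholds makes the indices increase; the summand [k] added in [v] makes them
   unbounded. *)
pose n_ k := (\sum_(j < k.+1) N j)%N.
have nN k : (N k <= n_ k)%N by rewrite /n_ big_ord_recr/= leq_addl.
have nS k : (n_ k <= n_ k.+1)%N by rewrite /n_ [leqRHS]big_ord_recr/= leq_addr.
have nk k : (k <= n_ k + k)%N by exact: leq_addl.
pose v k := u (n_ k + k)%N.
have v2 k : L2 mu (v k) by exact: u2.
have [N0 [mN0 N00 sN0]] : {ae mu, forall x, cvgn (v ^~ x)}.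
  apply: ae_cvg_rapid_L2 => // k; apply: Nk.
    by rewrite (leq_trans (nN k))// (leq_trans (nS k))// leq_addr.
  by rewrite (leq_trans (nN k))// leq_addr.
have mC : measurable (~` N0) by exact: measurableC.
(* Setting [v k] to zero on the exceptional set makes it converge everywhere, so that the limit is
   measurable. *)
pose w k x := v k x * \1_(~` N0) x.
have mw k : measurable_fun setT (w k).
  by apply: measurable_funM; [exact: L2_measurable (v2 k)|exact: measurable_indic].
have vw k : ae_eq mu setT (v k) (w k).
  exists N0; split => // x /= h; apply: contrapT => xN; apply: h => _.
  by rewrite /w indicE mem_set// mulr1.
have w2 k : L2 mu (w k).
  apply: L2_le (v2 k) => // x; rewrite /w normrM ler_piMr//.
  by rewrite indicE; case: (_ \in _); rewrite ?normr1 ?normr0.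
pose f x := limn (w ^~ x).
have wf x : (w ^~ x) k @[k --> \oo] --> f x.
  have [xN|xN] := pselect (N0 x); last first.
    have h : cvgn (v ^~ x) by apply: contrapT => h; apply: xN; exact: sN0.
    rewrite /f (_ : w ^~ x = v ^~ x)//.
    by apply/funext => k; rewrite /w indicE mem_set// mulr1.
  rewrite /f (_ : w ^~ x = cst 0); first exact: is_cvg_cst.
  by apply/funext => k; rewrite /w indicE memNset// mulr0.
have mf : measurable_fun setT f.
  by apply: (measurable_fun_cvg mw) => x _; exact: wf.
have key e : 0 < e -> exists K, forall n, (K <= n)%N ->
    L2 mu (fun x => u n x - f x) /\
    inner mu (fun x => u n x - f x) (fun x => u n x - f x) <= e.
  move=> e_gt0; have [K Ke] := cu _ e_gt0; exists K => n Kn.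
  apply: (@L2_fatou (fun k x => u n x - w k x)).
  - by move=> k; apply: measurable_funB => //; exact: L2_measurable (u2 n).
  - by apply: measurable_funB => //; exact: L2_measurable (u2 n).
  - by move=> x; apply: cvgB; [exact: cvg_cst|exact: wf].
  exists K => // k /= Kk; split; first exact: L2B.
  rewrite (@ae_eq_ip _ _ _ _ _ _ (fun x => u n x - v k x) (fun x => u n x - v k x)).
  - by apply: Ke => //; rewrite (leq_trans Kk).
  1-4: exact: L2B.
  1-2: by apply: filterS (vw k) => x /(_ I) h _; rewrite h.
have [K Kn] := key _ ltr01.
exists f.
  rewrite (_ : f = (fun x => u K x - (u K x - f x))).
    by apply: L2B => //; exact: (Kn K (leqnn K)).1.
  by apply/funext => x; rewrite subKr.
by move=> e /key[{}K {}Kn]; exists K => n /Kn[].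
Qed.

End L2_complete.

(** * Integrals under measure-preserving maps *)

Section measure_preserving.
Context d (T : measurableType d) (R : realType) (mu : {measure set T -> \bar R}).
Variable phi : T -> T.
Hypothesis mphi : measurable_fun setT phi.
Hypothesis mp : forall A, measurable A -> mu (phi @^-1` A) = mu A.

Lemma ge0_integral_mp (f : T -> \bar R) : measurable_fun setT f ->
  (forall x, 0 <= f x)%E -> (\int[mu]_x f (phi x) = \int[mu]_x f x)%E.
Proof.
move=> mf f0.
rewrite -[LHS](ge0_integral_pushforward mphi mu measurableT mf)//.
by apply: eq_measure_integral => A mA _; exact: mp.
Qed.

Lemma integrable_mp (f : T -> \bar R) : mu.-integrable setT f ->
  mu.-integrable setT (f \o phi).
Proof.
move=> /integrableP[mf fi]; apply/integrableP; split.
  exact: measurableT_comp.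
rewrite (ge0_integral_mp (f := fun x => `|f x|%E))//.
exact: measurableT_comp.
Qed.

Lemma Rintegral_mp (f : T -> R) : mu.-integrable setT (EFin \o f) ->
  \int[mu]_x f (phi x) = \int[mu]_x f x.
Proof.
move=> fi; congr fine.
transitivity (\int[pushforward mu phi]_x (f x)%:E)%E; last first.
  by apply: eq_measure_integral => A mA _; exact: mp.
apply/esym; apply: (@integral_pushforward _ _ _ _ _ _ mphi mu setT (EFin \o f)) => //.
- exact: measurable_int fi.
- by rewrite preimage_setT; exact: integrable_mp.
Qed.

Lemma L2_mp f : L2 mu f -> L2 mu (f \o phi).
Proof.
move=> /L2P[mf fi]; apply/L2P; split; first exact: measurableT_comp.
exact: (integrable_mp fi).
Qed.

Lemma ip_mp f g : L2 mu f -> L2 mu g -> inner mu (f \o phi) (g \o phi) = inner mu f g.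
Proof.
by move=> f2 g2; exact: (Rintegral_mp (f := fun x => f x * g x) (L2_mul f2 g2)).
Qed.

End measure_preserving.

(** * Lebesgue measure and the norm of R^n *)

Section lebesgue_rV_translation.
Context {R : realType}.
Local Notation leb := (@lebesgue_measure R).

Lemma measurable_shiftR (a : R) :
  measurable_fun setT (fun x : measurableTypeR R => x + a : measurableTypeR R).
Proof. exact: measurable_funD. Qed.

(** The image measure agrees with Lebesgue measure on half-open intervals, which determine it. *)
Lemma lebesgue_measure_shift (a : R) (A : set (measurableTypeR R)) : measurable A ->
  leb ((fun x => x + a) @^-1` A) = leb A.
Proof.
move=> mA; apply/esym.
apply: (@lebesgue_measure_unique _
  (measure_function_pushforward__canonical__measure_function_Measure
    leb (measurable_shiftR a))) => //= _ [[u v]] _ <-.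
rewrite /pushforward.
rewrite [X in _ = leb X](_ : _ = `]u - a, v - a]%classic); last first.
  by apply/seteqP; split => x /=; rewrite !in_itv/= ltrBlDr lerBrDr.
by rewrite !lebesgue_measure_itv/= !lte_fin ltrD2r !EFinN !EFinD; case: ifPn => // _;
  rewrite -!EFinD; congr EFin; ring.
Qed.

Lemma measurable_shift_rV n (a : 'rV[R]_n) :
  measurable_fun setT (fun x : 'rV[R]_n => x + a).
Proof.
apply: measurable_fun_rV => i.
rewrite (_ : (fun x : 'rV[R]_n => _) = (fun x : 'rV[R]_n => x ord0 i + a ord0 i)).
  by apply: measurable_funD => //; exact: measurable_rV_coord.
by apply/funext => x; rewrite mxE.
Qed.

(** Induction on the dimension: the outer integral absorbs the translation of the first coordinate,
    and the induction hypothesis applies to every section. *)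
Lemma lebesgue_rV_shift n (a : 'rV[R]_n) (A : set 'rV[R]_n) : measurable A ->
  lebesgue_rV n ((fun x => x + a) @^-1` A) = lebesgue_rV n A.
Proof.
elim: n a A => [|n ih] a A mA.
  by congr (lebesgue_rV 0 _); apply/seteqP; split => x;
    rewrite /preimage/= (thinmx0 (x + a)) (thinmx0 x).
have [b ->] : exists b, a = cons_rV b by exists (behead_rV a); rewrite behead_rVK.
rewrite /= /lebesgue_rV_step /pushforward /product_measure1.
pose g t := lebesgue_rV n (xsection (@cons_rV R n @^-1` A) t).
have mcA : measurable (@cons_rV R n @^-1` A).
  by rewrite -[X in measurable X]setTI; exact: measurable_cons_rV.
have mg : measurable_fun setT g by exact: measurable_fun_xsection.
transitivity (\int[leb]_t g (t + b.1)%R)%E; last first.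
  apply: (@ge0_integral_mp _ _ _ leb (fun t : measurableTypeR R => t + b.1) _ _ g) => //.
  - exact: measurable_shiftR.
  - by move=> B mB; exact: lebesgue_measure_shift.
apply: eq_integral => t _ /=; rewrite /g.
rewrite -(ih b.2 (xsection (@cons_rV R n @^-1` A) (t + b.1))); last exact: measurable_xsection.
congr (lebesgue_rV n _); apply/seteqP; split => x;
  rewrite /xsection/= !inE /preimage/=.
all: rewrite (_ : cons_rV (t, x) + cons_rV b = cons_rV (t + b.1, x + b.2))//.
all: by apply/rowP => i; rewrite !mxE; case: unliftP => [j _|_] //=; rewrite !mxE.
Qed.

End lebesgue_rV_translation.

Section rV_norm.
Context {R : realType}.
Implicit Type n : nat.

Lemma normrV_le n (x : 'rV[R]_n) (M : R) : 0 <= M ->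
  (`|x| <= M) <-> (forall i, `|x ord0 i| <= M).
Proof.
move=> M0; rewrite [`|x|]mx_normrE; split=> [h i|h].
  by apply: le_trans h; apply/bigmax_geP; right; exists (ord0, i).
by apply/bigmax_leP; split => // -[i j] _ /=; rewrite (ord1 i).
Qed.

Lemma coord_le_norm n (x : 'rV[R]_n) i : `|x ord0 i| <= `|x|.
Proof. exact: (normrV_le x (normr_ge0 x)).1. Qed.

Lemma norm_delta_mx n (i : 'I_n) : `|delta_mx 0 i : 'rV[R]_n| = 1.
Proof.
apply/le_anti; apply/andP; split.
  apply/(normrV_le _ ler01) => j; rewrite mxE/=.
  by case: (j == i); rewrite ?normr1 ?normr0.
by apply: le_trans (coord_le_norm _ i); rewrite mxE !eqxx normr1.
Qed.

(** The norm of ['rV[R]_n] is the maximum norm, so this ball is a cube and its volume is a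
    product. *)
Definition cball n (M : R) := [set x : 'rV[R]_n | `|x| <= M].
Arguments cball : clear implicits.

Lemma cball_setX n M : 0 <= M ->
  @cons_rV R n @^-1` cball n.+1 M = `[- M, M]%classic `*` cball n M.
Proof.
move=> M0; apply/seteqP; split=> [[t x]|[t x] []] /=; rewrite /cball /= in_itv/= -ler_norml.
  move/(normrV_le _ M0) => h; split.
    by have := h ord0; rewrite mxE unlift_none.
  by apply/(normrV_le _ M0) => i; have := h (lift ord0 i); rewrite mxE liftK.
move=> tM /(normrV_le _ M0) xM; apply/(normrV_le _ M0) => i; rewrite mxE.
by case: unliftP => [j _|_] //=.
Qed.

Lemma measurable_cball n M : measurable (cball n M).
Proof.
have [M0|M0] := leP 0 M; last first.
  rewrite (_ : cball n M = set0)//; apply/seteqP; split => x //=.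
  by rewrite /cball/= leNgt (lt_le_trans M0).
rewrite (_ : cball n M = \bigcap_(i in [set: 'I_n])
    ((fun x : 'rV[R]_n => x ord0 i) @^-1` `[- M, M]%classic)).
  apply: fin_bigcap_measurable => // i _; rewrite -[X in measurable X]setTI.
  by apply: measurable_rV_coord => //; exact: measurable_itv.
apply/seteqP; split=> [x /(normrV_le _ M0) h i _ /=|x h /=].
  by rewrite in_itv/= -ler_norml.
by apply/(normrV_le _ M0) => i; have := h i I; rewrite /= in_itv/= -ler_norml.
Qed.

Lemma lebesgue_rV_cball n M : 0 <= M ->
  lebesgue_rV n (cball n M) = ((M *+ 2) ^+ n)%:E.
Proof.
move=> M0; elim: n => [|n ih].
  rewrite /= diracE mem_set//= /cball /= (_ : `|_| = 0)//.
  by apply/eqP; rewrite normr_eq0.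
rewrite /= /lebesgue_rV_step /pushforward cball_setX// product_measure1E//; last exact: measurable_cball.
rewrite ih -[X in (X * _)%E]/(lebesgue_measure (`[- M, M]%classic : set R)).
rewrite lebesgue_measure_itv/= lte_fin.
case: ltP => [_|h].
  by rewrite -EFinD -EFinM exprS opprK mulr2n.
have M00 : M = 0 by apply/eqP; rewrite eq_le M0 andbT; lra.
by rewrite mul0e M00 mul0rn exprS mul0r.
Qed.

End rV_norm.
Arguments cball {R} n M.

(** * Rounding to the lattice, and measurability of continuous functions *)

Section floor.
Context {R : realType} (n : nat) (theta : R).
Hypothesis theta_gt0 : 0 < theta.

Definition lfloor (x : 'rV[R]_n) : lattice n :=
  (\row_i Num.floor (x ord0 i / theta) : 'rV[int]_n).

Definition lpoint (k : lattice n) : 'rV[R]_n := theta *: map_mx intr (k : 'rV[int]_n).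

(** The cells are half-open, so that every point belongs to exactly one of them; this makes them a
    partition of the space. *)
Lemma lfloorP (x : 'rV[R]_n) (k : lattice n) : lfloor x = k <->
  forall i, 0 <= (x - lpoint k) ord0 i < theta.
Proof.
have E i : (0 <= (x - lpoint k) ord0 i < theta) =
    (Num.floor (x ord0 i / theta) == (k : 'rV[int]_n) ord0 i).
  rewrite floor_eq !mxE subr_ge0 ler_pdivlMr// ltr_pdivrMr// (mulrC _ theta).
  by rewrite intrD mulrDl mul1r ltrBlDl mulrC.
split=> [lk i|h]; first by rewrite E -lk mxE.
by apply/rowP => i; rewrite mxE; apply/eqP; rewrite -E.
Qed.

Lemma measurable_lfloor_eq k : measurable (lfloor @^-1` [set k]).
Proof.
rewrite (_ : _ @^-1` _ = \bigcap_(i in [set: 'I_n])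
    ((fun x : 'rV[R]_n => x ord0 i) @^-1` `[lpoint k ord0 i, lpoint k ord0 i + theta[%classic)).
  apply: fin_bigcap_measurable => // i _; rewrite -[X in measurable X]setTI.
  by apply: measurable_rV_coord => //; exact: measurable_itv.
apply/seteqP; split=> [x /lfloorP h i _|x h].
  by have := h i; rewrite /= in_itv/= !mxE subr_ge0 ltrBlDl.
by apply/lfloorP => i; have := h i I; rewrite /= in_itv/= !mxE subr_ge0 ltrBlDl.
Qed.

Lemma measurable_lfloor : measurable_fun setT (lfloor : 'rV[R]_n -> lattice n).
Proof.
move=> _ A _; rewrite setTI.
rewrite (_ : _ @^-1` _ = \bigcup_k (if k \in A then lfloor @^-1` [set k] else set0)).
  apply: countable_bigcupT_measurable => [|k].
    exact: (@countableP _ [set: 'rV[int]_n]).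
  by case: ifP => _; [exact: measurable_lfloor_eq|exact: measurable0].
apply/seteqP; split=> [x /= Ax|x [k _]].
  by exists (lfloor x) => //; rewrite mem_set.
by case: ifPn => //; rewrite inE => Ak /= ->.
Qed.

Lemma lfloor_dist (x : 'rV[R]_n) : `|x - lpoint (lfloor x)| <= theta.
Proof.
apply/(normrV_le _ (ltW theta_gt0)) => i.
have /lfloorP/(_ i)/andP[h0 h1] := erefl (lfloor x).
by rewrite ger0_norm// ltW.
Qed.

End floor.

Section continuous_rV.
Context {R : realType} (n : nat).

(** The sigma-algebra is the one generated by the coordinates, so openness of preimages does not by
    itself give measurability. Instead [u] is the pointwise limit of its values at the corners of
    cells of side [1 / (m + 1)], which factor through the countable lattice. *)
Lemma continuous_measurable_rV (u : 'rV[R]_n -> R) : continuous u ->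
  measurable_fun setT u.
Proof.
move=> cu.
have th0 (m : nat) : (0 : R) < m.+1%:R^-1 by rewrite invr_gt0 ltr0n.
pose h m (x : 'rV[R]_n) := u (lpoint (m.+1%:R^-1) (lfloor (m.+1%:R^-1) x)).
apply: (@measurable_fun_cvg _ _ _ setT h) => [m|x _].
  have mu : measurable_fun setT (fun k : lattice n => u (lpoint m.+1%:R^-1 k)) by [].
  exact: (measurableT_comp mu (measurable_lfloor (th0 m))).
apply: (@cvg_comp _ _ _ (fun m => lpoint (m.+1%:R^-1) (lfloor (m.+1%:R^-1) x)) u).
  2: exact: cu.
apply/cvgrPdist_le => /= e e0.
near=> m; apply: le_trans (lfloor_dist (th0 m) x) _.
by near: m; have := near_infty_natSinv_lt (PosNum e0); apply: filterS => m /ltW.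
Unshelve. all: by end_near. Qed.

End continuous_rV.

(** * Smooth functions and test functions *)

Section smooth.
Context {R : realType} {n : nat}.
Implicit Types (u v w : 'rV[R]_n -> R) (i : 'I_n).

Definition dirder u (x v : 'rV[R]_n) (l : R) :=
  is_derive x v (u : 'rV[R]_n -> R^o) l.

(** Restriction to a line reduces the chain rule and the mean value theorem to functions of one
    variable. *)
Lemma dirder_line u (x v : 'rV[R]_n) (t l : R) :
  dirder u (x + t *: v) v l <-> is_derive t 1 (fun s => u (x + s *: v)) l.
Proof.
have E : (fun h : R => h^-1 *: (((u : _ -> R^o) \o shift (x + t *: v)) (h *: v) -
      u (x + t *: v))) =
    (fun h : R => h^-1 *: (((fun s => u (x + s *: v)) \o shift t) (h *: 1) -
      u (x + t *: v))).
  by apply/funext => h /=; rewrite [h%:A]mulr1 scalerDl addrCA.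
split=> -[d1 d2]; apply: DeriveDef.
- by move: d1; rewrite /derivable E.
- by rewrite -d2 /derive E.
- by move: d1; rewrite /derivable E.
- by rewrite -d2 /derive E.
Qed.

Lemma dirder_line0 u (x v : 'rV[R]_n) (l : R) :
  dirder u x v l <-> is_derive (0 : R) (1 : R) (fun s => u (x + s *: v)) l.
Proof. by rewrite -dirder_line scale0r addr0. Qed.

Definition smooth u := forall s,
  (forall i x, derivable (partials s u : 'rV[R]_n -> R^o) x (delta_mx 0 i)) /\
  continuous (partials s u).

(** A coinduction principle: smoothness concerns all iterated derivatives, so it suffices to exhibit
    a class of continuous functions that is closed under each partial derivative. The closure
    properties below each name such a class. *)
Lemma smooth_coind (P : ('rV[R]_n -> R) -> Prop) :
  (forall u, P u -> continuous u /\ forall i, exists2 v, P v &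
    forall x, dirder u x (delta_mx 0 i) (v x)) ->
  forall u, P u -> smooth u.
Proof.
move=> HP u Pu.
have E w i v : (forall x, dirder w x (delta_mx 0 i) (v x)) -> partial i w = v.
  by move=> h; apply/funext => x; rewrite /partial; have [_ ->] := h x.
have Ps s : P (partials s u).
  elim: s => //= i s /HP[_ /(_ i)[v Pv /E]].
  by rewrite /partials => ->.
move=> s; have [cs ds] := HP _ (Ps s); split => // i x.
by have [v _ /(_ x)[]] := ds i.
Qed.

Lemma smooth_continuous u : smooth u -> continuous u.
Proof. by move=> /(_ [::])[]. Qed.
Arguments smooth_continuous [u] _ _.

Lemma smooth_partial i u : smooth u -> smooth (partial i u).
Proof.
move=> su s; have := su (rcons s i).
by rewrite /partials foldr_rcons.
Qed.

Lemma smooth_partials s u : smooth u -> smooth (partials s u).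
Proof. by elim: s => //= i s ih /ih /smooth_partial. Qed.

Lemma smooth_dirder u i x : smooth u -> dirder u x (delta_mx 0 i) (partial i u x).
Proof. by move=> /(_ [::])[/(_ i x) + _] => /derivableP. Qed.

Lemma partialE u i v : (forall x, dirder u x (delta_mx 0 i) (v x)) -> partial i u = v.
Proof. by move=> h; apply/funext => x; rewrite /partial; have [_ ->] := h x. Qed.

Lemma dirder_cst (c : R) (x v : 'rV[R]_n) : dirder (cst c) x v 0.
Proof. exact: is_derive_cst. Qed.

Lemma dirderD u v (x e : 'rV[R]_n) a b : dirder u x e a -> dirder v x e b ->
  dirder (fun x => u x + v x) x e (a + b).
Proof. by move=> h1 h2; exact: is_deriveD. Qed.

Lemma dirderZ u (c : R) (x e : 'rV[R]_n) a : dirder u x e a ->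
  dirder (fun x => c * u x) x e (c * a).
Proof. by move=> h1; exact: (is_deriveZ (f := u : _ -> R^o)). Qed.

Lemma dirderM u v (x e : 'rV[R]_n) a b : dirder u x e a -> dirder v x e b ->
  dirder (fun x => u x * v x) x e (a * v x + u x * b).
Proof.
move=> h1 h2; rewrite [a * _ + _]addrC [a * _]mulrC.
exact: (is_deriveM (f := u) (g := v)).
Qed.

Lemma dirder_affine u (c : R) (a x e : 'rV[R]_n) l : dirder u (c *: x + a) e l ->
  dirder (fun x => u (c *: x + a)) x e (c * l).
Proof.
move=> /dirder_line0 h; apply/dirder_line0.
rewrite (_ : (fun _ => _) =
    (fun s => u (c *: x + a + s *: e)) \o (fun s : R => c * s)); last first.
  by apply/funext => s /=; rewrite scalerDr scalerA addrAC.
rewrite mulrC; apply: is_derive1_comp; first by rewrite mulr0.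
rewrite -[X in is_derive _ _ _ X]mulr1.
exact: (is_deriveZ (f := (@id R))).
Qed.

Lemma smooth_cst (c : R) : smooth (cst c).
Proof.
apply: (smooth_coind (P := fun u => exists c, u = cst c)); last by exists c.
move=> _ [{}c ->]; split=> [|i]; first exact: cst_continuous.
by exists (cst 0); [exists 0|move=> x; exact: dirder_cst].
Qed.

Lemma smoothD u v : smooth u -> smooth v -> smooth (fun x => u x + v x).
Proof.
move=> su sv; apply: (smooth_coind (P := fun w => exists2 p, smooth p.1 /\ smooth p.2
  & w = fun x => p.1 x + p.2 x)); last by exists (u, v).
move=> _ [[{su} {}u {sv} {}v] /= [su sv] ->] /=; split=> [x|i].
  exact: (continuousD (smooth_continuous su x) (smooth_continuous sv x)).
exists (fun x => partial i u x + partial i v x).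
  by exists (partial i u, partial i v) => //; split; exact: smooth_partial.
by move=> x; apply: dirderD; exact: smooth_dirder.
Qed.

Lemma continuous_affine (c : R) (a : 'rV[R]_n) : 
  continuous (fun x : 'rV[R]_n => c *: x + a : 'rV[R]_n).
Proof.
move=> x; apply: (@continuousD R 'rV[R]_n 'rV[R]_n); last exact: cst_continuous.
exact: scaler_continuous.
Qed.

Lemma smooth_affine u (k c : R) (a : 'rV[R]_n) : smooth u ->
  smooth (fun x => k * u (c *: x + a)).
Proof.
move=> su; apply: (smooth_coind (P := fun w => exists2 p, smooth p.1
  & w = fun x => p.2 * p.1 (c *: x + a))); last by exists (u, k).
move=> _ [[{su} {}u {}k] /= su ->] /=; split=> [x|i].
  have cu := continuous_comp (@continuous_affine c a x)
    (smooth_continuous su (c *: x + a)).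
  exact: (continuousM (@cst_continuous _ _ k x) cu).
exists (fun x => (k * c) * partial i u (c *: x + a)).
  by exists (partial i u, k * c) => //; exact: smooth_partial.
move=> x; rewrite -mulrA; apply: dirderZ; apply: dirder_affine; exact: smooth_dirder.
Qed.

Lemma smoothZ u (k : R) : smooth u -> smooth (fun x => k * u x).
Proof.
move=> su; have := smooth_affine k 1 0 su.
by under eq_fun do rewrite scale1r addr0.
Qed.

Lemma smoothB u v : smooth u -> smooth v -> smooth (fun x => u x - v x).
Proof.
move=> su sv; rewrite (_ : (fun _ => _) = (fun x => u x + -1 * v x)).
  by apply: smoothD => //; exact: smoothZ.
by apply/funext => x; rewrite mulN1r.
Qed.

(** The Leibniz rule turns a product of iterated derivatives into a sum of two such products, so
    this class is closed under differentiation. *)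
Inductive product_class u v : ('rV[R]_n -> R) -> Prop :=
| product_class_mul s t : product_class u v (fun x => partials s u x * partials t v x)
| product_class_add f g : product_class u v f -> product_class u v g ->
    product_class u v (fun x => f x + g x).

Lemma smoothM u v : smooth u -> smooth v -> smooth (fun x => u x * v x).
Proof.
move=> su sv; apply: (smooth_coind (P := product_class u v)); last first.
  exact: (product_class_mul u v [::] [::]).
move=> w; elim=> {w} [s t|f g cf [ctf df] cg [ctg dg]].
  split=> [x|i].
    exact: (continuousM ((su s).2 x) ((sv t).2 x)).
  exists (fun x => partials (i :: s) u x * partials t v x +
                   partials s u x * partials (i :: t) v x).
    by apply: product_class_add; exact: product_class_mul.
  by move=> x; apply: dirderM; apply: smooth_dirder; exact: smooth_partials.
split=> [x|i]; first exact: (continuousD (ctf x) (ctg x)).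
have [f' cf' hf'] := df i; have [g' cg' hg'] := dg i.
exists (fun x => f' x + g' x); first exact: product_class_add.
by move=> x; exact: dirderD.
Qed.

Lemma smooth_prod (I : Type) (r : seq I) (F : I -> 'rV[R]_n -> R) :
  (forall k, smooth (F k)) -> smooth (fun x => \prod_(k <- r) F k x).
Proof.
move=> sF; elim: r => [|k r ih].
  rewrite (_ : (fun _ => _) = cst 1); first exact: smooth_cst.
  by apply/funext => x; rewrite big_nil.
rewrite (_ : (fun _ => _) = (fun x => F k x * \prod_(j <- r) F j x)).
  exact: smoothM.
by apply/funext => x; rewrite big_cons.
Qed.

Lemma smooth_sum (I : Type) (r : seq I) (F : I -> 'rV[R]_n -> R) :
  (forall k, smooth (F k)) -> smooth (fun x => \sum_(k <- r) F k x).
Proof.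
move=> sF; elim: r => [|k r ih].
  rewrite (_ : (fun _ => _) = cst 0); first exact: smooth_cst.
  by apply/funext => x; rewrite big_nil.
rewrite (_ : (fun _ => _) = (fun x => F k x + \sum_(j <- r) F j x)).
  exact: smoothD.
by apply/funext => x; rewrite big_cons.
Qed.

End smooth.

Section test_functions.
Context {R : realType} {n : nat}.
Implicit Types (u v w : 'rV[R]_n -> R) (i : 'I_n).

Definition bsupp (M : R) u := forall x, M < `|x| -> u x = 0.

(** Closed bounded sets are compact in finite dimension, so compact support amounts to vanishing
    outside a ball; the explicit radius serves the norm estimates. *)
Lemma test_functionP u : test_function u <->
  smooth u /\ exists2 M : R, 0 <= M & bsupp M u.
Proof.
split=> [[du cu /compact_bounded[M [_ uM]]]|[su [M M0 uM]]].
  split; first by move=> s.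
  (* The support is bounded by every number above [M], and [M] itself may be negative. *)
  exists `|M + 1| => // x Mx; apply: contrapT => /eqP ux.
  have : `|x| <= M + 1 by apply: uM; [rewrite ltrDl|exact: subset_closure].
  by apply/negP; rewrite -ltNge (le_lt_trans (ler_norm _)).
split; [by move=> s i x; exact: (su s).1|by move=> s; exact: (su s).2|].
have cl : closed [set x : 'rV[R]_n | `|x| <= M].
  apply: (@closed_comp _ _ (fun x : 'rV[R]_n => `|x|) [set t | t <= M]).
    by move=> x _; exact: norm_continuous.
  exact: closed_le.
have sub : closure [set x | u x != 0] `<=` [set x : 'rV[R]_n | `|x| <= M].
  move=> x; have /closure_id -> := cl; apply: closure_subset => y /= uy.
  by rewrite leNgt; apply/negP => /uM /eqP; exact/negP.
apply: bounded_closed_compact; last exact: closed_closure.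
exists M; split; first exact: num_real.
by move=> N MN x /sub /= /le_trans; apply; exact: ltW.
Qed.

Lemma bsupp_le (M N : R) u : M <= N -> bsupp M u -> bsupp N u.
Proof. by move=> MN h x Nx; apply: h; exact: le_lt_trans Nx. Qed.

Lemma bsupp_partial M u i : bsupp M u -> bsupp M (partial i u).
Proof.
move=> uM x Mx; rewrite /partial (@near_eq_derive _ _ R^o _ (cst 0)); last first.
  have op : open [set y : 'rV[R]_n | M < `|y|].
    apply: (@open_comp _ _ (fun x : 'rV[R]_n => `|x|) [set t | M < t]).
      by move=> y _; exact: norm_continuous.
    exact: open_gt.
  near=> y; apply: uM; near: y.
  exact: (open_nbhs_nbhs (conj op Mx)).
by rewrite derive_cst.
Unshelve. all: by end_near. Qed.

Lemma test_smooth u : test_function u -> smooth u.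
Proof. by move=> /test_functionP[]. Qed.

Lemma test_partial i u : test_function u -> test_function (partial i u).
Proof.
move=> /test_functionP[su [M M0 uM]]; apply/test_functionP.
by split; [exact: smooth_partial|exists M => //; exact: bsupp_partial].
Qed.

Lemma testM u v : smooth u -> test_function v -> test_function (fun x => u x * v x).
Proof.
move=> su /test_functionP[sv [M M0 vM]]; apply/test_functionP.
by split; [exact: smoothM|exists M => // x /vM ->; rewrite mulr0].
Qed.

Lemma testZ c u : test_function u -> test_function (fun x => c * u x).
Proof. by move=> tu; apply: testM tu; exact: smooth_cst. Qed.

Lemma testD u v : test_function u -> test_function v ->
  test_function (fun x => u x + v x).
Proof.
move=> /test_functionP[su [M M0 uM]] /test_functionP[sv [N N0 vN]].
apply/test_functionP; split; first exact: smoothD.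
exists (M + N); first exact: addr_ge0.
move=> x h; rewrite uM ?vN ?addr0//.
  by apply: le_lt_trans h; rewrite lerDr.
by apply: le_lt_trans h; rewrite lerDl.
Qed.

Lemma testB u v : test_function u -> test_function v ->
  test_function (fun x => u x - v x).
Proof.
move=> tu tv; rewrite (_ : (fun _ => _) = (fun x => u x + -1 * v x)).
  by apply: testD => //; exact: testZ.
by apply/funext => x; rewrite mulN1r.
Qed.

Lemma test_sum (I : Type) (r : seq I) (F : I -> 'rV[R]_n -> R) :
  (forall k, test_function (F k)) -> test_function (fun x => \sum_(k <- r) F k x).
Proof.
move=> tF; elim: r => [|k r ih].
  apply/test_functionP; split; last first.
    by exists 0 => // x _; rewrite big_nil.
  by apply: smooth_sum => k; exact: test_smooth.
rewrite (_ : (fun _ => _) = (fun x => F k x + \sum_(j <- r) F j x)).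
  exact: testD.
by apply/funext => x; rewrite big_cons.
Qed.

Lemma test_affine (c : R) (a : 'rV[R]_n) u : c != 0 ->
  test_function u -> test_function (fun x => u (c *: x + a)).
Proof.
move=> c0 /test_functionP[su [M M0 uM]]; apply/test_functionP; split.
  have := smooth_affine 1 c a su.
  by rewrite (_ : (fun _ => 1 * _) = (fun x => u (c *: x + a)))//;
    apply/funext => x; rewrite mul1r.
have cp : 0 < `|c| by rewrite normr_gt0.
exists ((M + `|a|) / `|c|); first by rewrite divr_ge0// addr_ge0.
move=> x; rewrite ltr_pdivrMr// => h; apply: uM.
rewrite -(ltrD2r `|a|); apply: (lt_le_trans h).
rewrite mulrC -normrZ -[X in `|X| <= _](addrK a).
by rewrite (le_trans (ler_normB _ _)).
Qed.

Lemma partial_affine i (c : R) (a : 'rV[R]_n) u : smooth u ->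
  partial i (fun x => u (c *: x + a)) = (fun x => c * partial i u (c *: x + a)).
Proof.
move=> su; apply: partialE => x; apply: dirder_affine; exact: smooth_dirder.
Qed.

End test_functions.

(** * A smooth bump and smooth approximations of orthants *)

Section flat_function.
Context {R : realType}.
Implicit Types (P : {poly R}) (t : R).

(* This class is closed under differentiation, [P = 1] being the usual smooth
   function vanishing on the negative half-line. *)
Definition flat P t : R := if 0 < t then P.[t^-1] * expR (- t^-1) else 0.

(** Monomials are bounded by raising [1 + x <= expR x], at [x = y / (k + 1)], to the power [k]; the
    denominator [k + 1] also covers the constant term. *)
Lemma poly_le_expR P : exists2 C : R, 0 <= C &
  forall y, 0 < y -> `|P.[y]| <= C * expR y.
Proof.
have mono (k : nat) (y : R) : 0 < y -> y ^+ k <= k.+1%:R ^+ k * expR y.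
  move=> y0; have k0 : 0 < k.+1%:R :> R by rewrite ltr0n.
  apply: (@le_trans _ _ (k.+1%:R ^+ k * expR (y / k.+1%:R) ^+ k)).
    rewrite -exprMn lerXn2r ?nnegrE ?(ltW y0)//.
    rewrite mulrC -ler_pdivrMr//; apply: le_trans (expR_ge1Dx _).
    by rewrite lerDr.
  rewrite ler_wpM2l ?exprn_ge0 ?ler0n// -expRM_natl ler_expR.
  rewrite -[leRHS]mulr1 mulrCA ler_wpM2l ?(ltW y0)//.
  by rewrite ler_pdivrMr// mul1r ler_nat.
exists (\sum_(k < size P) `|P`_k| * k.+1%:R ^+ k).
  by apply: sumr_ge0 => k _; rewrite mulr_ge0// exprn_ge0// ler0n.
move=> y y0; rewrite horner_coef; apply: (le_trans (ler_norm_sum _ _ _)).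
rewrite mulr_suml; apply: ler_sum => k _; rewrite normrM -mulrA ler_wpM2l//.
by rewrite ger0_norm ?exprn_ge0 ?(ltW y0)// mono.
Qed.

(** The exponential dominates ['X^2 * P], which leaves a factor [t ^+ 2]; a bound of second order
    makes the derivative at the origin vanish. *)
Lemma flat_le P : exists2 C : R, 0 <= C & forall t, `|flat P t| <= C * t ^+ 2.
Proof.
have [C C0 h] := poly_le_expR ('X^2 * P); exists C => // t; rewrite /flat.
case: ifPn => [t0|_]; last by rewrite normr0 mulr_ge0// sqr_ge0.
have ti : 0 < t^-1 by rewrite invr_gt0.
have := h _ ti; rewrite hornerM hornerXn normrM ger0_norm ?sqr_ge0// => {}h.
rewrite normrM (ger0_norm (expR_ge0 _)) expRN.
have e0 := expR_gt0 t^-1; rewrite ler_pdivrMr//.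
have -> : `|P.[t^-1]| = t ^+ 2 * (t^-1 ^+ 2 * `|P.[t^-1]|).
  by rewrite mulrA -exprMn divff ?gt_eqF// expr1n mul1r.
by rewrite (mulrC C) -(mulrA _ C) ler_wpM2l// sqr_ge0.
Qed.

(** Differentiating [P(1/t) exp(-1/t)] brings out [1/t^2] and replaces [P] by [P - P'], whence the
    new polynomial. *)
Lemma is_derive_flat P t :
  is_derive t 1 (flat P) (flat ('X^2 * (P - P^`())) t).
Proof.
have [t0|t0|t0] := ltgtP t 0.
- rewrite [flat ('X^2 * _) t]/flat ltNge (ltW t0)/=.
  apply: (@near_eq_is_derive _ _ _ (cst 0)).
  near=> s; rewrite /flat ltNge (_ : s <= 0)//=.
  by apply: ltW; near: s; exact: lt_nbhsl.
- pose g (y : R) : R := P.[y] * expR (- y).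
  have dg (y : R) : is_derive y (1 : R) g ((P^`().[y] - P.[y]) * expR (- y)).
    have d1 := is_derive_poly P y.
    have d2 : is_derive y (1 : R) (fun y => expR (- y)) (expR (- y) * -1).
      apply: is_derive1_comp.
    apply: (is_derive_eq (is_deriveM d1 d2)).
    by rewrite /GRing.scale/=; ring.
  have di : is_derive t (1 : R) (fun s : R => s^-1) (- t ^- 2).
    have tn0 : id t != 0 by rewrite gt_eqF.
    have := is_deriveV tn0 (is_derive_id t (1 : R)).
    by rewrite /GRing.scale/= mulr1.
  have H : is_derive t (1 : R) (g \o (fun s : R => s^-1)) (flat ('X^2 * (P - P^`())) t).
    apply: (is_derive_eq (is_derive1_comp (dg t^-1) di)).
    by rewrite /flat t0 hornerM hornerXn hornerD hornerN exprVn; ring.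
  apply: (near_eq_is_derive _ H).
  near=> s; rewrite /= /flat /g (_ : 0 < s)//.
  by near: s; exact: lt_nbhsr.
- rewrite t0 [flat ('X^2 * _) 0]/flat ltxx.
  have [C C0 h] := flat_le P.
  have lim0 : h^-1 *: ((flat P \o shift 0) (h *: (1 : R)) - flat P 0) @[h --> 0^'] --> (0 : R).
    apply/cvgr0Pnorm_le => e e0; near=> s.
    have s0 : s != 0 by near: s; exact: nbhs_dnbhs_neq.
    rewrite /= addr0 [s%:A]mulr1 [flat P 0]/flat ltxx subr0 normrM normfV.
    rewrite ler_pdivrMl ?normr_gt0//; apply: (le_trans (h s)).
    rewrite -[s ^+ 2]ger0_norm ?sqr_ge0// normrX expr2 mulrCA ler_wpM2l//.
    rewrite (@le_trans _ _ ((C + 1) * `|s|))//.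
      by rewrite ler_wpM2r// lerDl.
    rewrite -ler_pdivlMl ?ltr_wpDl//.
    near: s; apply: dnbhs0_le.
    by rewrite mulr_gt0 ?invr_gt0 ?ltr_wpDl.
  apply: DeriveDef; first by apply/cvg_ex; exists 0.
  exact: cvg_lim lim0.
Unshelve. all: by end_near. Qed.

End flat_function.

Lemma cvg_prod {R : realType} (I : Type) (r : seq I) (F : I -> nat -> R) (l : I -> R) :
  (forall i, F i m @[m --> \oo] --> l i) ->
  (\prod_(i <- r) F i m) @[m --> \oo] --> \prod_(i <- r) l i.
Proof.
move=> Fl; elim: r => [|i r ih].
  rewrite big_nil (_ : (fun _ => _) = cst 1); first exact: cvg_cst.
  by apply/funext => m; rewrite big_nil.
rewrite big_cons (_ : (fun _ => _) = (fun m => F i m * \prod_(j <- r) F j m)).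
  by apply: cvgM.
by apply/funext => m; rewrite big_cons.
Qed.

Section bump.
Context {R : realType} {n : nat}.
Implicit Types (P : {poly R}) (t : R) (x : 'rV[R]_n).

Lemma flat_continuous P : continuous (flat P).
Proof.
move=> t; apply: differentiable_continuous; apply/derivable1_diffP.
by have [] := is_derive_flat P t.
Qed.

Lemma smooth_flat_coord P (alpha beta : R) (i : 'I_n) :
  smooth (fun x : 'rV[R]_n => flat P (alpha * x ord0 i + beta)).
Proof.
apply: (smooth_coind (P := fun w => exists P, w = fun x => flat P (alpha * x ord0 i + beta))).
  move=> _ [{}P ->]; split=> [x|j].
    have c1 : continuous_at x (fun x : 'rV[R]_n => alpha * x ord0 i + beta).
      apply: (@continuousD R R^o 'rV[R]_n); last exact: cst_continuous.
      apply: continuousM; first exact: cst_continuous.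
      exact: coord_continuous.
    exact: (continuous_comp c1 (@flat_continuous P _)).
  exists (fun x => flat ((alpha * (i == j)%:R) *: ('X^2 * (P - P^`())))
    (alpha * x ord0 i + beta)).
    by eexists; reflexivity.
  move=> x; apply/dirder_line0.
  rewrite (_ : (fun _ => _) = flat P \o
      (fun s : R => alpha * (i == j)%:R * s + (alpha * x ord0 i + beta))); last first.
    by apply/funext => s; rewrite /= !mxE eqxx/=; congr flat; ring.
  set f := fun s : R => _.
  have H : is_derive (0 : R) (1 : R) f (alpha * (i == j)%:R * 1 + 0).
    exact: is_deriveD.
  have := @is_derive1_comp _ (flat P) f 0 _ _ (is_derive_flat P (f 0)) H.
  move=> /is_derive_eq; apply; rewrite /f.
  rewrite mulr0 add0r /flat; case: ifP => _; last by rewrite mul0r.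
  by rewrite hornerZ; ring.
by exists P.
Qed.

Local Notation fl := (flat (1 : {poly R})).

Lemma flat1_ge0 t : 0 <= fl t.
Proof. by rewrite /flat; case: ifP => // _; rewrite hornerC mul1r expR_ge0. Qed.

Lemma flat1_le1 t : fl t <= 1.
Proof.
rewrite /flat; case: ifPn => // t0.
by rewrite hornerC mul1r expR_le1 oppr_le0 invr_ge0 ltW.
Qed.

Lemma flat1_gt0 t : 0 < t -> 0 < fl t.
Proof. by rewrite /flat => ->; rewrite hornerC mul1r expR_gt0. Qed.

Lemma flat1_eq0 t : t <= 0 -> fl t = 0.
Proof. by rewrite /flat ltNge => ->. Qed.

(** A product over coordinates suits the maximum norm: it is positive inside the unit cube and zero
    outside. The two factors for each coordinate make it even, as mollifiers have to be. *)
Definition bump x : R := \prod_i (fl (1 - x ord0 i) * fl (1 + x ord0 i)).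

Lemma bump_ge0 x : 0 <= bump x.
Proof. by apply: prodr_ge0 => i _; rewrite mulr_ge0// flat1_ge0. Qed.

Lemma bump_gt0 x : `|x| < 1 -> 0 < bump x.
Proof.
move=> x1; apply: prodr_gt0 => i _.
have := le_lt_trans (coord_le_norm x i) x1; rewrite ltr_norml => /andP[h1 h2].
by rewrite mulr_gt0// flat1_gt0//; lra.
Qed.

Lemma bump_le1 x : bump x <= 1.
Proof.
apply: prodr_ile1 => i _; rewrite mulr_ge0 ?flat1_ge0//=.
by rewrite mulr_ile1 ?flat1_ge0 ?flat1_le1.
Qed.

Lemma bumpN x : bump (- x) = bump x.
Proof. by apply: eq_bigr => i _; rewrite mxE opprK mulrC. Qed.

Lemma bump_bsupp : bsupp 1 bump.
Proof.
move=> x x1; apply: contrapT => /eqP; apply/negP; rewrite negbK.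
have [i xi] : exists i, 1 <= `|x ord0 i|.
  apply: contrapT => /forallNP h; move: x1; apply/negP; rewrite -leNgt.
  by apply/(normrV_le _ ler01) => i; rewrite leNgt; apply/negP => /ltW; exact: h.
rewrite /bump (bigD1 i)//= mulf_eq0; apply/orP; left; rewrite mulf_eq0.
move: xi; rewrite ler_normr => /orP[] h.
  by rewrite flat1_eq0 ?eqxx// subr_le0.
by rewrite (flat1_eq0 (t := 1 + _)) ?eqxx ?orbT//; lra.
Qed.

Lemma smooth_bump : smooth bump.
Proof.
apply: smooth_prod => i; apply: smoothM.
  have := smooth_flat_coord 1 (-1) 1 i; congr smooth; apply/funext => x.
  by congr flat; ring.
have := smooth_flat_coord 1 1 1 i; congr smooth; apply/funext => x.
by congr flat; ring.
Qed.

Lemma test_bump : test_function bump.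
Proof.
by apply/test_functionP; split; [exact: smooth_bump|exists 1 => //; exact: bump_bsupp].
Qed.

(** A smooth stand-in for the indicator of the orthant [open_ray a], to which it converges as [m]
    grows. *)
Definition ray (a : 'rV[R]_n) (m : nat) x : R := \prod_i fl (m%:R * (x ord0 i - a ord0 i)).

Lemma smooth_ray a m : smooth (ray a m).
Proof.
apply: smooth_prod => i.
have := smooth_flat_coord 1 m%:R (- (m%:R * a ord0 i)) i; congr smooth; apply/funext => x.
by congr flat; ring.
Qed.

Lemma ray_ge0 a m x : 0 <= ray a m x.
Proof. by apply: prodr_ge0 => i _; exact: flat1_ge0. Qed.

Lemma ray_le1 a m x : ray a m x <= 1.
Proof. by apply: prodr_ile1 => i _; rewrite flat1_ge0 flat1_le1. Qed.

Definition open_ray (a : 'rV[R]_n) : set 'rV[R]_n := [set x | forall i, a ord0 i < x ord0 i].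

Lemma ray_cvg a x : ray a m x @[m --> \oo] --> (\1_(open_ray a) x : R).
Proof.
have [xa|xa] := pselect (open_ray a x); last first.
  rewrite indicE memNset//.
  have [i ai] : exists i, x ord0 i <= a ord0 i.
    apply: contrapT => /forallNP h; apply: xa => i.
    by rewrite ltNge; apply/negP; exact: h.
  rewrite (_ : (fun _ => _) = cst 0); first exact: cvg_cst.
  apply/funext => m; rewrite /ray (bigD1 i)//= flat1_eq0 ?mul0r//.
  by rewrite mulr_ge0_le0 ?subr_le0.
rewrite indicE mem_set//.
have : (\prod_(i < n) fl (m%:R * (x ord0 i - a ord0 i))) @[m --> \oo] -->
    (\prod_(i < n) (1 : R)).
  apply: cvg_prod => i.
  have c0 : 0 < x ord0 i - a ord0 i by rewrite subr_gt0.
  set c := x ord0 i - a ord0 i in c0 *.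
  (* Index [0] is skipped, because there the argument of [fl] is zero; afterwards each factor is an
     exponential that tends to [1]. *)
  rewrite -(cvg_shiftn 1) (_ : (fun _ => _) =
    (fun k => expR (- (c^-1 * k.+1%:R^-1)))); last first.
    apply/funext => k; rewrite /flat addn1 mulr_gt0// hornerC mul1r invfM mulrC.
    done.
  have e1 : expR (- (c^-1 * 0)) = 1 by rewrite mulr0 oppr0 expR0.
  suff : expR (- (c^-1 * k.+1%:R^-1)) @[k --> \oo] --> expR (- (c^-1 * 0)).
    by rewrite e1.
  apply: continuous_cvg; first exact: continuous_expR.
  apply: cvgN; apply: cvgM; first exact: cvg_cst.
  exact: cvg_harmonic.
by rewrite big1.
Qed.

End bump.

Section L2_norm.
Context d (T : measurableType d) (R : realType) (mu : {measure set T -> \bar R}).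
Implicit Types f g h : T -> R.

Lemma ip_le f g : L2 mu f -> L2 mu g -> (forall x, `|f x| <= `|g x|) ->
  inner mu f f <= inner mu g g.
Proof.
move=> f2 g2 fg; apply: le_Rintegral => //; try exact: L2_mul.
by move=> x _; rewrite -!expr2 -[leLHS]ger0_norm ?sqr_ge0// -[leRHS]ger0_norm
  ?sqr_ge0// !normrX lerXn2r ?nnegrE.
Qed.

Definition L2norm f := Num.sqrt (inner mu f f).

Lemma nrm_eq f g : inner mu f f = inner mu g g -> L2norm f = L2norm g.
Proof. by rewrite /L2norm => ->. Qed.

Lemma nrm_ge0 f : 0 <= L2norm f. Proof. exact: sqrtr_ge0. Qed.

Lemma sqr_nrm f : L2norm f ^+ 2 = inner mu f f.
Proof. by rewrite sqr_sqrtr// ip_ge0. Qed.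

Lemma ip_nrm f g : L2 mu f -> L2 mu g -> `|inner mu f g| <= L2norm f * L2norm g.
Proof.
move=> f2 g2; rewrite -(@ler_pXn2r _ 2)// ?nnegrE ?mulr_ge0 ?nrm_ge0//.
by rewrite -normrX ger0_norm ?sqr_ge0// exprMn !sqr_nrm ip_CS.
Qed.

Lemma ip_le_nrm f g (e : R) : L2 mu f -> L2 mu g -> L2norm f <= e ->
  `|inner mu f g| <= e * L2norm g.
Proof.
by move=> f2 g2 fe; apply: le_trans (ip_nrm f2 g2) _; rewrite ler_wpM2r ?nrm_ge0.
Qed.

Lemma nrmD f g : L2 mu f -> L2 mu g -> L2norm (fun x => f x + g x) <= L2norm f + L2norm g.
Proof.
move=> f2 g2; rewrite -(@ler_pXn2r _ 2)// ?nnegrE ?addr_ge0 ?nrm_ge0//.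
rewrite sqr_nrm ipDl ?ipDr//; try exact: L2D.
have := le_trans (ler_norm _) (ip_nrm f2 g2).
by rewrite sqrrD !sqr_nrm (ipC _ g f) mulr2n; lra.
Qed.

Lemma nrmZ (c : R) f : L2 mu f -> L2norm (fun x => c * f x) = `|c| * L2norm f.
Proof.
move=> f2; rewrite /L2norm ipZl ?ipZr//; last exact: L2Z.
by rewrite mulrA -expr2 sqrtrM ?sqr_ge0// sqrtr_sqr.
Qed.

End L2_norm.

(** * Uniform continuity near cubes and functions of bounded support *)

Section uniform_continuity.
Context {R : realType} {n : nat}.
Implicit Type u : 'rV[R]_n -> R.

Lemma compact_cball (M : R) : compact (cball n M).
Proof.
apply: bounded_closed_compact.
  by exists M; split => [|N MN x /= /le_trans]; [exact: num_real|apply; exact: ltW].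
apply: (@closed_comp _ _ (fun x : 'rV[R]_n => `|x|) [set t | t <= M]).
  by move=> x _; exact: norm_continuous.
exact: closed_le.
Qed.

(** Only [x] is confined to the ball: the neighbourhoods that cover it are taken in the whole space,
    so [y] may leave it. Difference quotients and periodic functions rely on this. *)
Lemma uniform_continuous_cball u (M e : R) : continuous u -> 0 < e ->
  exists2 delta : R, 0 < delta &
    forall x y, `|x| <= M -> `|x - y| <= delta -> `|u x - u y| <= e.
Proof.
move=> cu e0; have e20 : 0 < e / 2 by rewrite divr_gt0.
have /compact_near_coveringP nc := @compact_cball M.
pose P (r : R) (x : 'rV[R]_n) := forall y, `|x - y| <= r -> `|u x - u y| <= e.
have [] := nc R (at_right 0) P.
  move=> x _; have /cvgrPdist_lt/(_ _ e20) := cu x.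
  move=> /nbhs_ballP[r /= r0 hr].
  have r20 : 0 < r / 2 by rewrite divr_gt0.
  have hr' z : `|x - z| < r -> `|u x - u z| < e / 2.
    by move=> xz; apply: hr; rewrite -ball_normE.
  exists (ball x (r / 2), [set s | s < r / 2]).
    split; first by apply: nbhsx_ballx.
    exact: nbhs_right_lt.
  move=> [x' s] /= [+ sr] y x'y; rewrite -ball_normE /= => xx'.
  have h1 : `|u x - u x'| < e / 2 by apply: hr'; lra.
  have h2 : `|u x - u y| < e / 2.
    apply: hr'; have := ler_distD x' x y; lra.
  by have := ler_distD (u x) (u x') (u y); rewrite (distrC (u x') (u x)); lra.
move=> r /= r0 hr; have [s sr] : exists s, 0 < s < r.
  by exists (r / 2); rewrite divr_gt0//= ltr_pdivrMr// ltr_pMr// ltr1n.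
exists s; first by case/andP: sr.
move=> x y xM xy; apply: (hr s) => //=; last by case/andP: sr.
by rewrite sub0r normrN; case/andP: sr => s0 ?; rewrite gtr0_norm.
Qed.

Lemma continuous_bounded_cball u (M : R) : continuous u ->
  exists2 C : R, 0 <= C & forall x, `|x| <= M -> `|u x| <= C.
Proof.
move=> cu; have : compact (u @` cball n M).
  by apply: continuous_compact; [exact: continuous_subspaceT|exact: compact_cball].
move=> /compact_bounded[C [_ hC]]; exists (`|C| + 1); first by rewrite addr_ge0.
move=> x xM; apply: hC; last by exists x.
by rewrite (le_lt_trans (ler_norm C))// ltrDl.
Qed.

Lemma test_bounded u : test_function u ->
  exists2 C : R, 0 <= C & forall x, `|u x| <= C.
Proof.
move=> /test_functionP[su [M M0 uM]].
have [C C0 h] := continuous_bounded_cball M (@smooth_continuous _ _ _ su).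
exists C => // x; have [/h//|/uM ->] := leP `|x| M.
by rewrite normr0.
Qed.

End uniform_continuity.

Section bounded_support.
Context {R : realType} {n : nat}.
Local Notation leb := (@lebesgue_rV R n).
Implicit Type u : 'rV[R]_n -> R.

Definition vol (M : R) : R := (M *+ 2) ^+ n.

Lemma L2_cball (M : R) : 0 <= M -> L2 leb \1_(cball n M).
Proof.
move=> M0; apply/L2P; split; first by apply: measurable_indic; exact: measurable_cball.
rewrite (_ : (fun _ => _) = \1_(cball n M)).
  apply/integrableP; split.
    by apply/measurable_EFinP; apply: measurable_indic; exact: measurable_cball.
  rewrite (eq_integral (EFin \o \1_(cball n M))); last first.
    by move=> x _ /=; rewrite indicE; case: (_ \in _); rewrite ?normr1 ?normr0.
  rewrite integral_indic//; last exact: measurable_cball.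
  by rewrite setIT [X in (X < _)%E](lebesgue_rV_cball n M0) ltry.
by apply/funext => x; rewrite indicE; case: (_ \in _); rewrite ?expr1n ?expr0n.
Qed.

Lemma ip_cball (M : R) : 0 <= M -> inner leb \1_(cball n M) \1_(cball n M) = vol M.
Proof.
move=> M0; rewrite /inner (_ : (fun _ => _) = \1_(cball n M)).
  rewrite /Rintegral integral_indic//; last exact: measurable_cball.
  by rewrite setIT [X in fine X](lebesgue_rV_cball n M0).
by apply/funext => x; rewrite indicE; case: (_ \in _); rewrite ?mulr1 ?mulr0.
Qed.

Lemma vol_ge0 (M : R) : 0 <= M -> 0 <= vol M.
Proof. by move=> M0; rewrite exprn_ge0// mulrn_wge0. Qed.

Lemma L2_bsupp u (M C : R) : 0 <= M -> measurable_fun setT u -> bsupp M u ->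
  (forall x, `|u x| <= C) -> L2 leb u /\ inner leb u u <= C ^+ 2 * vol M.
Proof.
move=> M0 mu_ uM uC.
have C0 : 0 <= C by exact: le_trans (uC 0).
have g2 := L2Z C (L2_cball M0).
have ug x : `|u x| <= `|C * \1_(cball n M) x|.
  have [xM|xM] := leP `|x| M; last by rewrite uM// normr0.
  by rewrite indicE mem_set// mulr1 (ger0_norm C0).
have u2 : L2 leb u by exact: L2_le g2.
split => //; apply: le_trans (ip_le u2 g2 ug) _.
by rewrite ipZl ?ipZr ?ip_cball//; rewrite ?mulrA ?expr2//; exact: L2_cball.
Qed.

(** Read as an inner product with the indicator of a cube, the integral becomes accessible to the
    Cauchy-Schwarz inequality. *)
Lemma Rintegral_bsupp u (M : R) : bsupp M u ->
  \int[leb]_x u x = inner leb u \1_(cball n M).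
Proof.
move=> uM; apply: eq_Rintegral => x _; rewrite indicE.
have [xM|xM] := leP `|x| M; first by rewrite mem_set// mulr1.
by rewrite uM// mul0r.
Qed.

Lemma integrable_bsupp u (M : R) : 0 <= M -> L2 leb u -> bsupp M u ->
  leb.-integrable setT (EFin \o u).
Proof.
move=> M0 u2 uM; apply: eq_integrable (L2_mul u2 (L2_cball M0)) => // x _ /=.
rewrite indicE; have [xM|xM] := leP `|x| M; first by rewrite mem_set// mulr1.
by rewrite uM// mul0r.
Qed.

Lemma test_measurable u : test_function u -> measurable_fun setT u.
Proof. by move=> /test_smooth/smooth_continuous; exact: continuous_measurable_rV. Qed.

Lemma test_L2 u : test_function u -> L2 leb u.
Proof.
move=> tu; have [C _ uC] := test_bounded tu.
have /test_functionP[_ [M M0 uM]] := tu.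
by have [] := L2_bsupp M0 (test_measurable tu) uM uC.
Qed.

Lemma test_integrable u : test_function u -> leb.-integrable setT (EFin \o u).
Proof.
move=> tu; have /test_functionP[_ [M M0 uM]] := tu.
exact: integrable_bsupp (test_L2 tu) uM.
Qed.

Lemma shift_L2 u (a : 'rV[R]_n) : L2 leb u -> L2 leb (fun x => u (x + a)).
Proof.
by apply: L2_mp; [exact: measurable_shift_rV|exact: lebesgue_rV_shift].
Qed.

Lemma ip_shift u v (a : 'rV[R]_n) : L2 leb u -> L2 leb v ->
  inner leb (fun x => u (x + a)) (fun x => v (x + a)) = inner leb u v.
Proof.
by apply: (@ip_mp _ _ _ leb (fun x => x + a));
  [exact: measurable_shift_rV|exact: lebesgue_rV_shift].
Qed.

Lemma Rintegral_shift u (a : 'rV[R]_n) : leb.-integrable setT (EFin \o u) ->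
  \int[leb]_x u (x + a) = \int[leb]_x u x.
Proof.
by apply: (@Rintegral_mp _ _ _ leb (fun x => x + a));
  [exact: measurable_shift_rV|exact: lebesgue_rV_shift].
Qed.

End bounded_support.

(** The form in which most limits are taken below: errors are arbitrarily small multiples of a fixed
    constant [K]. *)
Lemma eps_le0 {R : realFieldType} (a K : R) : 0 <= K -> (forall e, 0 < e -> a <= e * K) -> a <= 0.
Proof.
move=> K0 h; rewrite leNgt; apply/negP => a0.
have K1 : 0 < K + 1 by rewrite ltr_wpDl.
have := h (a / (K + 1) / 2); rewrite !divr_gt0// => /(_ isT).
apply/negP; rewrite -ltNge.
have -> : a / (K + 1) / 2 * K = a * (K / (K + 1) / 2) by field; rewrite gt_eqF.
rewrite gtr_pMr// ltr_pdivrMr// ltr_pdivrMr//; lra.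
Qed.

(** * Integration by parts *)

Section difference_quotients.
#[local] Opaque partial inner L2norm.
Context {R : realType} {n : nat}.
Local Notation leb := (@lebesgue_rV R n).
Local Notation ip := (inner leb).
Local Notation nrm := (L2norm leb).
Implicit Types (u v : 'rV[R]_n -> R) (i j : 'I_n).

Lemma MVT_dir u i (x : 'rV[R]_n) (h : R) : smooth u ->
  exists2 c : R, `|c| <= `|h| &
    u (x + h *: delta_mx 0 i) - u x = h * partial i u (x + c *: delta_mx 0 i).
Proof.
move=> su; pose g (s : R) := u (x + s *: delta_mx 0 i).
have dg (s : R) : is_derive s (1 : R) g (partial i u (x + s *: delta_mx 0 i)).
  by apply/dirder_line; exact: smooth_dirder.
have cg : continuous g.
  by move=> s; apply: differentiable_continuous; apply/derivable1_diffP; have [] := dg s.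
have g0 : g 0 = u x by rewrite /g scale0r addr0.
have [h0|h0] := leP 0 h.
  have [c cb E] := MVT_segment h0 (fun s _ => dg s) (continuous_subspaceT cg).
  exists c; last by rewrite -g0 -/(g h) E subr0 mulrC.
  by move: cb; rewrite in_itv/= => /andP[c0 ch]; rewrite !ger0_norm.
have [c cb E] := MVT_segment (ltW h0) (fun s _ => dg s) (continuous_subspaceT cg).
exists c; last by rewrite -g0 -/(g h) -[LHS]opprB E sub0r mulrN opprK mulrC.
by move: cb; rewrite in_itv/= => /andP[c0 ch]; rewrite !ler0_norm// ?lerN2// ltW.
Qed.

Definition diffq i (h : R) u (x : 'rV[R]_n) := h^-1 * (u (x + h *: delta_mx 0 i) - u x).

Lemma bsupp_shift u (M : R) (a : 'rV[R]_n) : bsupp M u ->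
  bsupp (M + `|a|) (fun x => u (x + a)).
Proof.
move=> uM x; rewrite -ltrBrDr => h; apply: uM.
by apply: (lt_le_trans h); rewrite lerBlDr -[X in `|X| <= _](addrK a) ler_normB.
Qed.

Lemma normrZ_delta (h : R) i : `|h *: delta_mx 0 i : 'rV[R]_n| = `|h|.
Proof. by rewrite normrZ norm_delta_mx mulr1. Qed.

Lemma test_shift u (a : 'rV[R]_n) : test_function u -> test_function (fun x => u (x + a)).
Proof.
move=> tu; have := test_affine a (oner_neq0 _) tu.
by under eq_fun do rewrite scale1r.
Qed.

Lemma partial_shift i u (a : 'rV[R]_n) : smooth u ->
  partial i (fun x => u (x + a)) = (fun x => partial i u (x + a)).
Proof.
move=> su; have := partial_affine i 1 a su.
have e (w : 'rV[R]_n -> R) : (fun x => w (1 *: x + a)) = (fun x => w (x + a)).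
  by apply/funext => x; rewrite scale1r.
by rewrite e => ->; apply/funext => x; rewrite mul1r scale1r.
Qed.

Lemma test_diffq i (h : R) u : test_function u -> test_function (diffq i h u).
Proof. by move=> tu; apply: testZ; apply: testB => //; exact: test_shift. Qed.

Lemma partialB i u v : smooth u -> smooth v ->
  partial i (fun x => u x - v x) = (fun x => partial i u x - partial i v x).
Proof.
move=> su sv; apply: partialE => x.
have := dirderD (smooth_dirder i x su) (dirderZ (-1) (smooth_dirder i x sv)).
by rewrite mulN1r; congr dirder; apply/funext => y; rewrite mulN1r.
Qed.

Lemma partialD i u v : smooth u -> smooth v ->
  partial i (fun x => u x + v x) = (fun x => partial i u x + partial i v x).
Proof. by move=> su sv; apply: partialE => x; apply: dirderD; exact: smooth_dirder. Qed.

Lemma partialZ i (c : R) u : smooth u ->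
  partial i (fun x => c * u x) = (fun x => c * partial i u x).
Proof. by move=> su; apply: partialE => x; apply: dirderZ; exact: smooth_dirder. Qed.

Lemma partialM i u v : smooth u -> smooth v ->
  partial i (fun x => u x * v x) = (fun x => partial i u x * v x + u x * partial i v x).
Proof. by move=> su sv; apply: partialE => x; apply: dirderM; exact: smooth_dirder. Qed.

Lemma partial_diffq i j (h : R) u : test_function u ->
  partial j (diffq i h u) = diffq i h (partial j u).
Proof.
move=> tu; have su := test_smooth tu.
have ss := test_smooth (test_shift (h *: delta_mx 0 i) tu).
rewrite /diffq partialZ; last exact: smoothB.
by rewrite (partialB j ss su) (partial_shift j _ su).
Qed.

Lemma diffq_bsupp i (h M : R) u : `|h| <= 1 -> bsupp M u -> bsupp (M + 1) (diffq i h u).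
Proof.
move=> h1 uM x xM; rewrite /diffq (uM x); last by rewrite (lt_trans _ xM)// ltrDl.
rewrite (bsupp_shift (a := h *: delta_mx 0 i) uM) ?subrr ?mulr0//.
by apply: le_lt_trans xM; rewrite lerD2l normrZ_delta.
Qed.

Lemma diffq_unif i (e : R) u : test_function u -> 0 < e ->
  exists2 delta : R, 0 < delta & forall h x, h != 0 -> `|h| <= delta ->
    `|diffq i h u x - partial i u x| <= e.
Proof.
move=> tu e0; have su := test_smooth tu.
have /test_functionP[_ [M M0 uM]] := tu.
have cp : continuous (partial i u) by exact: smooth_continuous (smooth_partial i su).
have [delta d0 hd] := uniform_continuous_cball (M + 1) cp e0.
exists (Num.min delta 1); first by rewrite lt_min d0 ltr01.
move=> h x h0; rewrite le_min => /andP[hd' h1].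
have [xM|xM] := leP `|x| (M + 1); last first.
  rewrite (diffq_bsupp i h1 uM)// (bsupp_partial i uM) ?subrr ?normr0 ?(ltW e0)//.
  by rewrite (lt_trans _ xM)// ltrDl.
have [c ch E] := MVT_dir i x h su.
rewrite /diffq E mulrA mulVf// mul1r distrC; apply: hd => //.
by rewrite opprD addrA subrr sub0r normrN normrZ_delta (le_trans ch).
Qed.

Lemma nrm_bsupp u (M C : R) : 0 <= M -> measurable_fun setT u -> bsupp M u ->
  (forall x, `|u x| <= C) -> nrm u <= C * Num.sqrt (vol (n := n) M).
Proof.
move=> M0 mu_ uM uC; have [_ h] := L2_bsupp M0 mu_ uM uC.
have C0 : 0 <= C by exact: le_trans (uC 0).
rewrite -(@ler_pXn2r _ 2)// ?nnegrE ?nrm_ge0 ?mulr_ge0 ?sqrtr_ge0//.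
by rewrite sqr_nrm exprMn sqr_sqrtr ?vol_ge0.
Qed.

(** For [|h| <= 1] all the functions are supported in one cube, where uniform convergence implies
    convergence in norm. *)
Lemma diffq_cvg i (e : R) u : test_function u -> 0 < e ->
  exists2 delta : R, 0 < delta & forall h, h != 0 -> `|h| <= delta ->
    nrm (fun x => diffq i h u x - partial i u x) <= e.
Proof.
move=> tu e0; have /test_functionP[_ [M M0 uM]] := tu.
set s := Num.sqrt (vol (n := n) (M + 1)).
have s1 : 0 < s + 1 by rewrite ltr_wpDl// sqrtr_ge0.
have [delta d0 hd] := diffq_unif i tu (divr_gt0 e0 s1).
exists (Num.min delta 1); first by rewrite lt_min d0 ltr01.
move=> h h0; rewrite le_min => /andP[hd' h1].
have td : test_function (fun x => diffq i h u x - partial i u x).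
  by apply: testB; [exact: test_diffq|exact: test_partial].
have M1 : 0 <= M + 1 by rewrite addr_ge0.
apply: (le_trans (nrm_bsupp M1 (test_measurable td) _ (fun x => hd h x h0 hd'))).
  move=> x xM; rewrite (diffq_bsupp i h1 uM)// (bsupp_partial i uM) ?subrr//.
  by rewrite (lt_trans _ xM)// ltrDl.
rewrite -/s mulrAC ler_pdivrMr// ler_wpM2l ?(ltW e0)// lerDl//.
Qed.

Lemma diffq_small i u : test_function u -> forall e : R, 0 < e ->
  exists h : R, [/\ h != 0, `|h| <= 1 & nrm (fun x => diffq i h u x - partial i u x) <= e].
Proof.
move=> tu e e0; have [delta d0 hd] := diffq_cvg i tu e0.
have m0 : 0 < Num.min delta 1 by rewrite lt_min d0 ltr01.
exists (Num.min delta 1); rewrite gt_eqF// gtr0_norm//; split => //.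
  by rewrite ge_min lexx orbT.
by apply: hd; rewrite ?gt_eqF// gtr0_norm// ge_min lexx.
Qed.

(** A difference quotient has integral zero by translation invariance, and it tends to the
    derivative in [L2] on a fixed cube. *)
Lemma int_partial i u : test_function u -> \int[leb]_x partial i u x = 0.
Proof.
move=> tu; have /test_functionP[_ [M M0 uM]] := tu.
have M1 : 0 <= M + 1 by rewrite addr_ge0.
have pM : bsupp (M + 1) (partial i u).
  by apply: bsupp_le (bsupp_partial i uM); rewrite lerDl.
have t1 := test_L2 (test_partial i tu).
have c2 := @L2_cball R n _ M1.
apply/eqP; rewrite -normr_eq0 eq_le normr_ge0 andbT.
apply: (@eps_le0 _ _ (nrm \1_(cball n (M + 1)))) => [|e e0]; first exact: nrm_ge0.
have [h [h0 h1 he]] := diffq_small i tu e0.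
have t2 := test_L2 (test_diffq i h tu).
have dq0 : ip (diffq i h u) \1_(cball n (M + 1)) = 0.
  rewrite -Rintegral_bsupp; last exact: diffq_bsupp.
  have iu := test_integrable tu.
  have iu' := test_integrable (test_shift (h *: delta_mx 0 i) tu).
  rewrite /diffq RintegralZl//; last exact: EFin_integrableB.
  by rewrite RintegralB// Rintegral_shift// subrr mulr0.
have -> : \int[leb]_x partial i u x =
    - ip (fun x => diffq i h u x - partial i u x) \1_(cball n (M + 1)).
  by rewrite (ipBl t2 t1 c2) dq0 sub0r opprK (Rintegral_bsupp pM).
rewrite normrN.
exact: (ip_le_nrm (L2B t2 t1) c2 he).
Qed.

Lemma ibp i u v : smooth u -> test_function v ->
  ip (partial i u) v = - ip u (partial i v).
Proof.
move=> su tv; apply/eqP; rewrite -addr_eq0; apply/eqP.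
have := int_partial i (testM su tv).
rewrite partialM//; last exact: test_smooth.
rewrite RintegralD//; apply: test_integrable; first exact: testM (smooth_partial i su) tv.
exact: testM su (test_partial i tv).
Qed.

(* Difference quotients commute with partial derivatives, so that Schwarz's
   theorem on mixed derivatives can be dispensed with. *)
Lemma partial_comm_weak i j u v : test_function u -> test_function v ->
  ip (partial i (partial j u)) v = ip (partial j (partial i u)) v.
Proof.
move=> tu tv.
have [[tiu tju] tjv] := (test_partial i tu, test_partial j tu, test_partial j tv).
have [[[v2 iu2] ju2] jv2] :=
  (test_L2 tv, test_L2 tiu, test_L2 tju, test_L2 tjv).
apply/eqP; rewrite -subr_eq0 -normr_eq0 eq_le normr_ge0 andbT.
apply: (@eps_le0 _ _ (nrm v + nrm (partial j v))) => [|e e0].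
  by rewrite addr_ge0 ?nrm_ge0.
have [d1 d10 h1] := diffq_cvg i tju e0; have [d2 d20 h2] := diffq_cvg i tu e0.
have m0 : 0 < Num.min d1 d2 by rewrite lt_min d10 d20.
have [md1 md2] : Num.min d1 d2 <= d1 /\ Num.min d1 d2 <= d2.
  by rewrite !ge_min !lexx orbT.
set h := Num.min d1 d2 in m0 md1 md2.
have {}h1 := h1 h (lt0r_neq0 m0); have {}h2 := h2 h (lt0r_neq0 m0).
rewrite gtr0_norm// in h1 h2; have {}h1 := h1 md1; have {}h2 := h2 md2.
have A : ip (diffq i h (partial j u)) v = - ip (diffq i h u) (partial j v).
  by rewrite -(partial_diffq i j h tu) (ibp j (test_smooth (test_diffq i h tu)) tv).
rewrite [X in `|_ - X|](ibp j (test_smooth tiu) tv).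
have q1 := test_L2 (test_diffq i h tju); have q2 := test_L2 (test_diffq i h tu).
have p1 := test_L2 (test_partial i tju).
have -> : ip (partial i (partial j u)) v - - ip (partial i u) (partial j v) =
    - (ip (fun x => diffq i h (partial j u) x - partial i (partial j u) x) v) -
    ip (fun x => diffq i h u x - partial i u x) (partial j v).
  by rewrite !ipBl// A; ring.
have H1 := ip_le_nrm (L2B q1 p1) v2 h1.
have H2 := ip_le_nrm (L2B q2 iu2) jv2 h2.
apply: (le_trans (ler_normB _ _)); rewrite normrN mulrDr.
exact: (lerD H1 H2).
Qed.

(** Integrate by parts in [i] and in [j], exchanging derivatives in between. Summed over both
    indices it says that the Hessian and the Laplacian have the same norm. *)
Lemma hessian i j u : test_function u ->
  ip (partial j (partial i u)) (partial j (partial i u)) =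
  ip (partial i (partial i u)) (partial j (partial j u)).
Proof.
move=> tu; have tiu := test_partial i tu; have tju := test_partial j tu.
have tjiu := test_partial j tiu.
apply: (eq_trans (partial_comm_weak j i tu tjiu)).
apply: (eq_trans (ibp i (test_smooth tju) tjiu)).
apply: (eq_trans (congr1 -%R (ipC _ _ _))).
apply: (eq_trans (congr1 -%R (partial_comm_weak i j tiu tju))).
apply: (eq_trans (congr1 -%R (ibp j (test_smooth (test_partial i tiu)) tju))).
exact: opprK.
Qed.

Lemma diffq_shift i (h : R) u : h != 0 ->
  (fun x => u (x + h *: delta_mx 0 i) - u x) = (fun x => h * diffq i h u x).
Proof. by move=> h0; apply/funext => x; rewrite /diffq mulrA mulfV// mul1r. Qed.

Lemma nrm_shift u (a : 'rV[R]_n) : L2 leb u -> nrm (fun x => u (x + a)) = nrm u.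
Proof. by move=> u2; apply: nrm_eq; rewrite ip_shift. Qed.

(** The translation is cut into [N] steps of length [t / N]. All steps have the same norm by
    translation invariance, and for large [N] this norm is at most
    [t / N * (nrm (partial i u) + e)]. *)
Lemma shift_bound i (t : R) u : 0 <= t -> test_function u ->
  nrm (fun x => u (x + t *: delta_mx 0 i) - u x) <= t * nrm (partial i u).
Proof.
move=> t0 tu; have u2 := test_L2 tu.
have sub (N : nat) (h : R) : nrm (fun x => u (x + (N%:R * h) *: delta_mx 0 i) - u x) <=
    N%:R * nrm (fun x => u (x + h *: delta_mx 0 i) - u x).
  elim: N => [|N ih].
    rewrite (_ : (fun x => _) = (fun x => 0 * u x)); last first.
      by apply/funext => x; rewrite !mul0r scale0r addr0 subrr.
    by rewrite (nrmZ 0 u2) normr0 !mul0r.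
  have -> : N.+1%:R * h = N%:R * h + h by rewrite -natr1 mulrDl mul1r.
  rewrite -natr1 mulrDl mul1r.
  rewrite (_ : (fun x => _) = (fun x =>
    (u (x + (N%:R * h) *: delta_mx 0 i + h *: delta_mx 0 i) - u (x + (N%:R * h) *: delta_mx 0 i)) +
    (u (x + (N%:R * h) *: delta_mx 0 i) - u x))); last first.
    by apply/funext => x; rewrite scalerDl addrA; ring.
  apply: (le_trans (nrmD _ _)).
  - have := shift_L2 ((N%:R * h) *: delta_mx 0 i)
      (L2B (shift_L2 (h *: delta_mx 0 i) u2) u2).
    by congr (L2 _ _); apply/funext => x; rewrite addrAC.
  - exact: L2B (shift_L2 _ u2) u2.
  rewrite addrC lerD//.
  have := nrm_shift ((N%:R * h) *: delta_mx 0 i)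
    (L2B (shift_L2 (h *: delta_mx 0 i) u2) u2).
  by move=> <-; rewrite le_eqVlt; apply/orP; left; apply/eqP;
    congr nrm; apply/funext => x; rewrite addrAC.
have [->|tn0] := eqVneq t 0.
  by have := sub 0 0; rewrite !mul0r.
have tp : 0 < t by rewrite lt_def tn0.
rewrite -subr_le0; apply: (@eps_le0 _ _ t) => // e e0.
have [delta d0 hd] := diffq_cvg i tu e0.
pose N := (Num.truncn (t / delta)).+1.
have N0 : 0 < N%:R :> R by rewrite ltr0n.
have hN : t / N%:R <= delta.
  by rewrite ler_pdivrMr// mulrC -ler_pdivrMr// ltW// truncnS_gt.
have hn0 : t / N%:R != 0 by rewrite mulf_neq0 ?invr_eq0 ?gt_eqF.
have {}hd := hd _ hn0; rewrite gtr0_norm ?divr_gt0// in hd; have {}hd := hd hN.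
have := sub N (t / N%:R); rewrite mulrCA divff ?gt_eqF// mulr1 => /le_trans H.
rewrite lerBlDr; apply: H.
have q2 := test_L2 (test_diffq i (t / N%:R) tu).
rewrite diffq_shift// nrmZ// gtr0_norm ?divr_gt0// mulrA mulrCA divff ?gt_eqF// mulr1.
rewrite (mulrC e) -mulrDr ler_wpM2l//.
have p2 := test_L2 (test_partial i tu).
apply: (@le_trans _ _ (nrm (fun x => (diffq i (t / N%:R) u x - partial i u x) + partial i u x))).
  by rewrite le_eqVlt; apply/orP; left; apply/eqP; congr nrm; apply/funext => x; rewrite subrK.
apply: (le_trans (nrmD _ p2)); first exact: L2B.
by rewrite lerD2r.
Qed.

End difference_quotients.

(** * From the lattice operators to a form bound on R^n *)

From mathcomp Require Import finmap.

Section rayleigh.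
Context d (T : measurableType d) (R : realType) (mu : {measure set T -> \bar R}).
Variable A : (T -> R) -> T -> R.
Local Notation ip := (inner mu).
Hypothesis A_L2 : forall f, L2 mu f -> L2 mu (A f).
Hypothesis A_linear : forall c f g, A (fun x => f x + c * g x) = (fun x => A f x + c * A g x).
Hypothesis A_sym : forall f g, L2 mu f -> L2 mu g -> ip (A f) g = ip f (A g).
Variable K : R.
Hypothesis A_bounded : forall f, L2 mu f -> `|ip (A f) f| <= K * ip f f.

Let B (a : R) f := fun x => A f x - a * f x.

Let B_L2 a f : L2 mu f -> L2 mu (B a f).
Proof. by move=> f2; apply: L2B; [exact: A_L2|exact: L2Z]. Qed.

Let ipB a f g : L2 mu f -> L2 mu g -> ip (B a f) g = ip (A f) g - a * ip f g.
Proof. by move=> f2 g2; rewrite ipBl ?ipZl//; [exact: A_L2|exact: L2Z]. Qed.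

Let B_CS a : (forall f, L2 mu f -> 0 <= ip (B a f) f) ->
  forall f g, L2 mu f -> L2 mu g -> ip (B a f) g ^+ 2 <= ip (B a f) f * ip (B a g) g.
Proof.
move=> B0 f g f2 g2; apply: disc_le0 => [|t]; first exact: B0.
have g2' := L2Z t g2; have s2 := L2D f2 g2'.
rewrite [leRHS](_ : _ = ip (B a (fun x => f x + t * g x)) (fun x => f x + t * g x)).
  exact: B0.
rewrite !ipB// A_linear.
have Af2 := A_L2 f2; have Ag2 := A_L2 g2; have Ag2' := L2Z t Ag2.
rewrite !ipDl ?ipDr//; rewrite !ipZl// !ipZr//.
by rewrite (A_sym g2 f2) (ipC _ g (A f)) (ipC _ g f); ring.
Qed.

(* If the infimum [a] of the Rayleigh quotient were less than [m], Cauchy-Schwarz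
   for the form of [A - a] would give [|(A - a) f|^2 <= K' <(A - a) f, f>], which
   is not bounded below by a multiple of [|f|^2], although [a] is in the
   resolvent set. *)
Lemma spectrum_form_ge (m : R) :
  (forall l, l < m -> resolvent_set mu (L2 mu) A l) ->
  forall f, L2 mu f -> m * ip f f <= ip (A f) f.
Proof.
move=> res f0 f02; rewrite leNgt; apply/negP => Qf0.
(* A null vector also has form zero, by boundedness, so it cannot violate the claim. *)
have f0p : 0 < ip f0 f0.
  rewrite lt_def ip_ge0 andbT; apply/eqP => f00.
  have := A_bounded f02; rewrite f00 mulr0 normr_le0 => /eqP h.
  by move: Qf0; rewrite f00 mulr0 h ltxx.
pose E : set R := [set q | exists2 f, L2 mu f /\ 0 < ip f f & q = ip (A f) f / ip f f].
have Enb : lbound E (- K).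
  move=> _ [f [f2 fp] ->]; rewrite ler_pdivlMr// mulNr.
  by have := A_bounded f2; rewrite ler_norml => /andP[].
have E0 : E (ip (A f0) f0 / ip f0 f0) by exists f0.
have Einf : has_inf E by split; [exists (ip (A f0) f0 / ip f0 f0)|exists (- K)].
pose a := inf E.
have aE q : E q -> a <= q by by move=> Eq; exact: ge_inf Einf.2 _ Eq.
have am : a < m.
  by apply: le_lt_trans (aE _ E0) _; rewrite ltr_pdivrMr.
have ip0 f : L2 mu f -> ip f f = 0 -> ip (A f) f = 0.
  by move=> f2 ff0; have := A_bounded f2; rewrite ff0 mulr0 normr_le0 => /eqP.
have B0 f : L2 mu f -> 0 <= ip (B a f) f.
  move=> f2; rewrite ipB// subr_ge0.
  have [ff0|ffn0] := eqVneq (ip f f) 0; first by rewrite ip0// ff0 mulr0.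
  have fp : 0 < ip f f by rewrite lt_def ffn0 ip_ge0.
  by rewrite -ler_pdivlMr//; apply: aE; exists f.
have [S [C [Sdom SB Sbd]]] := res _ am.
have K0 : 0 <= K.
  have := le_trans (normr_ge0 _) (A_bounded f02).
  by rewrite pmulr_lge0.
pose K' := K + `|a|.
have BK f : L2 mu f -> ip (B a f) f <= K' * ip f f.
  move=> f2; rewrite ipB// mulrDl lerD//.
    exact: le_trans (ler_norm _) (A_bounded f2).
  by rewrite -mulNr ler_wpM2r ?ip_ge0// -normrN ler_norm.
(* Cauchy-Schwarz for the form of [A - a], with [B a f] itself as the second vector. *)
have BB f : L2 mu f -> ip (B a f) (B a f) <= K' * ip (B a f) f.
  move=> f2; have Bf2 := B_L2 a f2.
  have [->|n0] := eqVneq (ip (B a f) (B a f)) 0.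
    by rewrite mulr_ge0// ?B0// addr_ge0.
  have p : 0 < ip (B a f) (B a f) by rewrite lt_def n0 ip_ge0.
  rewrite -(ler_pM2r p) -expr2; apply: (le_trans (B_CS B0 f2 Bf2)).
  rewrite [leRHS](_ : _ = ip (B a f) f * (K' * ip (B a f) (B a f))); last by ring.
  by rewrite ler_wpM2l ?B0// BK.
have SC f : L2 mu f -> ip f f <= C ^+ 2 * ip (B a f) (B a f).
  move=> f2; have Bf2 := B_L2 a f2.
  have [S2 _] := Sdom _ Bf2.
  rewrite -(ae_eq_ip S2 S2 f2 f2 (SB _ f2) (SB _ f2)).
  have := Sbd _ Bf2; rewrite !Lnorm2E// -EFinM lee_fin -!/(L2norm mu _).
  by rewrite -!sqr_nrm -exprMn => h; rewrite lerXn2r// nnegrE ?nrm_ge0//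
    (le_trans (nrm_ge0 _ _) h).
pose D := C ^+ 2 * K' + 1.
have D0 : 0 < D by rewrite ltr_wpDl// mulr_ge0 ?sqr_ge0// addr_ge0.
have fin f : L2 mu f -> ip f f <= D * ip (B a f) f.
  move=> f2; apply: (le_trans (SC _ f2)); rewrite /D mulrDl mul1r -mulrA.
  by rewrite ler_wpDr ?B0// ler_wpM2l ?sqr_ge0// BB.
(* All Rayleigh quotients exceed [a] by at least [D^-1], although [a] is their infimum. *)
have : a + D^-1 <= a.
  apply: lb_le_inf; first by case: Einf.
  move=> _ [f [f2 fp] ->]; rewrite ler_pdivlMr//.
  have := fin _ f2; rewrite ipB// -ler_pdivrMl// mulrDl; lra.
by rewrite gerDl leNgt invr_gt0 D0.
Qed.

End rayleigh.

(** * The quadratic forms of the lattice operators *)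

Section counting_lattice.
Context {R : realType} {n : nat}.
Local Notation cnt := (@counting (lattice n) R).
Implicit Types (f g : lattice n -> R).

Lemma counting_shift (a : lattice n) (A : set (lattice n)) : measurable A ->
  cnt ((fun k => k + a) @^-1` A) = cnt A.
Proof.
move=> _; have E : (fun k => k + a) @^-1` A = (fun k => k - a) @` A.
  apply/seteqP; split => [k /= Ak|_ [k Ak <-] /=]; last by rewrite subrK.
  by exists (k + a) => //; rewrite addrK.
have inj : injective (fun k : lattice n => k - a) by move=> x y /addIr.
rewrite /counting E.
have [fA|fA] := pselect (finite_set A); last first.
  rewrite !asboolF//; apply: contra_not fA => fA.
  have := finite_image (fun k => k + a) fA.
  rewrite (_ : (fun k => k + a) @` _ = A)//; apply/seteqP; split.
    by move=> _ [_ [k Ak <-] <-]; rewrite subrK.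
  by move=> k Ak; exists (k - a); [exists k|rewrite subrK].
rewrite !asboolT//; last exact: finite_image.
by rewrite fset_set_image// card_imfset.
Qed.

Lemma lattice_shift_L2 f (a : lattice n) : L2 cnt f -> L2 cnt (fun k => f (k + a)).
Proof. by apply: L2_mp => //; exact: counting_shift. Qed.

Lemma lattice_ip_shift f g (a : lattice n) : L2 cnt f -> L2 cnt g ->
  inner cnt (fun k => f (k + a)) (fun k => g (k + a)) = inner cnt f g.
Proof. by apply: (@ip_mp _ _ _ cnt (fun k => k + a)) => //; exact: counting_shift. Qed.

End counting_lattice.

Section lattice_form.
Context {R : realType} {n : nat}.
Local Notation cnt := (@counting (lattice n) R).
Local Notation ip := (inner cnt).
Implicit Types (f g : lattice n -> R) (i : 'I_n).

Definition evec i : lattice n := (delta_mx 0 i : 'rV[int]_n).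

Lemma evec_inj : injective evec.
Proof.
move=> i j /rowP/(_ i); rewrite !mxE !eqxx/=.
have [//|ij] := eqVneq i j.
by move/eqP; rewrite oner_eq0.
Qed.

Lemma evec_neqN i j : evec i != - evec j.
Proof.
apply/eqP => /rowP/(_ i); rewrite !mxE !eqxx/=.
by case: (i == j).
Qed.

(** A sum over a set becomes a sum over coordinates once the [2 n] neighbours are known to be
    distinct: unit vectors differ, and none is the opposite of a unit vector. *)
Lemma sum_neighbour f (k : lattice n) :
  \sum_(j \in [set j | neighbour j k]) f j = \sum_(i < n) (f (k + evec i) + f (k - evec i)).
Proof.
pose r := [seq k + evec i | i <- index_enum 'I_n] ++ [seq k - evec i | i <- index_enum 'I_n].
have ur : uniq r.
  have ip : injective (fun i => k + evec i) by move=> i j /addrI/evec_inj.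
  have im : injective (fun i => k - evec i) by move=> i j /addrI/oppr_inj/evec_inj.
  rewrite cat_uniq (map_inj_uniq ip) (map_inj_uniq im) !index_enum_uniq andbT andTb.
  apply/hasPn => _ /mapP[i _ ->]; apply/mapP => -[j _].
  by move=> /addrI/esym/eqP; exact/negP/evec_neqN.
have -> : [set j | neighbour j k] = [set` r].
  apply/seteqP; split=> [j [i [h|h]]|j] /=.
  - rewrite mem_cat; apply/orP; left; apply/mapP; exists i; first by rewrite mem_index_enum.
    by rewrite -[j](subrK k) h addrC.
  - rewrite mem_cat; apply/orP; right; apply/mapP; exists i; first by rewrite mem_index_enum.
    by rewrite -[j](subrK k) h addrC.
  rewrite mem_cat => /orP[] /mapP[i _ ->]; exists i; [left|right];
    by rewrite addrAC subrr add0r.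
by rewrite -fsbig_seq// big_cat/= !big_map -big_split.
Qed.

Variables (theta : R) (V : 'rV[R]_n -> R) (eta : 'rV[R]_n) (C : R).
Hypothesis V0 : forall x, 0 <= V x.
Hypothesis VC : forall x, V x <= C.

Definition Vk (k : lattice n) : R := V (lpoint theta k + eta).

(** The diagonal coefficient [2 n] is shared evenly among the coordinates, so that the form of each
    [hop i] is the squared norm of a difference. *)
Let hop i f k := 2 * f k - f (k + evec i) - f (k - evec i).

Let lattice_opE f : lattice_op theta V eta f =
  (fun k => \sum_(i < n) hop i f k + Vk k * f k).
Proof.
apply/funext => k; rewrite /lattice_op sum_neighbour; congr (_ + _).
rewrite -[(2 * n)%:R * f k](_ : \sum_(i < n) 2 * f k = _); last first.
  by rewrite sumr_const card_ord natrM -mulr_natr; ring.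
by rewrite -sumrB; apply: eq_bigr => i _; rewrite /hop opprD addrA.
Qed.

Let hop_L2 i f : L2 cnt f -> L2 cnt (hop i f).
Proof.
move=> f2; apply: L2B; last exact: lattice_shift_L2.
by apply: L2B; [exact: L2Z|exact: lattice_shift_L2].
Qed.

Let V_L2 f : L2 cnt f -> L2 cnt (fun k => Vk k * f k).
Proof.
move=> f2; apply: (@L2_bounded_mul _ _ _ _ _ C) => // k.
by rewrite ger0_norm ?V0 ?VC.
Qed.

Let op_L2 f : L2 cnt f -> L2 cnt (lattice_op theta V eta f).
Proof.
move=> f2; rewrite lattice_opE; apply: L2D; last exact: V_L2.
by apply: L2_sum => i; exact: hop_L2.
Qed.

Let ip_op f g : L2 cnt f -> L2 cnt g -> ip (lattice_op theta V eta f) g =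
  \sum_(i < n) (2 * ip f g - ip (fun k => f (k + evec i)) g -
                ip f (fun k => g (k + evec i))) + ip (fun k => Vk k * f k) g.
Proof.
move=> f2 g2; rewrite lattice_opE ipDl//; [|by apply: L2_sum => i; exact: hop_L2|exact: V_L2].
rewrite ip_suml//; last by move=> i; exact: hop_L2.
congr (_ + _); apply: eq_bigr => i _; have sf := lattice_shift_L2 (evec i) f2.
have sf' := lattice_shift_L2 (- evec i) f2.
rewrite ipBl//; last by apply: L2B => //; exact: L2Z.
rewrite ipBl// ?ipZl//; last exact: L2Z.
congr (_ - _); rewrite -(lattice_ip_shift (evec i) sf' g2).
by apply: eq_ip => k //; rewrite addrK.
Qed.

Let shift_form i f : L2 cnt f ->
  ip (fun k => f (k + evec i) - f k) (fun k => f (k + evec i) - f k) =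
  2 * ip f f - ip (fun k => f (k + evec i)) f - ip f (fun k => f (k + evec i)).
Proof.
move=> f2; have sf := lattice_shift_L2 (evec i) f2.
by rewrite ip_sqrB// lattice_ip_shift// (ipC _ f); ring.
Qed.

Let op_form f : L2 cnt f -> ip (lattice_op theta V eta f) f =
  \sum_(i < n) ip (fun k => f (k + evec i) - f k) (fun k => f (k + evec i) - f k) +
  ip (fun k => Vk k * f k) f.
Proof.
by move=> f2; rewrite ip_op//; congr (_ + _); apply: eq_bigr => i _; rewrite shift_form.
Qed.

Lemma lattice_form_ge (m : R) :
  (forall l, l < m -> resolvent_set cnt (L2 cnt) (lattice_op theta V eta) l) ->
  forall f, L2 cnt f -> m * ip f f <=
    \sum_(i < n) ip (fun k => f (k + evec i) - f k) (fun k => f (k + evec i) - f k) +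
    ip (fun k => Vk k * f k) f.
Proof.
move=> res f f2; rewrite -op_form//; move: f f2.
(* A difference of two vectors of equal norm has at most four times the square of that norm, for
   each of [n] coordinates; [C] bounds the potential. *)
apply: (@spectrum_form_ge _ _ _ _ (lattice_op theta V eta) _ _ _ (n%:R * 4 + C)) => //.
- move=> c f g; rewrite !lattice_opE; apply/funext => k.
  rewrite [c * (_ + _)]mulrDr mulr_sumr addrACA -big_split/=; congr (_ + _); last by ring.
  by apply: eq_bigr => i _; rewrite /hop; ring.
- move=> f g f2 g2; rewrite [RHS]ipC !ip_op//; congr (_ + _).
    apply: eq_bigr => i _; rewrite (ipC _ g f) (ipC _ (fun k : lattice n => g (k + evec i)) f).
    by rewrite (ipC _ g (fun k : lattice n => f (k + evec i))); ring.
  by apply: eq_Rintegral => k _; ring.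
move=> f f2; rewrite op_form// ger0_norm; last first.
  rewrite addr_ge0 ?sumr_ge0// => [i _|]; first exact: ip_ge0.
  by apply: Rintegral_ge0 => k _; rewrite -mulrA mulr_ge0 ?V0// -expr2 sqr_ge0.
rewrite mulrDl lerD//.
  rewrite -mulrA mulr_natl -[X in _ *+ X]card_ord -sumr_const; apply: ler_sum => i _.
  rewrite shift_form//; have sf := lattice_shift_L2 (evec i) f2.
  have := ip_nrm sf f2; have := ip_nrm f2 sf.
  have -> : L2norm cnt (fun k => f (k + evec i)) = L2norm cnt f.
    by rewrite /L2norm lattice_ip_shift.
  by rewrite -expr2 sqr_nrm !ler_norml => /andP[h1 h2] /andP[h3 h4]; lra.
rewrite -ipZl//; apply: le_Rintegral => //.
- exact: (L2_mul (V_L2 f2) f2).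
- exact: (L2_mul (L2Z C f2) f2).
by move=> k _; rewrite -!mulrA -expr2 ler_wpM2r ?sqr_ge0// VC.
Qed.

End lattice_form.

Section energy.
Context d (T : measurableType d) (R : realType) (mu : {measure set T -> \bar R}).

(** Stated for any measure because both sides of the slicing are of this kind: Lebesgue measure on
    [R^n] and the counting measure on a slice. *)
Lemma energy_integral n (F : 'I_n -> T -> R) (W f : T -> R) :
  (forall i, L2 mu (F i)) -> L2 mu f -> L2 mu (fun x => W x * f x) ->
  (forall x, 0 <= W x) ->
  (\int[mu]_x (\sum_(i < n) F i x ^+ 2 + W x * f x * f x)%:E =
   (\sum_(i < n) inner mu (F i) (F i) + inner mu (fun x => W x * f x) f)%:E)%E.
Proof.
move=> F2 f2 Wf2 W0.
have Wff x : 0 <= W x * f x * f x by rewrite -mulrA mulr_ge0// -expr2 sqr_ge0.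
have mF i : measurable_fun setT (fun x => (F i x ^+ 2)%:E).
  by apply/measurable_EFinP/measurable_funX; exact: L2_measurable (F2 i).
under eq_integral do rewrite EFinD -sumEFin.
rewrite ge0_integralD//.
- rewrite ge0_integral_sum//; last by move=> i x _; rewrite lee_fin sqr_ge0.
  rewrite EFinD -sumEFin; congr (_ + _)%E.
    by apply: eq_bigr => i _; rewrite L2_integral_sqr.
  by rewrite /inner /Rintegral fineK//; apply: integrable_fin_num => //; exact: L2_mul.
- by move=> x _; apply: sume_ge0 => i _; rewrite lee_fin sqr_ge0.
- exact: emeasurable_sum.
- by move=> x _; rewrite lee_fin.
- by apply/measurable_EFinP; apply: measurable_funM; [exact: L2_measurable Wf2|exact: L2_measurable f2].
Qed.

End energy.

(** * Slicing [R^n] along the cosets of the lattice *)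

Section partition.
Context {R : realType} {n : nat}.

(** An enumeration with gaps: a sum over the lattice becomes a series over [nat], in which an index
    that encodes no point contributes zero. *)
Definition enumk (N : nat) : option (lattice n) := pickle_inv N : option 'rV[int]_n.

Lemma enumk_inj N M k : enumk N = Some k -> enumk M = Some k -> N = M.
Proof.
rewrite /enumk => hN hM.
have := @pickle_invK 'rV[int]_n N; have := @pickle_invK 'rV[int]_n M.
by rewrite hN hM /= => <- <-.
Qed.

Lemma enumk_surj k : exists N, enumk N = Some k.
Proof. by exists (choice.pickle (k : 'rV[int]_n)); exact: pickleK_inv. Qed.

Lemma ge0_integral_partition d (T : measurableType d) (mu : {measure set T -> \bar R})
    (P : lattice n -> set T) (f : T -> \bar R) :
  (forall k, measurable (P k)) -> (forall k l x, P k x -> P l x -> k = l) ->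
  (forall x, exists k, P k x) ->
  measurable_fun setT f -> (forall x, 0 <= f x)%E ->
  (\int[mu]_x f x = \sum_(N <oo) oapp (fun k => \int[mu]_(x in P k) f x) 0 (enumk N))%E.
Proof.
move=> mP tP cP mf f0.
pose D N := oapp P set0 (enumk N).
have UD : \bigcup_N D N = setT.
  apply/seteqP; split => // x _; have [k Pk] := cP x; have [N Nk] := enumk_surj k.
  by exists N => //; rewrite /D Nk.
rewrite -UD ge0_integral_bigcup//.
- apply: eq_eseriesr => N _; rewrite /D; case: (enumk N) => //=.
  by rewrite integral_set0.
- by move=> N; rewrite /D; case: (enumk N) => /=.
- by rewrite UD.
- move=> N M _ _; rewrite /D; case hN : (enumk N) => [k|]/=; last by case=> x [].
  case hM : (enumk M) => [l|]/=; last by case=> x [].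
  case=> x [Pk Pl]; apply: (enumk_inj hN); rewrite hM; congr Some.
  exact: tP Pl Pk.
Qed.

Lemma ge0_integral_lattice (f : lattice n -> \bar R) : (forall k, 0 <= f k)%E ->
  (\int[@counting (lattice n) R]_k f k = \sum_(N <oo) oapp f 0 (enumk N))%E.
Proof.
move=> f0; rewrite (@ge0_integral_partition _ _ _ (fun k => [set k]))//.
- apply: eq_eseriesr => N _; case: (enumk N) => //= k.
  rewrite (eq_integral (cst (f k))); last by move=> x /set_mem /= ->.
  rewrite integral_cst// -[RHS]mule1; congr (_ * _)%E.
  by rewrite /= /counting asboolT// fset_set1 cardfs1.
- by move=> k l x -> ->.
- by move=> x; exists x.
Qed.

End partition.

Section tiling.
Context {R : realType} {n : nat}.
Variable theta : R.
Hypothesis theta_gt0 : 0 < theta.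
Local Notation leb := (@lebesgue_rV R n).

Definition cell : set 'rV[R]_n := lfloor theta @^-1` [set 0 : lattice n].

Lemma measurable_cell : measurable cell.
Proof. exact: measurable_lfloor_eq. Qed.

Lemma lpointD (k l : lattice n) : @lpoint R n theta (k + l) = lpoint theta k + lpoint theta l.
Proof. by rewrite /lpoint -scalerDr; congr (_ *: _); apply/rowP => i; rewrite !mxE rmorphD. Qed.

Lemma lpoint_evec i : @lpoint R n theta (evec i) = theta *: delta_mx 0 i.
Proof. by rewrite /lpoint /evec map_delta_mx. Qed.

Lemma lfloor_shift (x : 'rV[R]_n) (k : lattice n) :
  lfloor theta (x + lpoint theta k) = k <-> cell x.
Proof.
rewrite /cell /= !(lfloorP theta_gt0).
have e : x + lpoint theta k - lpoint theta k = x - lpoint theta 0.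
  by rewrite addrK /lpoint map_mx0 scaler0 subr0.
by split => h i; have := h i; rewrite e.
Qed.

Lemma tile_measurable (f : 'rV[R]_n -> \bar R) N : measurable_fun setT f ->
  measurable_fun setT (fun eta : 'rV[R]_n =>
    oapp (fun k : lattice n => f (eta + lpoint theta k)) 0%E (enumk N)).
Proof.
move=> mf; case: (enumk N) => //= k.
by apply: measurableT_comp => //; exact: measurable_shift_rV.
Qed.

(** Each tile is moved back to the fundamental cell by translation invariance, and nonnegativity
    permits exchanging the sum over tiles with the integral. *)
Lemma ge0_integral_tiling (f : 'rV[R]_n -> \bar R) :
  measurable_fun setT f -> (forall x, 0 <= f x)%E ->
  (\int[leb]_x f x =
   \int[leb]_(eta in cell) \int[@counting (lattice n) R]_k f (eta + lpoint theta k)%R)%E.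
Proof.
move=> mf f0.
rewrite (@ge0_integral_partition R n _ _ leb (fun k => lfloor theta @^-1` [set k]))//.
- under [RHS]eq_integral do rewrite ge0_integral_lattice//.
  rewrite integral_nneseries//; last 3 first.
  + exact: measurable_cell.
  + by move=> N; apply: measurable_funTS; exact: tile_measurable.
  + by move=> N x _; case: (enumk N) => /=.
  apply: eq_eseriesr => N _; case: (enumk N) => [k|] /=; last by rewrite integral0.
  rewrite [LHS]integral_mkcond [RHS]integral_mkcond.
  rewrite -(@ge0_integral_mp _ _ _ leb (fun x => x + lpoint theta k)); last first.
  + by move=> x; rewrite patchE; case: ifP.
  + apply/(measurable_restrictT f) => //; first exact: measurable_lfloor_eq.
    exact: measurable_funTS.
  + by move=> A mA; exact: lebesgue_rV_shift.
  + exact: measurable_shift_rV.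
  apply: eq_integral => x _; rewrite !patchE.
  have [cx|cx] := pselect (cell x).
    by rewrite mem_set ?mem_set//; exact/lfloor_shift.
  by rewrite memNset ?memNset// => /lfloor_shift.
- by move=> k; exact: measurable_lfloor_eq.
- by move=> k l x /= -> .
- by move=> x; exists (lfloor theta x).
Qed.

End tiling.

Section form_bound.
Context {R : realType} {n : nat}.
Local Notation leb := (@lebesgue_rV R n).
Local Notation cnt := (@counting (lattice n) R).
Variables (theta : R) (V : 'rV[R]_n -> R) (C m : R).
Hypothesis theta_gt0 : 0 < theta.
Hypothesis mV : measurable_fun setT V.
Hypothesis V0 : forall x, 0 <= V x.
Hypothesis VC : forall x, V x <= C.
Hypothesis res : forall eta l, l < m ->
  resolvent_set cnt (L2 cnt) (lattice_op theta V eta) l.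

Let V_L2 g : L2 leb g -> L2 leb (fun x => V x * g x).
Proof.
move=> g2; apply: (@L2_bounded_mul _ _ _ _ _ C) => // x.
by rewrite ger0_norm ?V0 ?VC.
Qed.

Let tile_integral_measurable (f : 'rV[R]_n -> \bar R) : measurable_fun setT f ->
  (forall x, 0 <= f x)%E ->
  measurable_fun (cell theta) (fun eta : 'rV[R]_n => \int[cnt]_k f (eta + lpoint theta k)%R)%E.
Proof.
move=> mf f0; apply: measurable_funTS.
rewrite (_ : (fun eta => _) = (fun eta : 'rV[R]_n => \sum_(N <oo)
  oapp (fun k : lattice n => f (eta + lpoint theta k)%R) 0 (enumk N))%E).
  apply: ge0_emeasurable_sum => N; last by move=> _; exact: tile_measurable.
  by move=> x _ _; case: (enumk N) => /=.
by apply/funext => eta; rewrite ge0_integral_lattice.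
Qed.

(* The form bound on the slices [k |-> g (x + theta k)], integrated over [x] in
   the cell. *)
Lemma shift_form_ge g : L2 leb g -> m * inner leb g g <=
  \sum_(i < n) inner leb (fun x => g (x + theta *: delta_mx 0 i) - g x)
                      (fun x => g (x + theta *: delta_mx 0 i) - g x) +
  inner leb (fun x => V x * g x) g.
Proof.
move=> g2.
pose tau i x := g (x + theta *: delta_mx 0 i) - g x.
have tau2 i : L2 leb (tau i) by apply: L2B => //; exact: shift_L2.
(* If [m <= 0], the left-hand side is nonpositive and the right-hand side nonnegative. Otherwise
   both sides are integrals of nonnegative functions, as the slicing requires. *)
have [m0|m0] := leP m 0.
  apply: (@le_trans _ _ 0); first by rewrite mulr_le0_ge0// ip_ge0.
  rewrite addr_ge0 ?sumr_ge0// => [i _|]; first exact: ip_ge0.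
  by apply: Rintegral_ge0 => x _; rewrite -mulrA mulr_ge0 ?V0// -expr2 sqr_ge0.
pose G x := \sum_(i < n) tau i x ^+ 2 + V x * g x * g x.
have G0 x : (0 <= (G x)%:E)%E.
  rewrite lee_fin addr_ge0 ?sumr_ge0// => [i _|]; first exact: sqr_ge0.
  by rewrite -mulrA mulr_ge0 ?V0// -expr2 sqr_ge0.
have mg2 : measurable_fun setT (fun x => (g x ^+ 2)%:E).
  by apply/measurable_EFinP/measurable_funX; exact: L2_measurable g2.
have g20 x : (0 <= (g x ^+ 2)%:E)%E by rewrite lee_fin sqr_ge0.
have mG : measurable_fun setT (fun x => (G x)%:E).
  apply/measurable_EFinP/measurable_funD.
    by apply: measurable_sum => i; apply: measurable_funX; exact: L2_measurable (tau2 i).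
  by apply: measurable_funM; [exact: L2_measurable (V_L2 g2)|exact: L2_measurable g2].
rewrite -lee_fin -(energy_integral tau2 g2 (V_L2 g2) V0) -/G EFinM -(L2_integral_sqr g2).
have mm0 : (0 <= m%:E)%E by rewrite lee_fin ltW.
rewrite -ge0_integralZl//.
have mmg2 : measurable_fun setT (fun x => m%:E * (g x ^+ 2)%:E)%E.
  exact: measurable_funeM.
rewrite (ge0_integral_tiling theta_gt0 mmg2); last by move=> x; rewrite mule_ge0.
rewrite (ge0_integral_tiling theta_gt0 mG G0).
(* [H] has a finite integral, so almost every slice is square-summable and the form bound of its
   lattice operator applies. *)
pose H (eta : 'rV[R]_n) := (\int[cnt]_k (g (eta + lpoint theta k)%R ^+ 2)%:E)%E.
have H0 eta : (0 <= H eta)%E by apply: integral_ge0 => k _; rewrite lee_fin sqr_ge0.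
have iH : leb.-integrable (cell theta) H.
  apply/integrableP; split; first exact: tile_integral_measurable mg2 g20.
  under eq_integral do rewrite gee0_abs//.
  by rewrite -(ge0_integral_tiling theta_gt0 mg2 g20) L2_integral_sqr// ltry.
apply: ae_ge0_le_integral.
- exact: measurable_cell.
- by move=> x _; apply: integral_ge0 => k _; rewrite mule_ge0.
- by apply: (tile_integral_measurable mmg2) => x; rewrite mule_ge0.
- by move=> x _; apply: integral_ge0 => k _.
- exact: (tile_integral_measurable mG G0).
have := integrable_ae (measurable_cell theta_gt0) iH.
apply: filterS => eta Hfin ceta; have {Hfin} Hfin := Hfin ceta.
pose ge (k : lattice n) := g (eta + lpoint theta k).
have ge2 : L2 cnt ge.
  apply/L2P; split => //; apply/integrableP; split => //.
  rewrite (eq_integral (fun k => (ge k ^+ 2)%:E)); last first.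
    by move=> k _ /=; rewrite ger0_norm ?sqr_ge0.
  by rewrite -ge0_fin_numE//; exact: H0.
rewrite ge0_integralZl//.
have := lattice_form_ge V0 VC (res eta) ge2.
have tge2 i : L2 cnt (fun k => ge (k + evec i) - ge k).
  by apply: L2B => //; exact: lattice_shift_L2.
have Vge2 : L2 cnt (fun k => Vk theta V eta k * ge k).
  by apply: (@L2_bounded_mul _ _ _ _ _ C) => // k; rewrite ger0_norm ?V0 ?VC.
rewrite -lee_fin -(energy_integral tge2 ge2 Vge2); last by move=> k; exact: V0.
rewrite EFinM -(L2_integral_sqr ge2) => /le_trans; apply.
rewrite le_eqVlt; apply/orP; left; apply/eqP; apply: eq_integral => k _.
congr EFin; rewrite /G /Vk /ge (addrC (lpoint _ _) eta); congr (_ + _).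
by apply: eq_bigr => i _; rewrite /tau lpointD lpoint_evec addrA.
Qed.

(** Replacing the discrete kinetic energy by the larger continuous one gives the form bound for
    [B_theta]. *)
Lemma test_form_ge g : test_function g -> m * inner leb g g <=
  theta ^+ 2 * (\sum_(i < n) inner leb (partial i g) (partial i g)) +
  inner leb (fun x => V x * g x) g.
Proof.
move=> tg; apply: (le_trans (shift_form_ge (test_L2 tg))).
rewrite lerD2r mulr_sumr; apply: ler_sum => i _.
have := shift_bound i (ltW theta_gt0) tg.
rewrite -!sqr_nrm -exprMn => h.
by rewrite lerXn2r// nnegrE ?nrm_ge0// mulr_ge0 ?nrm_ge0// ltW.
Qed.

End form_bound.

(** * Mollification and weak uniqueness *)

Section rays.
Context {R : realType} {n : nat}.

Lemma measurable_open_ray (a : 'rV[R]_n) : measurable (open_ray a).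
Proof.
rewrite (_ : open_ray a = \bigcap_(i in [set: 'I_n])
    ((fun x : 'rV[R]_n => x ord0 i) @^-1` `]a ord0 i, +oo[%classic)).
  apply: fin_bigcap_measurable => // i _; rewrite -[X in measurable X]setTI.
  by apply: measurable_rV_coord => //; exact: measurable_itv.
apply/seteqP; split=> [x xa i _|x xa i]; first by rewrite /= in_itv/= andbT.
by have := xa i I; rewrite /= in_itv/= andbT.
Qed.

Definition rays : set (set 'rV[R]_n) := range (@open_ray R n).

Lemma setI_closed_rays : setI_closed rays.
Proof.
move=> _ _ [a _ <-] [b _ <-]; exists (\row_i Num.max (a ord0 i) (b ord0 i)) => //.
apply/seteqP; split=> [x h|x [h1 h2] i].
  by split=> i; have := h i; rewrite mxE gt_max => /andP[].
by rewrite mxE gt_max h1 h2.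
Qed.

(** A half-space in one coordinate is the union over [N] of the rays whose other coordinates start
    at [- N]. *)
Lemma measurable_rays : @measurable _ 'rV[R]_n = <<s rays >>.
Proof.
apply/seteqP; split; last first.
  apply: smallest_sub; first exact: sigma_algebra_measurable.
  by move=> _ [a _ <-]; exact: measurable_open_ray.
apply: smallest_sub; first exact: smallest_sigma_algebra.
move=> B; rewrite -bigcup_seq/= => -[i _ [Y mY <-]]; rewrite setTI.
move: mY; rewrite -[measurable]/((@ocitv R).-sigma.-measurable).
rewrite RGenOInfty.measurableE => mY.
have [s0 sD sU] := smallest_sigma_algebra setT rays.
suff : (@RGenOInfty.G R).-sigma.-measurable `<=`
    [set Y | <<s rays >> ((fun x : 'rV[R]_n => x ord0 i) @^-1` Y)] by exact.
apply: smallest_sub.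
  split => /=.
  - by rewrite preimage_set0.
  - by move=> A sA; rewrite setTD preimage_setC -setTD; exact: sD.
  - by move=> F sF; rewrite preimage_bigcup; exact: sU.
move=> _ [x ->] /=.
rewrite (_ : _ @^-1` _ = \bigcup_(N : nat)
    open_ray (\row_j (if j == i then x else - N%:R))).
  apply: sU => N; apply: sub_gen_smallest.
  by exists (\row_j (if j == i then x else - N%:R)).
apply/seteqP; split=> [y|y [N _ /(_ i)]] /=; rewrite in_itv/= andbT; last first.
  by rewrite mxE eqxx.
move=> xy; exists (Num.truncn `|y|).+1 => // j; rewrite mxE.
case: eqP => [->//|_]; rewrite ltrNl.
apply: le_lt_trans (truncnS_gt _).
by apply: le_trans (coord_le_norm y j); rewrite -normrN ler_norm.
Qed.

End rays.

Section fundamental_lemma.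
Context {R : realType} {n : nat}.
Local Notation leb := (@lebesgue_rV R n).

(** The sets over which [u] has integral zero form a Dynkin system, and the rays that generate the
    sigma-algebra are closed under intersection. *)
Lemma integral_rays_eq0 (u : 'rV[R]_n -> R) : leb.-integrable setT (EFin \o u) ->
  (forall a, \int[leb]_(x in open_ray a) (u x)%:E = 0)%E ->
  forall A, measurable A -> (\int[leb]_(x in A) (u x)%:E = 0)%E.
Proof.
move=> ui u0 A mA.
have uS B : measurable B -> leb.-integrable B (EFin \o u).
  by move=> mB; apply: integrableS ui.
(* Complements require the whole space, which is an increasing union of rays. Monotone convergence
   is applied to the positive and negative parts separately, since [u] may change sign. *)
have uT : (\int[leb]_x (u x)%:E = 0)%E.
  pose a N : 'rV[R]_n := const_mx (- N%:R).
  have UT : \bigcup_N open_ray (a N) = setT.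
    apply/seteqP; split => // x _; exists (Num.truncn `|x|).+1 => // j.
    rewrite mxE ltrNl; apply: le_lt_trans (truncnS_gt _).
    by apply: le_trans (coord_le_norm x j); rewrite -normrN ler_norm.
  have nd : nondecreasing_seq (fun N => open_ray (a N)).
    move=> N M NM; apply/subsetPset => x h j; have := h j; rewrite !mxE.
    by apply: le_lt_trans; rewrite lerN2 ler_nat.
  have mr N : measurable (open_ray (a N)) by exact: measurable_open_ray.
  have pos (f : 'rV[R]_n -> \bar R) : measurable_fun setT f -> (forall x, 0 <= f x)%E ->
      (\int[leb]_(x in open_ray (a N)) f x @[N --> \oo] --> \int[leb]_x f x)%E.
    move=> mf f0; rewrite -UT; apply: ge0_nondecreasing_set_cvg_integral => //.
    by move=> N; exact: measurable_funTS.
  have mu := measurable_int _ ui.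
  have cp := pos _ (measurable_funepos mu) (fun x => funepos_ge0 _ x).
  have cn := pos _ (measurable_funeneg mu) (fun x => funeneg_ge0 _ x).
  rewrite integralE.
  have eqN N : (\int[leb]_(x in open_ray (a N)) (EFin \o u)^\+ x =
      \int[leb]_(x in open_ray (a N)) (EFin \o u)^\- x)%E.
    have := u0 (a N); rewrite integralE.
    have fin : (\int[leb]_(x in open_ray (a N)) (EFin \o u)^\- x)%E \is a fin_num.
      by apply: integrable_fin_num => //; apply: integrable_funeneg => //; exact: uS.
    move=> /(congr1 (fun z => z + \int[leb]_(x in open_ray (a N)) (EFin \o u)^\- x)%E).
    by rewrite subeK// add0e.
  rewrite (_ : (fun N => _) = (fun N =>
    \int[leb]_(x in open_ray (a N)) (EFin \o u)^\- x)%E) in cp; last exact/funext.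
  rewrite (cvg_unique _ cp cn)// subee//.
  by apply: integrable_fin_num => //; exact: integrable_funeneg.
have sA : <<s (@rays R n) >> A by rewrite -measurable_rays.
move: A sA {mA}.
apply: (dynkin_induction measurable_rays setI_closed_rays) => //.
- by move=> _ [a _ <-].
- move=> S mS S0; have mSC := measurableC mS.
  have : (\int[leb]_(x in S `|` ~` S) (u x)%:E = 0)%E by rewrite setUv.
  rewrite integral_setU//.
  + by rewrite S0 add0e.
  + by rewrite setUv; exact: measurable_int ui.
  + by apply/disj_setPS; rewrite setICr.
- move=> F mF tF F0; rewrite integral_bigcup//; last exact/uS/bigcupT_measurable.
  by apply: eseries0 => k _ _.
Qed.

(* The open rays form a pi-system, and their indicators are limits of smooth
   functions. *)
Lemma fundamental_lemma (v : 'rV[R]_n -> R) : L2 leb v ->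
  (forall psi, test_function psi -> inner leb v psi = 0) -> v = cst 0 %[ae leb].
Proof.
move=> v2 v0.
(* The cut-off makes [v * chi N] integrable and [ray a k * chi N] a test function; where it is
   positive it can be divided out. *)
pose chi N (x : 'rV[R]_n) : R := bump ((N.+1%:R^-1) *: x + 0).
have N0 N : (0 : R) < N.+1%:R^-1 by rewrite invr_gt0 ltr0n.
have tchi N : test_function (chi N).
  by apply: test_affine; [rewrite gt_eqF|exact: test_bump].
have vchi N : {ae leb, forall x, v x * chi N x = 0}.
  have ui : leb.-integrable setT (EFin \o (fun x => v x * chi N x)).
    exact: L2_mul v2 (test_L2 (tchi N)).
  have mu := measurable_int _ ui.
  have : ae_eq leb setT (EFin \o (fun x => v x * chi N x)) (cst 0%E).
    apply: integral_ae_eq => // E _ mE; rewrite integral0.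
    apply: (integral_rays_eq0 ui) => // a.
    pose f k x : \bar R := (v x * chi N x * ray a k x)%:E.
    pose g x : \bar R := (v x * chi N x * \1_(open_ray a) x)%:E.
    have mr k : measurable_fun setT (ray a k).
      by apply: continuous_measurable_rV; apply: smooth_continuous; exact: smooth_ray.
    have m1 : measurable_fun setT (\1_(open_ray a) : 'rV[R]_n -> R).
      by apply: measurable_indic; exact: measurable_open_ray.
    have mvc : measurable_fun setT (fun x => v x * chi N x) by exact/measurable_EFinP.
have fint k : (\int[leb]_x f k x = 0)%E.
      have := v0 _ (testM (smooth_ray a k) (tchi N)); rewrite /inner /Rintegral.
      have EE : (\int[leb]_x (v x * (ray a k x * chi N x))%:E = \int[leb]_x f k x)%E.
        by apply: eq_integral => x _; rewrite /f; congr EFin; ring.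
      rewrite EE => h; rewrite -[LHS]fineK ?h// -EE.
      by apply: integrable_fin_num => //; apply: L2_mul v2 (test_L2 (testM (smooth_ray a k) (tchi N))).
    have cv : [sequence (\int[leb]_x f k x)%E]_k @ \oo --> (0 : \bar R).
      rewrite (_ : [sequence _]_k = cst 0%E); first exact: cvg_cst.
      by apply/funext => k; exact: fint.
    have mf k : measurable_fun setT (f k).
      by apply/measurable_EFinP; exact: measurable_funM.
    have mg : measurable_fun setT g by apply/measurable_EFinP; exact: measurable_funM.
    have fg : {ae leb, forall x, setT x -> f ^~ x @ \oo --> g x}.
      apply: aeW => x _; rewrite /f /g; apply: cvg_EFin; first exact: nearW.
      by apply: cvgM; [exact: cvg_cst|exact: ray_cvg].
    have fb : {ae leb, forall x k, setT x -> (`|f k x| <= `|(v x * chi N x)%:E|)%E}.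
      apply: aeW => x k _; rewrite /f lee_fin normrM ler_piMr//.
      by rewrite ger0_norm ?ray_ge0// ray_le1.
    have [_ _ cvf] := dominated_convergence measurableT mf mg fg (integrable_abse ui) fb.
    have g0 : (\int[leb]_x g x = 0)%E by exact: cvg_unique cvf cv.
    rewrite integral_mkcond -[RHS]g0; apply: eq_integral => x _.
    by rewrite patchE /g indicE; case: ifP => _; rewrite ?mulr1 ?mulr0.
  apply: filterS => x /(_ I) /= []; exact.
have : {ae leb, forall x, forall N, v x * chi N x = 0} by exact/ae_foralln.
apply: filterS => x h _ /=.
have [N xN] : exists N, `|x| < N.+1%:R.
  by exists (Num.truncn `|x|); exact: truncnS_gt.
have := h N => /eqP; rewrite mulf_eq0 => /orP[/eqP//|].
rewrite gt_eqF// bump_gt0// addr0 normrZ gtr0_norm//.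
by rewrite mulrC ltr_pdivrMr ?mul1r ?ltr0n.
Qed.

End fundamental_lemma.

Lemma div_mul_le {R : realFieldType} (e a : R) : 0 <= e -> 0 <= a -> e / (a + 1) * a <= e.
Proof.
move=> e0 a0; have a1 : 0 < a + 1 by rewrite ltr_wpDl.
by rewrite mulrAC ler_pdivrMr// ler_wpM2l// lerDl.
Qed.

(** * Mollifiers and convolution *)

Section mollifier.
Context {R : realType} {n : nat}.
Local Notation leb := (@lebesgue_rV R n).
Local Notation ip := (inner leb).
Local Notation nrm := (L2norm leb).

(** Evenness, [mollN], makes convolution with [rho] symmetric for the inner product. *)
Record mollifier (e : R) (rho : 'rV[R]_n -> R) : Prop := Mollifier {
  moll_test : test_function rho;
  moll_ge0 : forall x, 0 <= rho x;
  mollN : forall x, rho (- x) = rho x;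
  moll_bsupp : bsupp e rho;
  moll_int : \int[leb]_x rho x = 1 }.

Lemma exists_mollifier (e : R) : 0 < e -> exists rho, mollifier e rho.
Proof.
move=> e0; have ei : 0 < e^-1 by rewrite invr_gt0.
pose b (x : 'rV[R]_n) : R := bump (e^-1 *: x + 0).
have tb : test_function b.
  by apply: test_affine; [rewrite gt_eqF|exact: test_bump].
have b0 x : 0 <= b x by exact: bump_ge0.
have ib := test_integrable tb.
pose Z := \int[leb]_x b x.
(* A nonnegative function with integral zero vanishes almost everywhere, yet the rescaled bump is
   positive on a cube of side [e]. *)
have Z0 : 0 < Z.
  rewrite lt_def Rintegral_ge0// andbT; apply/eqP => Z0.
  have mb := measurable_int _ ib.
  have : (\int[leb]_x `|(EFin \o b) x| = 0)%E.
    under eq_integral do rewrite /= ger0_norm//.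
    have := integrable_fin_num measurableT ib.
    by move: Z0; rewrite /Z /Rintegral => h /fineK; rewrite h.
  move=> /(ae_eq_integral_abs leb measurableT mb)[N [mN N0 sub]].
  have e20 : 0 <= e / 2 by rewrite divr_ge0// ltW.
  have : (leb (cball n (e / 2)) <= leb N)%E.
    have mc : measurable (cball n (e / 2)) := @measurable_cball R n (e / 2).
    apply: (le_measure leb) (mem_set mc) (mem_set mN) _.
    move=> x xe; apply: sub => /(_ I) /= [] /eqP; apply/negP.
    rewrite gt_eqF// bump_gt0// addr0 normrZ gtr0_norm//.
    by rewrite mulrC ltr_pdivrMr// mul1r (le_lt_trans xe)// ltr_pdivrMr// ltr_pMr// ltr1n.
  rewrite N0 [X in (X <= _)%E](lebesgue_rV_cball n e20) lee_fin leNgt.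
  by rewrite exprn_gt0// mulrn_wgt0// divr_gt0.
exists (fun x => Z^-1 * b x); split.
- exact: testZ.
- by move=> x; rewrite mulr_ge0// invr_ge0 ltW.
- by move=> x; rewrite /b !addr0 scalerN bumpN.
- move=> x xe; have -> : b x = 0; last by rewrite mulr0.
  apply: bump_bsupp; rewrite addr0 normrZ gtr0_norm//.
  by rewrite mulrC ltr_pdivlMr// mul1r.
- by rewrite RintegralZl// mulVf// gt_eqF.
Qed.

Lemma shift_cvg (psi : 'rV[R]_n -> R) (e : R) : test_function psi -> 0 < e ->
  exists2 delta : R, 0 < delta &
    forall a, `|a| <= delta -> nrm (fun x => psi (x + a) - psi x) <= e.
Proof.
move=> tpsi e0; have /test_functionP[spsi [M M0 psiM]] := tpsi.
have M1 : 0 <= M + 1 by rewrite addr_ge0.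
set s := Num.sqrt (vol (n := n) (M + 1)).
have s1 : 0 < s + 1 by rewrite ltr_wpDl// sqrtr_ge0.
have [delta d0 hd] := uniform_continuous_cball (M + 1)
  (@smooth_continuous _ _ _ spsi) (divr_gt0 e0 s1).
exists (Num.min delta 1); first by rewrite lt_min d0 ltr01.
move=> a; rewrite le_min => /andP[ad a1].
have td : test_function (fun x => psi (x + a) - psi x).
  by apply: testB => //; exact: test_shift.
have bd : bsupp (M + 1) (fun x => psi (x + a) - psi x).
  move=> x xM; rewrite (bsupp_shift (a := a) psiM); last first.
    by apply: le_lt_trans xM; rewrite lerD2l.
  by rewrite (psiM x) ?subrr// (lt_trans _ xM)// ltrDl.
apply: le_trans (nrm_bsupp M1 (test_measurable td) bd (C := e / (s + 1)) _) _.
  move=> x; have [xM|xM] := leP `|x| (M + 1); last first.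
    by rewrite bd// normr0 divr_ge0// ltW.
  by rewrite distrC hd// opprD addrA subrr sub0r normrN.
rewrite -/s mulrAC ler_pdivrMr// ler_wpM2l ?(ltW e0)// lerDl//.
Qed.

Variable v : 'rV[R]_n -> R.
Hypothesis v2 : L2 leb v.
#[local] Opaque partial inner L2norm.

(** As a pairing of [v] with a translate of [psi], it inherits its regularity in [x] from
    translations in [L2]. The argument [y - x] instead of [x - y] costs a sign in each
    derivative. *)
Definition conv (psi : 'rV[R]_n -> R) (x : 'rV[R]_n) : R := ip v (fun y => psi (y - x)).

Lemma continuous_conv psi : test_function psi -> continuous (conv psi).
Proof.
move=> tpsi x; apply/(@cvgrPdist_le R R^o 'rV[R]_n (nbhs x)) => /= e e0.
have v1 : 0 < nrm v + 1 by rewrite ltr_wpDl// nrm_ge0.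
have [delta d0 hd] := shift_cvg tpsi (divr_gt0 e0 v1).
near=> y.
have xy : `|x - y| <= delta.
  by near: y; apply/nbhs_ballP; exists delta => //= y; rewrite -ball_normE /= => /ltW.
have p2 := test_L2 tpsi.
have E : conv psi x - conv psi y =
    ip (fun z => psi (z - y + (y - x)) - psi (z - y)) v.
  have -> : conv psi x = ip v (fun z => psi (z - y + (y - x))).
    by apply: eq_ip => // z; rewrite addrA subrK.
  rewrite [RHS]ipC ipBr//; [|exact: shift_L2].
  by have := shift_L2 (- y) (shift_L2 (y - x) p2).
rewrite E; have q2 := L2B (shift_L2 (y - x) p2) p2.
have sh := nrm_shift (- y) q2.
have := hd (y - x); rewrite distrC xy => /(_ isT); rewrite -sh => h.
apply: (le_trans (ip_le_nrm (shift_L2 (- y) q2) v2 h)).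
exact: (div_mul_le (ltW e0) (nrm_ge0 leb v)).
Unshelve. all: by end_near. Qed.

(** The difference quotient in [x] passes to [psi] with step [- h], and there it converges in
    [L2]. *)
Lemma dirder_conv psi i x : test_function psi ->
  dirder (conv psi) x (delta_mx 0 i) (- conv (partial i psi) x).
Proof.
move=> tpsi; have v1 : 0 < nrm v + 1 by rewrite ltr_wpDl// nrm_ge0.
have lim0 : h^-1 *: (((conv psi : _ -> R^o) \o shift x) (h *: delta_mx 0 i) - conv psi x)
    @[h --> 0^'] --> (- conv (partial i psi) x : R^o).
  apply/cvgrPdist_le => /= e e0.
  have [delta d0 hd] := diffq_cvg i tpsi (divr_gt0 e0 v1).
  near=> h.
  have h0 : h != 0 by near: h; exact: nbhs_dnbhs_neq.
  have h1 : `|h| <= delta by near: h; exact: dnbhs0_le.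
  have q2 := L2B (test_L2 (test_diffq i (- h) tpsi)) (test_L2 (test_partial i tpsi)).
  have hN : - h != 0 by rewrite oppr_eq0.
  have hd' := hd (- h) hN; rewrite normrN in hd'; have {}hd' := hd' h1.
  have sh := nrm_shift (- x) q2; rewrite -sh in hd'.
  have E : - conv (partial i psi) x - h^-1 *: (conv psi (h *: delta_mx 0 i + x) - conv psi x) =
    ip (fun z => diffq i (- h) psi (z - x) - partial i psi (z - x)) v.
    have A2 := shift_L2 (- x) (test_L2 (test_diffq i (- h) tpsi)).
    have B2 := shift_L2 (- x) (test_L2 (test_partial i tpsi)).
    have C2 := shift_L2 (- x) (shift_L2 (- h *: delta_mx 0 i) (test_L2 tpsi)).
    have D2 := shift_L2 (- x) (test_L2 tpsi).
    apply: etrans (esym (ipBl A2 B2 v2)); rewrite addrC.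
    congr (_ - _); last exact: ipC.
    apply: etrans (ipC _ _ _); apply: etrans (esym (ipZr (- h)^-1 (L2B C2 D2) v2)).
    have -> : conv psi (h *: delta_mx 0 i + x) =
        ip v (fun z => psi (z - x + - h *: delta_mx 0 i)).
      apply: (eq_ip _ (fun=> erefl)) => z.
      by congr psi; rewrite scaleNr opprD addrA addrAC.
    rewrite invrN mulNr; congr (- (_ * _)); exact: (esym (ipBr C2 D2 v2)).
  rewrite E; apply: (le_trans (ip_le_nrm (shift_L2 (- x) q2) v2 hd')).
  exact: (div_mul_le (ltW e0) (nrm_ge0 leb v)).
apply: DeriveDef; first by apply/cvg_ex; exists (- conv (partial i psi) x).
exact: cvg_lim lim0.
Unshelve. all: by end_near. Qed.

Lemma convN psi x : test_function psi -> conv (fun y => -1 * psi y) x = - conv psi x.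
Proof.
move=> tpsi; rewrite /conv ipZr ?mulN1r//.
exact: (shift_L2 (- x) (test_L2 tpsi)).
Qed.

Lemma partial_conv psi i : test_function psi ->
  partial i (conv psi) = conv (fun y => -1 * partial i psi y).
Proof.
move=> tpsi; apply: partialE => x.
rewrite convN; last exact: test_partial.
exact: dirder_conv.
Qed.

Lemma smooth_conv psi : test_function psi -> smooth (conv psi).
Proof.
move=> tpsi; apply: (smooth_coind (P := fun w => exists2 psi, test_function psi & w = conv psi)).
  move=> _ [{tpsi} {}psi tpsi ->]; split; first exact: continuous_conv.
  move=> i; exists (conv (fun y => -1 * partial i psi y)).
    by exists (fun y => -1 * partial i psi y) => //; apply: testZ; exact: test_partial.
  move=> x; rewrite convN; last exact: test_partial.
  exact: dirder_conv.
by exists psi.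
Qed.

Lemma partial2_conv psi i x : test_function psi ->
  partial i (partial i (conv psi)) x = conv (partial i (partial i psi)) x.
Proof.
move=> tpsi; have tp := test_partial i tpsi.
rewrite partial_conv// partial_conv//; last exact: testZ.
rewrite partialZ; last exact: test_smooth.
apply: eq_ip => // y; rewrite mulrA mulN1r opprK mul1r.
done.
Qed.

End mollifier.

Section convolution.
Context {R : realType} {n : nat}.
Local Notation leb := (@lebesgue_rV R n).
Local Notation ip := (inner leb).
Local Notation nrm := (L2norm leb).
Variables (e : R) (rho : 'rV[R]_n -> R).
Hypothesis mrho : mollifier e rho.

Let trho : test_function rho := moll_test mrho.

Lemma mollB x y : rho (x - y) = rho (y - x).
Proof. by rewrite -(mollN mrho) opprB. Qed.

Lemma moll_shift_int (x : 'rV[R]_n) : \int[leb]_y rho (y - x) = 1.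
Proof. by rewrite (Rintegral_shift (- x) (test_integrable trho)) (moll_int mrho). Qed.

Lemma moll_shift_integrable (x : 'rV[R]_n) :
  leb.-integrable setT (EFin \o (fun y => rho (y - x))).
Proof. exact: test_integrable (test_shift (- x) trho). Qed.

Lemma measurable_moll_prod :
  measurable_fun setT (fun z : 'rV[R]_n * 'rV[R]_n => rho (z.2 - z.1)).
Proof.
apply: (measurableT_comp (test_measurable trho)).
apply: measurable_fun_rV => i.
rewrite (_ : (fun _ => _) = (fun z : 'rV[R]_n * 'rV[R]_n => z.2 ord0 i - z.1 ord0 i)).
  apply: measurable_funB.
    by apply: (measurableT_comp (measurable_rV_coord i)); exact: measurable_snd.
  by apply: (measurableT_comp (measurable_rV_coord i)); exact: measurable_fst.
by apply/funext => z; rewrite !mxE.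
Qed.

(* The convolution of [rho] with [v ^+ 2], at [x]. *)
Definition gam (v : 'rV[R]_n -> R) x := ip (fun y => rho (y - x) * v y) v.

Lemma moll_mul_L2 v x : L2 leb v -> L2 leb (fun y => rho (y - x) * v y).
Proof.
move=> v2; have [C _ hC] := test_bounded trho.
apply: (@L2_bounded_mul _ _ _ _ _ C) => //.
exact: test_measurable (test_shift (- x) trho).
Qed.

Lemma gam_ge0 v x : 0 <= gam v x.
Proof.
apply: Rintegral_ge0 => y _.
by rewrite -mulrA mulr_ge0 ?(moll_ge0 mrho)// -expr2 sqr_ge0.
Qed.

(** Tonelli's theorem and the unit mass of [rho]. A function whose square is at most [gam v]
    pointwise is thereby bounded in norm by [v]. *)
Lemma int_gam v : L2 leb v ->
  leb.-integrable setT (EFin \o gam v) /\ \int[leb]_x gam v x = ip v v.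
Proof.
move=> v2.
pose f (z : 'rV[R]_n * 'rV[R]_n) : \bar R := (rho (z.2 - z.1) * v z.2 * v z.2)%:E.
have f0 z : (0 <= f z)%E.
  by rewrite lee_fin -mulrA mulr_ge0 ?(moll_ge0 mrho)// -expr2 sqr_ge0.
have mf : measurable_fun setT f.
  have mv2 : measurable_fun setT (fun z : 'rV[R]_n * 'rV[R]_n => v z.2).
    by apply: (measurableT_comp (L2_measurable v2)); exact: measurable_snd.
  apply/measurable_EFinP; apply: measurable_funM => //.
  by apply: measurable_funM => //; exact: measurable_moll_prod.
have F x : (\int[leb]_y f (x, y) = (gam v x)%:E)%E.
  rewrite /gam /inner /Rintegral fineK//.
  by apply: integrable_fin_num => //; exact: L2_mul (moll_mul_L2 x v2) v2.
have G y : (\int[leb]_x f (x, y) = (v y ^+ 2)%:E)%E.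
  have E : (fun x => f (x, y)) = (fun x => (v y ^+ 2)%:E * (rho (x - y))%:E)%E.
    by apply/funext => x; rewrite /f /= -EFinM mollB; congr EFin; ring.
  rewrite E ge0_integralZl//; last 3 first.
  - by have := measurable_int _ (moll_shift_integrable y).
  - by move=> x _; rewrite lee_fin (moll_ge0 mrho).
  - by rewrite lee_fin sqr_ge0.
  have := moll_shift_int y; rewrite /Rintegral => h.
  have /fineK := integrable_fin_num measurableT (moll_shift_integrable y).
  by move=> <-; rewrite [X in (_ * X%:E)%E]h mule1.
have T : (\int[leb]_x (gam v x)%:E = (ip v v)%:E)%E.
  rewrite -L2_integral_sqr//.
  transitivity (\int[leb]_x \int[leb]_y f (x, y))%E.
    by apply: eq_integral => x _; rewrite F.
  rewrite (fubini_tonelli f mf f0).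
  by apply: eq_integral => y _; rewrite G.
have mg : measurable_fun setT (EFin \o gam v).
  have := measurable_fun_fubini_tonelli_F (m2 := leb) f mf f0.
  by congr measurable_fun; apply/funext => x; rewrite /fubini_F F.
split; last by rewrite /Rintegral T.
apply/integrableP; split => //.
under eq_integral do rewrite /= ger0_norm ?gam_ge0//.
by rewrite T ltry.
Qed.

(** Cauchy-Schwarz after splitting [rho] into two square roots, one put with [v] and one with [k].
    The bound [K] only ensures membership in [L2]; the estimate is governed by [om], the bound of
    [k] within distance [e] of [x]. The weight [1] gives the convolution, the weight [V x - V y] its
    commutator with [V]. *)
Lemma conv_weight v (k : 'rV[R]_n -> R) (K om : R) x : L2 leb v ->
  measurable_fun setT k -> (forall y, `|k y| <= K) -> 0 <= om ->
  (forall y, `|y - x| <= e -> `|k y| <= om) ->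
  ip v (fun y => k y * rho (y - x)) ^+ 2 <= om ^+ 2 * gam v x.
Proof.
move=> v2 mk kK om0 kom.
pose s y := Num.sqrt (rho (y - x)).
have mrx := test_measurable (test_shift (- x) trho).
have ss y : s y * s y = rho (y - x) by rewrite -expr2 sqr_sqrtr// (moll_ge0 mrho).
have ms : measurable_fun setT s.
  have msq : measurable_fun [set: R] (@Num.sqrt R).
    apply: continuous_measurable_fun; exact: sqrt_continuous.
  exact: (measurableT_comp msq mrx).
have s2 : L2 leb s.
  apply/L2P; split => //; apply: eq_integrable (moll_shift_integrable x) => //.
  by move=> y _ /=; rewrite expr2 ss.
have [C C0 hC] := test_bounded trho.
(* [C + 1] bounds the square root of [C]. *)
have sC y : `|s y| <= C + 1.
  rewrite ger0_norm ?sqrtr_ge0// -(@ler_pXn2r _ 2)// ?nnegrE ?sqrtr_ge0 ?addr_ge0//.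
  rewrite sqr_sqrtr ?(moll_ge0 mrho)//; apply: le_trans (ler_norm _) _.
  by apply: le_trans (hC _) _; nra.
have sv2 : L2 leb (fun y => s y * v y) by exact: L2_bounded_mul ms sC v2.
have ks2 : L2 leb (fun y => k y * s y) by exact: L2_bounded_mul mk kK s2.
have -> : ip v (fun y => k y * rho (y - x)) = ip (fun y => s y * v y) (fun y => k y * s y).
  by apply: eq_Rintegral => y _; rewrite -ss; ring.
have -> : gam v x = ip (fun y => s y * v y) (fun y => s y * v y).
  by apply: eq_Rintegral => y _; rewrite -ss; ring.
apply: (le_trans (ip_CS sv2 ks2)); rewrite mulrC ler_wpM2r ?ip_ge0//.
have -> : om ^+ 2 = \int[leb]_y (om ^+ 2 * rho (y - x)).
  by rewrite (RintegralZl _ measurableT (moll_shift_integrable x)) moll_shift_int mulr1.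
apply: le_Rintegral => //.
- exact: (L2_mul ks2 ks2).
- exact: (EFin_integrableZ _ (moll_shift_integrable x)).
move=> y _; rewrite -ss (_ : k y * s y * (k y * s y) = k y ^+ 2 * (s y * s y)); last by ring.
rewrite ss; have [yx|yx] := leP `|y - x| e; last by rewrite (moll_bsupp mrho)// !mulr0.
rewrite ler_wpM2r ?(moll_ge0 mrho)//.
by rewrite -[leLHS]ger0_norm ?sqr_ge0// normrX lerXn2r ?nnegrE// kom.
Qed.

Lemma conv_gam v x : L2 leb v -> conv v rho x ^+ 2 <= gam v x.
Proof.
move=> v2; have := @conv_weight v (cst 1) 1 1 x v2.
rewrite expr1n mul1r => h.
have -> : conv v rho x = ip v (fun y => cst 1 y * rho (y - x)).
  by apply: (eq_ip _ (fun=> erefl)) => y; rewrite mul1r.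
by apply: h => // y; rewrite ?normr1.
Qed.

Lemma conv_L2 v : L2 leb v -> L2 leb (conv v rho).
Proof.
move=> v2; have [ig _] := int_gam v2.
have mc : measurable_fun setT (conv v rho).
  by apply: continuous_measurable_rV; exact: continuous_conv.
apply/L2P; split => //; apply: le_integrable ig => //.
  by apply/measurable_EFinP; exact: measurable_funX.
by move=> x _ /=; rewrite lee_fin !ger0_norm ?sqr_ge0 ?gam_ge0// conv_gam.
Qed.

Lemma nrm_conv v : L2 leb v -> nrm (conv v rho) <= nrm v.
Proof.
move=> v2; have [ig ig'] := int_gam v2; have c2 := conv_L2 v2.
rewrite -(@ler_pXn2r _ 2)// ?nnegrE ?nrm_ge0// !sqr_nrm -ig'.
apply: le_Rintegral => //; first exact: (L2_mul c2 c2).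
by move=> x _; rewrite -expr2 conv_gam.
Qed.

(** Fubini's theorem and the evenness of [rho]; absolute integrability holds because the convolution
    of [|v|] is in [L2] as well. *)
Lemma ip_conv v psi : L2 leb v -> test_function psi ->
  ip (conv v rho) psi = ip v (conv psi rho).
Proof.
move=> v2 tpsi; have p2 := test_L2 tpsi.
pose f (z : 'rV[R]_n * 'rV[R]_n) : \bar R := (v z.2 * rho (z.2 - z.1) * psi z.1)%:E.
have mf : measurable_fun setT f.
  apply/measurable_EFinP; apply: measurable_funM.
    apply: measurable_funM; last exact: measurable_moll_prod.
    by apply: (measurableT_comp (L2_measurable v2)); exact: measurable_snd.
  by apply: (measurableT_comp (L2_measurable p2)); exact: measurable_fst.
pose w y := `|v y|.
have w2 : L2 leb w.
  apply: (L2_le _ _ v2) => [|x]; last by rewrite normr_id.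
  by apply: measurableT_comp => //; exact: L2_measurable v2.
have rx2 x : L2 leb (fun y => rho (y - x)) by exact: (shift_L2 (- x) (test_L2 trho)).
have cw0 x : 0 <= conv w rho x.
  apply: Rintegral_ge0 => y _.
  by apply: mulr_ge0; [exact: normr_ge0|exact: (moll_ge0 mrho)].
have fin : (leb \x leb)%E.-integrable setT f.
  apply/integrable12ltyP => //.
  have E x : (\int[leb]_y `|f (x, y)| = `|(psi x * conv w rho x)%:E|)%E.
    rewrite abse_EFin normrM (ger0_norm (cw0 x)) EFinM.
    have -> : ((conv w rho x)%:E = \int[leb]_y (w y * rho (y - x))%:E)%E.
      rewrite /conv /inner /Rintegral fineK//.
      by apply: integrable_fin_num => //; exact: L2_mul w2 (rx2 x).
    rewrite -ge0_integralZl//.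
    - apply: eq_integral => y _; rewrite /f /= !normrM (ger0_norm (moll_ge0 mrho _)).
      by rewrite -EFinM; congr EFin; rewrite mulrC.
    - by have := measurable_int _ (L2_mul w2 (rx2 x)).
    - move=> y _; rewrite lee_fin.
      by apply: mulr_ge0; [exact: normr_ge0|exact: (moll_ge0 mrho)].
  under eq_integral do rewrite E.
  by have /integrableP[] := L2_mul p2 (conv_L2 w2).
have := Fubini fin.
have -> : (\int[leb]_x \int[leb]_y f (x, y) = \int[leb]_x (conv v rho x * psi x)%:E)%E.
  apply: eq_integral => x _; rewrite /conv /inner /Rintegral EFinM fineK; last first.
    by apply: integrable_fin_num => //; exact: L2_mul v2 (rx2 x).
  rewrite -integralZr//; last exact: L2_mul v2 (rx2 x).
have -> : (\int[leb]_y \int[leb]_x f (x, y) = \int[leb]_y (v y * conv psi rho y)%:E)%E.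
  apply: eq_integral => y _; rewrite /conv /inner /Rintegral EFinM fineK; last first.
    by apply: integrable_fin_num => //; exact: L2_mul p2 (rx2 y).
  rewrite -integralZl//; last exact: L2_mul p2 (rx2 y).
  apply: eq_integral => x _; rewrite /f /= -EFinM mollB; congr EFin; ring.
by move=> h; congr fine.
Qed.

End convolution.

(** The difference is the average of [psi x - psi y] against [rho]. It is uniformly small and
    supported in a fixed cube, hence small in norm. *)
Lemma conv_approx {R : realType} {n : nat} (psi : 'rV[R]_n -> R) (eta : R) :
  test_function psi -> 0 < eta ->
  exists2 e0 : R, 0 < e0 & forall e rho, e <= e0 -> mollifier e rho ->
    L2norm (@lebesgue_rV R n) (fun y => conv psi rho y - psi y) <= eta.
Proof.
move=> tpsi eta0; have /test_functionP[spsi [M M0 psiM]] := tpsi.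
have M1 : 0 <= M + 1 by rewrite addr_ge0.
have p2 := test_L2 tpsi.
set s := Num.sqrt (vol (n := n) (M + 1)).
have s0 : 0 <= s by exact: sqrtr_ge0.
have s1 : 0 < s + 1 by rewrite ltr_wpDl.
have [delta d0 hd] := uniform_continuous_cball (M + 1)
  (@smooth_continuous _ _ _ spsi) (divr_gt0 eta0 s1).
exists (Num.min delta 1); first by rewrite lt_min d0 ltr01.
move=> e rho; rewrite le_min => /andP[ed e1] mrho.
have rx2 x : L2 (@lebesgue_rV R n) (fun y => rho (y - x)).
  exact: (shift_L2 (- x) (test_L2 (moll_test mrho))).
have E y : conv psi rho y - psi y = \int[@lebesgue_rV R n]_x ((psi x - psi y) * rho (x - y)).
  transitivity (conv psi rho y - psi y * \int[@lebesgue_rV R n]_x rho (x - y)).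
    by rewrite (moll_shift_int mrho) mulr1.
  rewrite -(RintegralZl _ measurableT (moll_shift_integrable mrho y)).
  rewrite -(RintegralB measurableT (L2_mul p2 (rx2 y))); last first.
    exact: (EFin_integrableZ _ (moll_shift_integrable mrho y)).
  by apply: eq_Rintegral => x _; rewrite mulrBl.
have bd : bsupp (M + 1) (fun y => conv psi rho y - psi y).
  move=> y yM; rewrite E; under eq_Rintegral => x _.
    rewrite (_ : _ * _ = 0); first over.
    have [xy|xy] := leP `|x - y| e; last by rewrite (moll_bsupp mrho) ?mulr0.
    rewrite !psiM ?subrr ?mul0r//; first by rewrite (lt_trans _ yM)// ltrDl.
    have := ler_distD x y 0; rewrite !subr0 distrC => h.
    by rewrite -(ltrD2r 1); apply: (lt_le_trans yM); apply: (le_trans h); rewrite addrC lerD2l (le_trans xy).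
  by rewrite /Rintegral integral0.
have md : measurable_fun setT (fun y => conv psi rho y - psi y).
  apply: measurable_funB; last exact: L2_measurable p2.
  by apply: continuous_measurable_rV; apply: continuous_conv => //; exact: moll_test mrho.
apply: le_trans (nrm_bsupp M1 md bd (C := eta / (s + 1)) _) _; last first.
  exact: (div_mul_le (ltW eta0) s0).
move=> y; have [yM|yM] := leP `|y| (M + 1); last first.
  by rewrite bd// normr0 divr_ge0// ltW.
rewrite E.
have i1 : (@lebesgue_rV R n).-integrable setT (EFin \o (fun x => (psi x - psi y) * rho (x - y))).
  rewrite (_ : (fun x => _) = (fun x => psi x * rho (x - y) - psi y * rho (x - y))).
    apply: EFin_integrableB; first exact: (L2_mul p2 (rx2 y)).
    exact: (EFin_integrableZ _ (moll_shift_integrable mrho y)).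
  by apply/funext => x; rewrite mulrBl.
apply: (le_trans (le_normr_Rintegral measurableT i1)).
have -> : eta / (s + 1) = \int[@lebesgue_rV R n]_x (eta / (s + 1) * rho (x - y)).
  by rewrite (RintegralZl _ measurableT (moll_shift_integrable mrho y)) (moll_shift_int mrho) mulr1.
apply: le_Rintegral => //.
- exact: (integrable_norm i1).
- exact: (EFin_integrableZ _ (moll_shift_integrable mrho y)).
move=> x _; rewrite normrM (ger0_norm (moll_ge0 mrho _)).
have [xy|xy] := leP `|x - y| e; last by rewrite (moll_bsupp mrho) ?mulr0.
rewrite ler_wpM2r ?(moll_ge0 mrho)// distrC; apply: hd => //.
by rewrite distrC (le_trans xy).
Qed.

(** * Functions orthogonal to the range of [B_theta - lam] on test functions *)

Section uniqueness.
Context {R : realType} {n : nat}.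
Local Notation leb := (@lebesgue_rV R n).
Local Notation ip := (inner leb).
Local Notation nrm := (L2norm leb).
#[local] Opaque partial inner L2norm conv.
Variables (theta : R) (V : 'rV[R]_n -> R) (C m lam : R).
Hypothesis cV : continuous V.
Hypothesis V0 : forall x, 0 <= V x.
Hypothesis VC : forall x, V x <= C.
Hypothesis Vunif : forall eta : R, 0 < eta -> exists2 delta : R, 0 < delta &
  forall x y : 'rV[R]_n, `|x - y| <= delta -> `|V x - V y| <= eta.
Hypothesis form : forall g, test_function g -> m * ip g g <=
  theta ^+ 2 * (\sum_(i < n) ip (partial i g) (partial i g)) + ip (fun x => V x * g x) g.
Hypothesis lam_m : lam < m.

Let C0 : 0 <= C. Proof. exact: le_trans (V0 0) (VC 0). Qed.

Lemma V_mul_L2 g : L2 leb g -> L2 leb (fun x => V x * g x).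
Proof.
move=> g2; apply: (@L2_bounded_mul _ _ _ _ _ C) => //.
  exact: continuous_measurable_rV.
by move=> x; rewrite ger0_norm ?V0 ?VC.
Qed.

(* [B_theta - lam] with classical derivatives. *)
Definition test_op (phi : 'rV[R]_n -> R) x : R :=
  - theta ^+ 2 * (\sum_(i < n) partial i (partial i phi) x) + (V x * phi x - lam * phi x).

Lemma test_lap_L2 phi : test_function phi ->
  L2 leb (fun x => \sum_(i < n) partial i (partial i phi) x).
Proof. by move=> tp; apply: L2_sum => i; apply: test_L2; do 2 apply: test_partial. Qed.

Lemma ip_test_op phi g : test_function phi -> L2 leb g ->
  ip g (test_op phi) = - theta ^+ 2 * (\sum_(i < n) ip g (partial i (partial i phi))) +
    (ip g (fun x => V x * phi x) - lam * ip g phi).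
Proof.
move=> tp g2; have p2 := test_L2 tp; have Vp2 := V_mul_L2 p2.
have l2 := test_lap_L2 tp.
rewrite [LHS]ipC (ipDl (L2Z (- theta ^+ 2) l2) (L2B Vp2 (L2Z lam p2)) g2).
rewrite (ipZl (- theta ^+ 2) l2 g2) (ipBl Vp2 (L2Z lam p2) g2) (ipZl lam p2 g2).
rewrite (ipC _ _ g) (ipC _ phi g); congr (_ * _ + _); rewrite ipC.
apply: (etrans (ip_suml _ _ g2)).
  by move=> i; apply: test_L2; do 2 apply: test_partial.
by apply: eq_bigr => i _; exact: ipC.
by [].
Qed.

(* The cross terms are the derivative of [w * partial i w * chi ^+ 2], hence
   integrate to zero. *)
Lemma ip_partial_cutoff i (chi w : 'rV[R]_n -> R) : test_function chi -> smooth w ->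
  ip (partial i (fun x => w x * chi x)) (partial i (fun x => w x * chi x)) =
  ip (fun x => w x * partial i chi x) (fun x => w x * partial i chi x) -
  \int[leb]_x (w x * partial i (partial i w) x * chi x * chi x).
Proof.
move=> tc sw; have sc := test_smooth tc; have swi := smooth_partial i sw.
have swii := smooth_partial i swi; have tci := test_partial i tc.
have t1 : test_function (fun x => (w x * partial i w x) * chi x * chi x).
  by apply: testM => //; apply: smoothM => //; exact: smoothM.
have t2 : test_function (fun x => (w x * partial i (partial i w) x) * chi x * chi x).
  by apply: testM => //; apply: smoothM => //; exact: smoothM.
have t3 : test_function (fun x => w x * partial i chi x) by exact: testM.
have -> : ip (partial i (fun x => w x * chi x)) (partial i (fun x => w x * chi x)) =
    \int[leb]_x ((w x * partial i chi x) * (w x * partial i chi x) +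
      (partial i (fun x => (w x * partial i w x) * chi x * chi x) x -
       (w x * partial i (partial i w) x) * chi x * chi x)).
  apply: eq_Rintegral => x _.
  rewrite (partialM i sw sc) (partialM i (smoothM (smoothM sw swi) sc) sc).
  rewrite (partialM i (smoothM sw swi) sc) (partialM i sw swi) /=.
  ring.
have i1 := test_integrable (test_partial i t1); have i2 := test_integrable t2.
have i3 := L2_mul (test_L2 t3) (test_L2 t3).
rewrite (RintegralD measurableT i3 (EFin_integrableB i1 i2)).
by rewrite (RintegralB measurableT i1 i2) (int_partial i t1) sub0r.
Qed.

(** The form bound for [w * chi]. After [ip_partial_cutoff] no first derivative of [w] is left on
    the right: for a mollification there is uniform control only of [w] and, through the equation,
    of [test_op w]. *)
Lemma cutoff_form (chi w : 'rV[R]_n -> R) : test_function chi -> smooth w ->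
  (m - lam) * ip (fun x => w x * chi x) (fun x => w x * chi x) <=
  theta ^+ 2 * (\sum_(i < n) ip (fun x => w x * partial i chi x)
                                (fun x => w x * partial i chi x)) +
  \int[leb]_x (w x * test_op w x * chi x * chi x).
Proof.
move=> tc sw; have tg : test_function (fun x => w x * chi x) by exact: testM.
have g2 := test_L2 tg; have Vg2 := V_mul_L2 g2.
have tii i : test_function (fun x => w x * partial i (partial i w) x * chi x * chi x).
  apply: testM => //; apply: smoothM; last exact: test_smooth.
  by apply: smoothM => //; do 2 apply: smooth_partial.
rewrite mulrBl lerBlDr; apply: (le_trans (form tg)).
under eq_bigr do rewrite ip_partial_cutoff//.
rewrite sumrB mulrBr -!addrA lerD2l.
have -> : \int[leb]_x (w x * test_op w x * chi x * chi x) =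
    - theta ^+ 2 * (\sum_(i < n) \int[leb]_x (w x * partial i (partial i w) x * chi x * chi x)) +
    (ip (fun x => V x * (w x * chi x)) (fun x => w x * chi x) -
     lam * ip (fun x => w x * chi x) (fun x => w x * chi x)).
  have -> : \sum_(i < n) \int[leb]_x (w x * partial i (partial i w) x * chi x * chi x) =
      \int[leb]_x (\sum_(i < n) w x * partial i (partial i w) x * chi x * chi x).
    elim: (index_enum _) => [|i s ih].
      rewrite big_nil /Rintegral; under eq_integral do rewrite big_nil.
      by rewrite integral0.
    rewrite big_cons ih -RintegralD//.
    - by apply: eq_Rintegral => x _; rewrite big_cons.
    - exact: test_integrable.
    - by apply: test_integrable; exact: test_sum.
  have is1 := test_integrable (test_sum (index_enum 'I_n) tii).
  have i2 := L2_mul Vg2 g2; have i3 := L2_mul g2 g2.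
  rewrite -(RintegralZl (- theta ^+ 2) measurableT is1) -(RintegralZl lam measurableT i3).
  rewrite -(RintegralB measurableT i2 (EFin_integrableZ lam i3)).
  rewrite -(RintegralD measurableT (EFin_integrableZ (- theta ^+ 2) is1)
    (EFin_integrableB i2 (EFin_integrableZ lam i3))).
  apply: eq_Rintegral => x _; rewrite /test_op.
  have -> : \sum_(i < n) w x * partial i (partial i w) x * chi x * chi x =
      w x * (\sum_(i < n) partial i (partial i w) x) * chi x * chi x.
    by rewrite mulr_sumr !mulr_suml.
  ring.
by rewrite le_eqVlt; apply/orP; left; apply/eqP; ring.
Qed.

Variable v : 'rV[R]_n -> R.
Hypothesis v2 : L2 leb v.
Hypothesis vB : forall phi, test_function phi -> ip v (test_op phi) = 0.

(** The translate of [rho] is a test function, so orthogonality cancels everything but the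
    commutator: derivatives commute with the convolution, the potential does not. *)
Lemma test_op_conv e rho x : mollifier e rho ->
  test_op (conv v rho) x = ip v (fun y => (V x - V y) * rho (y - x)).
Proof.
move=> mrho; have trho := moll_test mrho; have tp := test_shift (- x) trho.
have p2 := test_L2 tp; have srho := test_smooth trho.
have := vB tp; rewrite (ip_test_op tp v2) => E.
have -> : test_op (conv v rho) x = test_op (conv v rho) x - 0 by rewrite subr0.
rewrite -{1}E /test_op.
have -> : \sum_(i < n) partial i (partial i (conv v rho)) x =
    \sum_(i < n) ip v (partial i (partial i (fun y => rho (y - x)))).
  apply: eq_bigr => i _; rewrite (partial2_conv v2 i x trho).
  by rewrite (partial_shift i (- x) srho) (partial_shift i (- x) (smooth_partial i srho)).
have -> : conv v rho x = ip v (fun y => rho (y - x)) by [].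
have -> : ip v (fun y => (V x - V y) * rho (y - x)) =
    ip v (fun y => V x * rho (y - x) - V y * rho (y - x)).
  by apply: (eq_ip _ (fun=> erefl)) => y; rewrite mulrBl.
rewrite (ipBr (L2Z (V x) p2) (V_mul_L2 p2) v2) (ipZr (V x) p2 v2); ring.
Qed.

(** Both error terms are dominated pointwise by [gam rho v], whose integral is the squared norm of
    [v]; the estimate thus depends on the mollifier only through the oscillation of [V]. *)
Lemma cutoff_bound e rho chi (c eta : R) : mollifier e rho -> test_function chi ->
  0 <= c -> 0 <= eta ->
  (forall x, `|chi x| <= 1) -> (forall i x, `|partial i chi x| <= c) ->
  (forall x y, `|x - y| <= e -> `|V x - V y| <= eta) ->
  (m - lam) * ip (fun x => conv v rho x * chi x) (fun x => conv v rho x * chi x) <=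
  (theta ^+ 2 * (n%:R * c ^+ 2) + eta) * ip v v.
Proof.
move=> mrho tc c0 eta0 chi1 dchi Ve.
have [ig ig'] := int_gam mrho v2; have w2 := conv_L2 mrho v2.
have sw := smooth_conv v2 (moll_test mrho).
have wg x : conv v rho x ^+ 2 <= gam rho v x by exact: (conv_gam mrho).
have rg x : test_op (conv v rho) x ^+ 2 <= eta ^+ 2 * gam rho v x.
  rewrite (test_op_conv x mrho); apply: (conv_weight (K := C) mrho) => //.
  - apply: measurable_funB => //; exact: continuous_measurable_rV.
  - move=> y; have := V0 x; have := V0 y; have := VC x; have := VC y => *.
    by rewrite ler_norml; apply/andP; split; lra.
  - by move=> y yx; apply: Ve; rewrite distrC.
apply: (le_trans (cutoff_form tc sw)); rewrite mulrDl; apply: lerD.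
  rewrite -mulrA ler_wpM2l ?sqr_ge0// -mulrA mulr_natl -[X in _ *+ X]card_ord -sumr_const.
  apply: ler_sum => i _; rewrite -ig' -(RintegralZl (c ^+ 2) measurableT ig).
  have tci := testM sw (test_partial i tc).
  apply: le_Rintegral => //.
  - exact: (L2_mul (test_L2 tci) (test_L2 tci)).
  - exact: (EFin_integrableZ _ ig).
  move=> x _; rewrite -expr2 exprMn mulrC ler_pM ?sqr_ge0//.
  by rewrite -[leLHS]ger0_norm ?sqr_ge0// normrX lerXn2r ?nnegrE.
rewrite -ig' -(RintegralZl eta measurableT ig).
have b2 x : conv v rho x * test_op (conv v rho) x * chi x * chi x <= eta * gam rho v x.
  have g0 := gam_ge0 mrho v x.
  apply: (le_trans (ler_norm _)); rewrite !normrM -mulrA.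
  apply: (@le_trans _ _ (`|conv v rho x| * `|test_op (conv v rho) x|)).
    rewrite ler_piMr ?mulr_ge0//.
    by rewrite -(mulr1 1) ler_pM.
  rewrite -normrM -(@ler_pXn2r _ 2)// ?nnegrE ?mulr_ge0//.
  rewrite -normrX ger0_norm ?sqr_ge0// !exprMn.
  rewrite (_ : eta ^+ 2 * gam rho v x ^+ 2 = gam rho v x * (eta ^+ 2 * gam rho v x)); last by ring.
  by rewrite ler_pM ?sqr_ge0.
(* The remaining integrability comes from continuity and bounded support, since [V] makes the
   integrand continuous but not smooth. *)
apply: le_Rintegral => //; last exact: (EFin_integrableZ _ ig).
have sl : smooth (fun x => \sum_(i < n) partial i (partial i (conv v rho)) x).
  by apply: smooth_sum => i; do 2 apply: smooth_partial.
have cw := @smooth_continuous _ _ _ sw.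
have cB : continuous (test_op (conv v rho)).
  move=> x; have c1 : {for x, continuous (fun x => - theta ^+ 2 * (\sum_(i < n) partial i (partial i (conv v rho)) x))}.
    exact: (smooth_continuous (smoothZ (- theta ^+ 2) sl)).
  have c2 : {for x, continuous (fun x => V x * conv v rho x)} by apply: continuousM; [exact: cV|exact: cw].
  have c3 : {for x, continuous (fun x => lam * conv v rho x)} by exact: (smooth_continuous (smoothZ lam sw)).
  exact: (@continuousD _ R^o _ _ _ x c1 (@continuousB _ R^o _ _ _ x c2 c3)).
have cchi := @smooth_continuous _ _ _ (test_smooth tc).
have cp : continuous (fun x => conv v rho x * test_op (conv v rho) x * chi x * chi x).
  move=> x; exact: (continuousM (continuousM (continuousM (cw x) (cB x)) (cchi x)) (cchi x)).
have /test_functionP[_ [M M0 chiM]] := tc.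
have pM : bsupp M (fun x => conv v rho x * test_op (conv v rho) x * chi x * chi x).
  by move=> x Mx; rewrite (chiM x Mx) mulr0.
have [K K0 pK] := continuous_bounded_cball M cp.
have pK' x : `|conv v rho x * test_op (conv v rho) x * chi x * chi x| <= K.
  by have [/pK//|/pM ->] := leP `|x| M; rewrite normr0.
apply: (integrable_bsupp M0 _ pM).
by have [] := L2_bsupp M0 (continuous_measurable_rV cp) pM pK'.
Qed.

(** The pairing with a test function [psi] changes by an error of order [e] when [v] is mollified,
    and again when it is cut off; the norm of the mollified and cut-off function is itself of order
    [e] by [cutoff_bound]. *)
Lemma weak_uniqueness : v = cst 0 %[ae leb].
Proof.
apply: fundamental_lemma v2 _ => psi tpsi; have p2 := test_L2 tpsi.
(* The cut-off is a rescaled bump and tends to the value [b0] at the origin rather than to [1];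
   hence the factor [b0] throughout. *)
set b0 : R := bump (0 : 'rV[R]_n).
have b00 : 0 < b0 by apply: bump_gt0; rewrite normr0.
have [c0 c00 dbump] : exists2 c0 : R, 0 <= c0 & forall i (x : 'rV[R]_n), `|partial i bump x| <= c0.
  have /choice[c hc] : forall i, exists c : R, 0 <= c /\ forall x : 'rV[R]_n, `|partial i bump x| <= c.
    by move=> i; have [c ? ?] := test_bounded (test_partial i (@test_bump R n)); exists c.
  exists (\sum_i c i); first by apply: sumr_ge0 => i _; have [] := hc i.
  move=> i x; have [_ /(_ x) h] := hc i; apply: (le_trans h).
  by rewrite (bigD1 i)//= lerDl sumr_ge0// => j _; have [] := hc j.
have /test_functionP[_ [M M0 psiM]] := tpsi.
(* [cutoff_bound] will bound [(m - lam)] times the squared norm of [conv v rho * chi] by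
   [2 * e ^+ 2 * ip v v]. *)
pose K1 := Num.sqrt (2 * ip v v / (m - lam)).
have K10 : 0 <= K1 by exact: sqrtr_ge0.
pose K := b0 * nrm v + nrm v * nrm psi + K1 * nrm psi.
have K0 : 0 <= K by rewrite !addr_ge0 ?mulr_ge0 ?nrm_ge0// ltW.
have ml : 0 < m - lam by rewrite subr_gt0.
have vv0 : 0 <= ip v v by exact: ip_ge0.
suff : `|b0 * ip v psi| <= 0.
  by rewrite normr_le0 mulf_eq0 gt_eqF//= => /eqP.
apply: eps_le0 K0 _ => e e0.
pose D := theta ^+ 2 * (n%:R * c0 ^+ 2) + 1.
have D1 : 1 <= D by rewrite lerDr (mulr_ge0 (sqr_ge0 _))// mulr_ge0 ?sqr_ge0 ?ler0n.
have D0 : 0 < D by exact: lt_le_trans D1.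
have [d d0 hd] := uniform_continuous_cball 0 (smooth_continuous (@smooth_bump R n)) e0.
(* [d / (M + 1)] keeps [chi] within [e] of [b0] on the support of [psi]; [e / D] keeps the kinetic
   error of the cut-off below [e ^+ 2]. *)
pose s := Num.min (d / (M + 1)) (e / D).
have s0 : 0 < s by rewrite lt_min !divr_gt0// ltr_wpDl.
have sM : s * M <= d.
  apply: le_trans (div_mul_le (ltW d0) M0); rewrite ler_wpM2r//.
  by rewrite ge_min lexx.
have sD : theta ^+ 2 * (n%:R * (s * c0) ^+ 2) <= e ^+ 2.
  have h1 : D * s ^+ 2 <= e ^+ 2.
    apply: (@le_trans _ _ (D * (e / D) ^+ 2)).
      have sE : s <= e / D by rewrite ge_min lexx orbT.
      by rewrite ler_pM2l// lerXn2r ?nnegrE ?(ltW s0)// divr_ge0 ?(ltW e0) ?(ltW D0).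
    rewrite expr_div_n expr2 [D ^+ 2]expr2 invfM mulrCA mulVKf ?gt_eqF//.
    by rewrite ler_pdivrMr// ler_peMr// -expr2 sqr_ge0.
  apply: le_trans h1; rewrite /D mulrDl mul1r.
  rewrite (_ : theta ^+ 2 * (n%:R * c0 ^+ 2) * s ^+ 2 = theta ^+ 2 * (n%:R * (s * c0) ^+ 2)); last by ring.
  by rewrite lerDl sqr_ge0.
pose chi (x : 'rV[R]_n) : R := bump (s *: x + 0).
have tchi : test_function chi by apply: test_affine; [rewrite gt_eqF|exact: test_bump].
have chi1 x : `|chi x| <= 1 by rewrite ger0_norm ?bump_ge0 ?bump_le1.
have dchi i x : `|partial i chi x| <= s * c0.
  rewrite /chi (partial_affine i s 0 (@smooth_bump R n)) normrM gtr0_norm//.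
  by rewrite ler_pM2l.
have chib x : `|x| <= M -> `|b0 - chi x| <= e.
  move=> xM; apply: hd; rewrite ?normr0// sub0r normrN addr0 normrZ gtr0_norm//.
  by apply: le_trans sM; rewrite ler_pM2l.
have e20 : 0 < e ^+ 2 by rewrite exprn_gt0.
have [dV dV0 hV] := Vunif e20; have [e1 e10 he1] := conv_approx tpsi e0.
pose h := Num.min dV e1; have h0 : 0 < h by rewrite lt_min dV0.
have [rho mrho] := exists_mollifier (n := n) h0.
have w2 := conv_L2 mrho v2; have pr2 := conv_L2 mrho p2.
have cb := cutoff_bound mrho tchi (mulr_ge0 (ltW s0) c00) (ltW e20) chi1 dchi _.
have tw : test_function (fun x => conv v rho x * chi x).
  by apply: testM => //; exact: (smooth_conv v2 (moll_test mrho)).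
have wc2 := test_L2 tw.
have nwc : nrm (fun x => conv v rho x * chi x) <= e * K1.
  rewrite -(@ler_pXn2r _ 2)// ?nnegrE ?nrm_ge0 ?mulr_ge0 ?(ltW e0)//.
  rewrite sqr_nrm exprMn sqr_sqrtr ?divr_ge0 ?mulr_ge0 ?(ltW ml)//.
  rewrite mulrA ler_pdivlMr// mulrC; apply: le_trans (cb _) _.
    by move=> x y xy; apply: hV; apply: (le_trans xy); rewrite ge_min lexx.
  by rewrite [leRHS]mulrA ler_wpM2r//; lra.
have na : nrm (fun x => conv psi rho x - psi x) <= e.
  by apply: (he1 h) => //; rewrite ge_min lexx orbT.
have cp2 : L2 leb (fun x => (b0 - chi x) * psi x).
  apply: test_L2; apply: testM => //; apply: smoothB; [exact: smooth_cst|exact: test_smooth].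
have ncp : nrm (fun x => (b0 - chi x) * psi x) <= e * nrm psi.
  rewrite -(gtr0_norm e0) -(nrmZ e p2) ler_sqrt ?ip_ge0//.
  apply: (ip_le cp2 (L2Z e p2)) => x; rewrite !normrM (gtr0_norm e0).
  have [xM|/psiM ->] := leP `|x| M; last by rewrite normr0 !mulr0.
  by rewrite ler_wpM2r// chib.
have E1 : ip v (fun x => conv psi rho x - psi x) = ip (conv v rho) psi - ip v psi.
  by rewrite (ipBr pr2 p2 v2) (ip_conv mrho v2 tpsi).
have E2 : ip (conv v rho) (fun x => (b0 - chi x) * psi x) =
    b0 * ip (conv v rho) psi - ip (fun x => conv v rho x * chi x) psi.
  rewrite -(ipZl b0 w2 p2) -(ipBl (L2Z b0 w2) wc2 p2).
  by apply: eq_Rintegral => x _; ring.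
have -> : b0 * ip v psi = - (b0 * ip v (fun x => conv psi rho x - psi x)) +
    ip (conv v rho) (fun x => (b0 - chi x) * psi x) + ip (fun x => conv v rho x * chi x) psi.
  by rewrite E1 E2; ring.
have b1 := ip_le_nrm (L2B pr2 p2) v2 na; rewrite ipC in b1.
have b2 := ip_le_nrm cp2 w2 ncp; rewrite ipC in b2.
have b3 := ip_le_nrm wc2 p2 nwc.
have b4 : e * nrm psi * nrm (conv v rho) <= e * nrm psi * nrm v.
  by apply: (ler_wpM2l (mulr_ge0 (ltW e0) (nrm_ge0 _ _))); exact: (nrm_conv mrho v2).
apply: le_trans (ler_normD _ _) _; apply: le_trans (lerD (ler_normD _ _) (lexx _)) _.
rewrite normrN normrM (gtr0_norm b00).
have b1' : b0 * `|ip v (fun x => conv psi rho x - psi x)| <= b0 * (e * nrm v) by rewrite ler_pM2l.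
apply: le_trans (lerD (lerD b1' (le_trans b2 b4)) b3) _.
by rewrite le_eqVlt; apply/orP; left; apply/eqP; rewrite /K; ring.
Qed.

End uniqueness.

(** * The resolvent of the Schroedinger operator *)

Section L2_convergence.
Context d (T : measurableType d) (R : realType) (mu : {measure set T -> \bar R}).
Local Notation ip := (inner mu).
Local Notation nrm := (L2norm mu).
#[local] Opaque inner L2norm.
Implicit Types (f g h : T -> R) (u : nat -> T -> R).

Definition L2_cvg u f := forall e : R, 0 < e -> exists N, forall k, (N <= k)%N ->
  nrm (fun x => u k x - f x) <= e.

Lemma L2_cvg_complete u : (forall k, L2 mu (u k)) ->
  (forall e : R, 0 < e -> exists N, forall k l, (N <= k)%N -> (N <= l)%N ->
    nrm (fun x => u k x - u l x) <= e) ->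
  exists2 f, L2 mu f & L2_cvg u f.
Proof.
move=> u2 cu; have [|f f2 uf] := L2_complete u2.
  move=> e e0; have /cu[N hN] : 0 < Num.sqrt e by rewrite sqrtr_gt0.
  exists N => k l Nk Nl; rewrite -sqr_nrm -[leRHS]sqr_sqrtr ?(ltW e0)//.
  by rewrite lerXn2r ?nnegrE ?nrm_ge0 ?sqrtr_ge0 ?hN.
exists f => // e e0; have /uf[N hN] : 0 < e ^+ 2 by rewrite exprn_gt0.
exists N => k Nk; rewrite -(@ler_pXn2r _ 2)// ?nnegrE ?nrm_ge0 ?(ltW e0)//.
by rewrite sqr_nrm hN.
Qed.

Lemma L2_cvg_ip u f g (e : R) : (forall k, L2 mu (u k)) -> L2 mu f -> L2 mu g ->
  L2_cvg u f -> 0 < e ->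
  exists N, forall k, (N <= k)%N -> `|ip (u k) g - ip f g| <= e * nrm g.
Proof.
move=> u2 f2 g2 uf e0; have [N hN] := uf e e0; exists N => k Nk.
rewrite -(ipBl (u2 k) f2 g2); exact: (ip_le_nrm (L2B (u2 k) f2) g2 (hN k Nk)).
Qed.

(** Carries identities to the limit: integration by parts with [c = -1], the symmetry of the
    operator with [c = 1]. *)
Lemma L2_cvg_ip_eq u f g u' f' g' (c : R) :
  (forall k, L2 mu (u k)) -> L2 mu f -> L2 mu g -> L2_cvg u f ->
  (forall k, L2 mu (u' k)) -> L2 mu f' -> L2 mu g' -> L2_cvg u' f' ->
  (forall k, ip (u k) g = c * ip (u' k) g') -> ip f g = c * ip f' g'.
Proof.
move=> u2 f2 g2 uf u2' f2' g2' uf' E; apply/eqP; rewrite -subr_eq0 -normr_le0; apply/eqP/eqP.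
have K0 : 0 <= nrm g + `|c| * nrm g' by rewrite addr_ge0 ?mulr_ge0 ?nrm_ge0.
apply: (eps_le0 K0) => e e0.
have [N hN] := L2_cvg_ip u2 f2 g2 uf e0; have [N' hN'] := L2_cvg_ip u2' f2' g2' uf' e0.
have h1 := hN _ (leq_maxl N N'); have h2 := hN' _ (leq_maxr N N').
have -> : ip f g - c * ip f' g' =
    - (ip (u (maxn N N')) g - ip f g) + c * (ip (u' (maxn N N')) g' - ip f' g').
  by rewrite E; ring.
apply: le_trans (ler_normD _ _) _; rewrite normrN normrM mulrDr; apply: lerD => //.
by rewrite mulrCA ler_wpM2l.
Qed.

Lemma nrm_diff f g : L2 mu f -> L2 mu g -> nrm f <= nrm (fun x => f x - g x) + nrm g.
Proof.
move=> f2 g2; apply: le_trans (nrmD (L2B f2 g2) g2).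
by rewrite le_eqVlt (nrm_eq (g := fun x => f x - g x + g x)) ?eqxx//; apply: eq_ip => x; rewrite subrK.
Qed.

Lemma nrm_distC f g : nrm (fun x => f x - g x) = nrm (fun x => g x - f x).
Proof. by apply: nrm_eq; apply: eq_Rintegral => x _; rewrite -[LHS]mulrNN !opprB. Qed.

Lemma L2_cvg_nrm_le u f u' f' (c : R) : 0 <= c ->
  (forall k, L2 mu (u k)) -> L2 mu f -> L2_cvg u f ->
  (forall k, L2 mu (u' k)) -> L2 mu f' -> L2_cvg u' f' ->
  (forall k, nrm (u k) <= c * nrm (u' k)) -> nrm f <= c * nrm f'.
Proof.
move=> c0 u2 f2 uf u2' f2' uf' E; rewrite -subr_le0.
have K0 : 0 <= 1 + c by rewrite addr_ge0.
apply: (eps_le0 K0) => e e0.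
have [N hN] := uf e e0; have [N' hN'] := uf' e e0.
have h1 := hN _ (leq_maxl N N'); have h2 := hN' _ (leq_maxr N N').
set k := maxn N N' in h1 h2.
have h3 := nrm_diff f2 (u2 k); rewrite nrm_distC in h3.
have h4 := nrm_diff (u2' k) f2'; have h5 := E k.
have h6 : c * nrm (u' k) <= c * (e + nrm f').
  by rewrite ler_wpM2l//; apply: le_trans h4 _; rewrite lerD2r.
rewrite mulrDr in h6; rewrite mulrDr mulr1; lra.
Qed.

(** The projection onto the closure of a subspace: a sequence that minimises the distance to [h] is
    Cauchy by the parallelogram law, and its limit is [f]. *)
Lemma L2_projection (P : set (T -> R)) h : P !=set0 -> (forall f, P f -> L2 mu f) ->
  (forall f g c, P f -> P g -> P (fun x => f x + c * g x)) -> L2 mu h ->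
  exists2 F : nat -> T -> R, (forall k, P (F k)) &
  exists2 f, L2 mu f & L2_cvg F f /\ forall g, P g -> ip (fun x => h x - f x) g = 0.
Proof.
move=> [f0 Pf0] P2 PD h2.
pose I f := ip (fun x => h x - f x) (fun x => h x - f x).
have h2B f : P f -> L2 mu (fun x => h x - f x) by move=> /P2; exact: L2B.
pose A := [set I f | f in P]; pose a := inf A.
have iA : has_inf A.
  split; first by exists (I f0); exists f0.
  by exists 0 => _ [f Pf <-]; exact: ip_ge0.
have aI f : P f -> a <= I f by move=> Pf; apply: ge_inf; [exact: iA.2|exists f].
have /choice[F hF] : forall k : nat, exists f, P f /\ I f <= a + k.+1%:R^-1.
  move=> k; have k0 : (0 : R) < k.+1%:R^-1 by rewrite invr_gt0 ltr0n.
  by have [_ [f Pf <-] If] := inf_adherent k0 iA; exists f; split => //; exact: ltW.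
have PF k : P (F k) by have [] := hF k.
have IE f g t : P f -> P g -> I (fun x => f x + t * g x) =
    I f - 2 * t * ip (fun x => h x - f x) g + t ^+ 2 * ip g g.
  move=> Pf Pg; rewrite [RHS](_ : _ =
    I f + (- t) * ip (fun x => h x - f x) g *+ 2 + (- t) ^+ 2 * ip g g); last by ring.
  rewrite -(ip_sqrD (- t) (h2B f Pf) (P2 g Pg)).
  by apply: eq_ip => x; ring.
have small (e : R) : 0 < e -> exists N, forall k, (N <= k)%N -> (k.+1%:R^-1 : R) <= e.
  move=> e0; exists (Num.truncn e^-1) => k Nk.
  rewrite invf_ple ?posrE//; apply: ltW; apply: lt_le_trans (truncnS_gt _) _.
  by rewrite ler_nat ltnS.
have [|f f2 Ff] := @L2_cvg_complete F (fun k => P2 _ (PF k)).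
  (* The squared distance is at most twice the sum of the two excesses over the infimum, hence the
     quarter. *)
  move=> e e0; have e20 : 0 < e ^+ 2 / 4 by rewrite divr_gt0 ?exprn_gt0.
  have [N hN] := small _ e20; exists N => k l Nk Nl.
  rewrite -(@ler_pXn2r _ 2)// ?nnegrE ?nrm_ge0 ?(ltW e0)// sqr_nrm.
  pose g x := F k x + (-1) * F l x; have Pg : P g by exact: PD.
  have -> : ip (fun x => F k x - F l x) (fun x => F k x - F l x) = ip g g.
    by apply: eq_ip => x; rewrite /g mulN1r.
  (* The infimum is compared with the midpoint of [F k] and [F l]. *)
  have := aI _ (PD _ _ (- (2^-1)) (PF k) Pg); rewrite (IE _ _ _ (PF k) Pg).
  have : I (fun x => F k x + (-1) * g x) <= a + l.+1%:R^-1.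
    have -> : (fun x => F k x + (-1) * g x) = F l by apply/funext => x; rewrite /g; ring.
    by have [] := hF l.
  rewrite (IE _ _ _ (PF k) Pg).
  have [_] := hF k; have := hN _ Nk; have := hN _ Nl.
  have -> : (- (2^-1)) ^+ 2 = 4^-1 :> R by field.
  rewrite sqrrN expr1n; move: (k.+1%:R^-1) (l.+1%:R^-1) (I (F k)) (ip _ g) (ip g g) (e ^+ 2).
  by move=> dk dl Ik b q e2; lra.
exists F => //; exists f => //; split => // g Pg; have g2 := P2 g Pg.
apply/eqP; rewrite -normr_le0; apply/eqP/eqP.
have K0 : 0 <= 2 * nrm g by rewrite mulr_ge0 ?nrm_ge0.
apply: (eps_le0 K0) => e e0; have e20 : 0 < e ^+ 2 by rewrite exprn_gt0.
have [N hN] := small _ e20.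
have [N' hN'] := L2_cvg_ip (fun k => P2 _ (PF k)) f2 g2 Ff e0.
have h1 := hN _ (leq_maxl N N'); have h2' := hN' _ (leq_maxr N N').
set k := maxn N N' in h1 h2'; have [_ Ik] := hF k.
have hk2 := h2B _ (PF k).
(* Near-minimality of [F k] along the direction [g] makes a quadratic polynomial nonnegative; its
   discriminant gives the bound. *)
have b1 : `|ip (fun x => h x - F k x) g| <= e * nrm g.
  rewrite -(@ler_pXn2r _ 2)// ?nnegrE ?mulr_ge0 ?nrm_ge0 ?(ltW e0)//.
  rewrite -normrX ger0_norm ?sqr_ge0// exprMn sqr_nrm.
  apply: (@le_trans _ _ ((I (F k) - a) * ip g g)); last first.
    by rewrite ler_wpM2r ?ip_ge0// lerBlDl (le_trans Ik)// lerD2l.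
  rewrite -sqrrN; apply: disc_le0; first exact: ip_ge0.
  move=> t; have := aI _ (PD _ _ t (PF k) Pg); rewrite (IE _ _ _ (PF k) Pg).
  rewrite mulrN mulNrn mulr2n; lra.
have -> : ip (fun x => h x - f x) g = ip (fun x => h x - F k x) g + (ip (F k) g - ip f g).
  by rewrite (ipBl h2 f2 g2) (ipBl h2 (P2 _ (PF k)) g2); ring.
rewrite (_ : e * (2 * nrm g) = e * nrm g + e * nrm g); last by ring.
by apply: le_trans (ler_normD _ _) _; rewrite lerD.
Qed.

End L2_convergence.

Section resolvent.
Context {R : realType} {n : nat}.
Local Notation leb := (@lebesgue_rV R n).
Local Notation ip := (inner leb).
Local Notation nrm := (L2norm leb).
#[local] Opaque partial inner L2norm.
Variables (theta : R) (V : 'rV[R]_n -> R) (C m lam : R).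
Hypothesis theta_gt0 : 0 < theta.
Hypothesis cV : continuous V.
Hypothesis V0 : forall x, 0 <= V x.
Hypothesis VC : forall x, V x <= C.
Hypothesis Vunif : forall eta : R, 0 < eta -> exists2 delta : R, 0 < delta &
  forall x y : 'rV[R]_n, `|x - y| <= delta -> `|V x - V y| <= eta.
Hypothesis form : forall g, test_function g -> m * ip g g <=
  theta ^+ 2 * (\sum_(i < n) ip (partial i g) (partial i g)) + ip (fun x => V x * g x) g.
Hypothesis lam_m : lam < m.

Local Notation Bt := (test_op theta V lam).

Let C0 : 0 <= C. Proof. exact: le_trans (V0 0) (VC 0). Qed.
Let ml : 0 < m - lam. Proof. by rewrite subr_gt0. Qed.

Let VL2 g : L2 leb g -> L2 leb (fun x => V x * g x).
Proof. exact: (V_mul_L2 cV V0 VC). Qed.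

Lemma test_op_L2 phi : test_function phi -> L2 leb (Bt phi).
Proof.
move=> tp; have p2 := test_L2 tp.
exact: (L2D (L2Z (- theta ^+ 2) (test_lap_L2 tp)) (L2B (VL2 p2) (L2Z lam p2))).
Qed.

Lemma test_op_lin phi psi c : test_function phi -> test_function psi ->
  Bt (fun x => phi x + c * psi x) = (fun x => Bt phi x + c * Bt psi x).
Proof.
move=> /test_smooth sp /test_smooth sq; apply/funext => x; rewrite /test_op.
have E i : partial i (partial i (fun x => phi x + c * psi x)) x =
    partial i (partial i phi) x + c * partial i (partial i psi) x.
  rewrite (partialD i sp (smoothZ c sq)) (partialZ i c sq).
  have spi := smooth_partial i sp; have sqi := smooth_partial i sq.
  by rewrite (partialD i spi (smoothZ c sqi)) (partialZ i c sqi).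
have alg (a b t w p q : R) : t * (a + c * b) + (w * (p + c * q) - lam * (p + c * q)) =
    t * a + (w * p - lam * p) + c * (t * b + (w * q - lam * q)) by ring.
apply: (etrans _ (alg _ _ _ _ _ _)); congr (_ * _ + _).
by rewrite mulr_sumr -big_split; apply: eq_bigr => i _; exact: E.
Qed.

Lemma test_op_sym phi psi : test_function phi -> test_function psi ->
  ip phi (Bt psi) = ip (Bt phi) psi.
Proof.
move=> tp tq; have p2 := test_L2 tp; have q2 := test_L2 tq.
rewrite (ip_test_op theta lam cV V0 VC tq p2) [RHS]ipC (ip_test_op theta lam cV V0 VC tp q2).
have cg (a a' b b' c c' t : R) : a = a' -> b = b' -> c = c' ->
    t * a + (b - lam * c) = t * a' + (b' - lam * c') by move=> -> -> ->.
apply: cg; last exact: ipC.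
  apply: eq_bigr => i _; have tpi := test_partial i tp; have tqi := test_partial i tq.
  have e1 := ibp i (test_smooth tp) tqi; have e2 := ibp i (test_smooth tq) tpi.
  by apply: oppr_inj; exact: (etrans (esym e1) (etrans (ipC _ _ _) e2)).
by apply: eq_Rintegral => x _; ring.
Qed.

Lemma sum_partial2 phi : test_function phi ->
  \sum_(i < n) ip (partial i phi) (partial i phi) = - (\sum_(i < n) ip phi (partial i (partial i phi))).
Proof.
move=> tp; rewrite -sumrN; apply: eq_bigr => i _.
exact: (ibp i (test_smooth tp) (test_partial i tp)).
Qed.

(** Cauchy-Schwarz for [ip phi (Bt phi)], which the form bound estimates from below. *)
Lemma test_op_coercive phi : test_function phi -> (m - lam) * nrm phi <= nrm (Bt phi).
Proof.
move=> tp; have p2 := test_L2 tp; have B2 := test_op_L2 tp.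
have h1 : (m - lam) * nrm phi ^+ 2 <= nrm phi * nrm (Bt phi).
  apply: le_trans (le_trans (ler_norm _) (ip_nrm p2 B2)).
  rewrite sqr_nrm (ip_test_op theta lam cV V0 VC tp p2) mulrBl.
  rewrite addrA lerD2r; apply: (le_trans (form tp)).
  have e := congr1 (fun s => theta ^+ 2 * s) (sum_partial2 tp).
  apply: lerD; rewrite le_eqVlt; apply/orP; left; apply/eqP; last exact: ipC.
  exact: (etrans e (etrans (mulrN _ _) (esym (mulNr _ _)))).
have [p0|p0] := eqVneq (nrm phi) 0; first by rewrite p0 mulr0 nrm_ge0.
have p00 : 0 < nrm phi by rewrite lt_neqAle eq_sym p0 nrm_ge0.
by rewrite -(ler_pM2l p00) mulrCA -expr2.
Qed.

Local Notation lap phi := (fun x => \sum_(i < n) partial i (partial i phi) x).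

(* The equation bounds the Laplacian, which has the same norm as the Hessian,
   and [|grad phi|^2 = - <laplacian phi, phi>]. *)
Lemma test_op_elliptic : exists2 K : R, 0 <= K & forall phi, test_function phi ->
  forall s, (size s <= 2)%N -> nrm (partials s phi) <= K * nrm (Bt phi).
Proof.
(* [k0] is the constant of coercivity; [k2] comes from solving the equation for the Laplacian, with
   [|V - lam| <= C + |lam|]. *)
pose k0 := (m - lam)^-1; have k00 : 0 <= k0 by rewrite invr_ge0 ltW.
pose k2 := (theta ^+ 2)^-1 * (1 + (C + `|lam|) * k0).
have t20 : 0 < theta ^+ 2 by rewrite exprn_gt0.
have k20 : 0 <= k2 by rewrite mulr_ge0 ?invr_ge0 ?(ltW t20)// addr_ge0// mulr_ge0// addr_ge0.
exists (k0 + k2); first by rewrite addr_ge0.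
move=> phi tp; have p2 := test_L2 tp; have B2 := test_op_L2 tp.
have l2 := test_lap_L2 tp; set b := nrm (Bt phi); have b0 : 0 <= b by exact: nrm_ge0.
have h0 : nrm phi <= k0 * b by rewrite ler_pdivlMl// test_op_coercive.
have h2 : nrm (lap phi) <= k2 * b.
  rewrite /k2 -mulrA ler_pdivlMl//.
  have W2 : L2 leb (fun x => V x * phi x - lam * phi x) by exact: (L2B (VL2 p2) (L2Z lam p2)).
  have -> : theta ^+ 2 * nrm (lap phi) = nrm (fun x => -1 * Bt phi x + (V x * phi x - lam * phi x)).
    rewrite -{1}(gtr0_norm t20) -(nrmZ (theta ^+ 2) l2); apply: nrm_eq.
    by apply: eq_Rintegral => x _; rewrite /test_op; ring.
  apply: le_trans (nrmD (L2Z (-1) B2) W2) _.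
  rewrite (nrmZ (-1) B2) normrN normr1 mul1r mulrDl mul1r lerD2l.
  have wb x : `|V x * phi x - lam * phi x| <= `|(C + `|lam|) * phi x|.
    rewrite -mulrBl !normrM ler_wpM2r// (le_trans (ler_normB _ _))//.
    by rewrite [leRHS]ger0_norm ?addr_ge0// lerD2r ger0_norm.
  have W3 := L2Z (C + `|lam|) p2.
  apply: (@le_trans _ _ (nrm (fun x => (C + `|lam|) * phi x))).
    by rewrite ler_sqrt ?ip_ge0//; exact: (ip_le W2 W3).
  rewrite (nrmZ _ p2) ger0_norm ?addr_ge0// -mulrA ler_wpM2l// addr_ge0//.
have sq (a : R) : 0 <= a -> forall x : R, 0 <= x -> x ^+ 2 <= a ^+ 2 -> x <= a.
  by move=> a0 x x0; rewrite ler_pXn2r ?nnegrE.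
have le_term (F : 'I_n -> R) i : (forall j, 0 <= F j) -> F i <= \sum_j F j.
  by move=> F0; rewrite (bigD1 i)//= lerDl sumr_ge0.
have l2i i : L2 leb (partial i (partial i phi)) by apply: test_L2; do 2 apply: test_partial.
move=> [|i [|j [|//]]] _ /=.
- by apply: le_trans h0 _; rewrite ler_wpM2r// lerDl.
- apply: sq; rewrite ?nrm_ge0 ?mulr_ge0 ?addr_ge0//; rewrite sqr_nrm.
  apply: (@le_trans _ _ (nrm (lap phi) * nrm phi)).
    apply: le_trans (ip_nrm l2 p2).
    apply: (le_trans (le_term (fun j => ip (partial j phi) (partial j phi)) i (fun=> ip_ge0 _ _))).
    rewrite (sum_partial2 tp); apply: le_trans (ler_norm _) _; rewrite normrN le_eqVlt; apply/orP; left; apply/eqP.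
    congr (`|_|); apply: etrans (esym (ip_suml _ l2i p2)).
    by apply: eq_bigr => j _; exact: ipC.
  (* The gradient is controlled by the geometric mean of [k0] and [k2], which is below their sum. *)
  apply: (@le_trans _ _ ((k2 * b) * (k0 * b))); first by rewrite ler_pM ?nrm_ge0.
  rewrite exprMn sqrrD.
  have pos : 0 <= (k0 ^+ 2 + k0 * k2 + k2 ^+ 2) * b ^+ 2.
    exact: (mulr_ge0 (addr_ge0 (addr_ge0 (sqr_ge0 _) (mulr_ge0 k00 k20)) (sqr_ge0 _)) (sqr_ge0 _)).
  rewrite -subr_ge0 [X in 0 <= X](_ : _ = (k0 ^+ 2 + k0 * k2 + k2 ^+ 2) * b ^+ 2)//.
  by move: (k0) (k2) (b) => x y z; ring.
- apply: (@le_trans _ _ (nrm (lap phi))); last first.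
    by apply: le_trans h2 _; rewrite ler_wpM2r// lerDr.
  rewrite ler_sqrt ?ip_ge0//.
  apply: (@le_trans _ _ (\sum_k \sum_l ip (partial l (partial k phi)) (partial l (partial k phi)))).
    apply: (le_trans (le_term (fun l => ip (partial l (partial j phi)) (partial l (partial j phi))) i
      (fun=> ip_ge0 _ _))).
    apply: (le_term (fun k => \sum_l ip (partial l (partial k phi)) (partial l (partial k phi))) j).
    by move=> k; apply: sumr_ge0 => l _; exact: ip_ge0.
  rewrite le_eqVlt; apply/orP; left; apply/eqP.
  apply: etrans (esym (ip_suml _ l2i l2)); apply: eq_bigr => k _.
  apply: etrans (etrans (esym (ip_suml _ l2i (l2i k))) (ipC _ _ _)).
  by apply: eq_bigr => l _; apply: (etrans (hessian k l tp)); exact: ipC.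
Qed.

Lemma test_partials (s : seq 'I_n) (phi : 'rV[R]_n -> R) : test_function phi -> test_function (partials s phi).
Proof. by move=> tp; elim: s => //= i s; exact: test_partial. Qed.

Lemma partials_lin (s : seq 'I_n) (phi psi : 'rV[R]_n -> R) c : smooth phi -> smooth psi ->
  partials s (fun x => phi x + c * psi x) = (fun x => partials s phi x + c * partials s psi x).
Proof.
move=> sp sq; elim: s => //= i s ->; have sp' := smooth_partials s sp; have sq' := smooth_partials s sq.
by rewrite (partialD i sp' (smoothZ c sq')) (partialZ i c sq').
Qed.

(* By weak uniqueness [h] is the limit of some [Bt (phi k)], and the elliptic
   estimate makes the derivatives of [phi k] up to order two converge. *)
Lemma weak_solution h : L2 leb h -> exists u,
  [/\ sobolev 2 u, forall phi, test_function phi -> ip u (Bt phi) = ip h phi &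
      nrm u <= (m - lam)^-1 * nrm h].
Proof.
move=> h2; pose P := [set f | exists2 phi, test_function phi & f = Bt phi].
have P2 f : P f -> L2 leb f by move=> [phi tp ->]; exact: test_op_L2.
have P0 : P !=set0.
  exists (Bt (fun x => 0 * bump x)); exists (fun x => 0 * bump x) => //.
  by apply: testZ; exact: test_bump.
have [f f1 c [phi tp fE] [psi tq gE]|F PF [f f2 [Ff fP]]] := L2_projection P0 P2 _ h2.
  exists (fun x => phi x + c * psi x); first by apply: testD => //; exact: testZ.
  by rewrite fE gE test_op_lin.
have hf2 : L2 leb (fun x => h x - f x) by exact: L2B.
have r0 : (fun x => h x - f x) = cst 0 %[ae leb].
  apply: (weak_uniqueness cV V0 VC Vunif form lam_m hf2) => phi tp.
  by apply: fP; exists phi.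
have hf : f = h %[ae leb].
  by apply: filterS r0 => x /(_ I)/eqP; rewrite subr_eq0 => /eqP.
have nf : nrm f = nrm h by apply: nrm_eq; apply: ae_eq_ip.
have /choice[phi hphi] : forall k, exists phi, test_function phi /\ F k = Bt phi.
  by move=> k; have [phi ? ?] := PF k; exists phi.
have tphi k : test_function (phi k) by have [] := hphi k.
have FE k : F k = Bt (phi k) by have [] := hphi k.
have F2 k : L2 leb (F k) by exact: P2.
have [K K0 ell] := test_op_elliptic.
have t2 s k : L2 leb (partials s (phi k)) by apply: test_L2; exact: test_partials.
have /choice[U hU] : forall s, exists g, (size s <= 2)%N ->
    L2 leb g /\ L2_cvg leb (fun k => partials s (phi k)) g.
  move=> s; have [s2|_] := leqP (size s) 2; last by exists (cst 0).
  have [|g g2 gU] := L2_cvg_complete (t2 s); last by exists g.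
  (* The factor [2] accounts for two distances to [f] in the triangle inequality. *)
  move=> e e0; have e1 : 0 < e / (K * 2 + 1) by rewrite divr_gt0// ltr_wpDl// mulr_ge0.
  have [N hN] := Ff _ e1; exists N => k l Nk Nl.
  apply: (le_trans _ (div_mul_le (ltW e0) (mulr_ge0 K0 (ler0n _ 2)))).
  have td : test_function (fun x => phi k x + (-1) * phi l x) by apply: testD => //; exact: testZ.
  have := ell _ td s s2; rewrite (partials_lin s (-1) (test_smooth (tphi k)) (test_smooth (tphi l))).
  rewrite (test_op_lin (-1) (tphi k) (tphi l)) => h1.
  have -> : nrm (fun x => partials s (phi k) x - partials s (phi l) x) =
      nrm (fun x => partials s (phi k) x + (-1) * partials s (phi l) x).
    by apply: nrm_eq; apply: eq_ip => x; rewrite mulN1r.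
  apply: (le_trans h1); rewrite mulrCA ler_wpM2l//.
  have d2 j : L2 leb (fun x => F j x - f x) by exact: L2B.
  have -> : nrm (fun x => Bt (phi k) x + (-1) * Bt (phi l) x) =
      nrm (fun x => (F k x - f x) + (-1) * (F l x - f x)).
    by apply: nrm_eq; apply: eq_ip => x; rewrite !FE; ring.
  apply: (le_trans (nrmD (d2 k) (L2Z (-1) (d2 l)))).
  rewrite (nrmZ (-1) (d2 l)) normrN normr1 mul1r mulrDr mulr1.
  by apply: lerD; exact: hN.
have U2 s : (size s <= 2)%N -> L2 leb (U s) by move=> /hU[].
have Uc s : (size s <= 2)%N -> L2_cvg leb (fun k => partials s (phi k)) (U s) by move=> /hU[].
(* Integration by parts for [phi k] passes to the limit and makes the limits weak derivatives of
   each other. *)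
have wU s i : (size s < 2)%N -> is_weak_partial i (U s) (U (i :: s)).
  move=> s2 psi tpsi; have s2' := ltnW s2.
  have p2 := test_L2 tpsi; have pi2 := test_L2 (test_partial i tpsi).
  have -> : \int[leb]_x (U s x * partial i psi x) = ip (U s) (partial i psi) by [].
  have -> : \int[leb]_x (U (i :: s) x * psi x) = ip (U (i :: s)) psi by [].
  rewrite (L2_cvg_ip_eq (c := -1) (t2 (i :: s)) (U2 (i :: s) s2) p2 (Uc (i :: s) s2)
    (t2 s) (U2 s s2') pi2 (Uc s s2')) ?mulN1r ?opprK// => k.
  rewrite mulN1r; exact: (ibp i (smooth_partials s (test_smooth (tphi k))) tpsi).
exists (U [::]); split.
- split; first exact: U2.
  move=> i; exists (U [:: i]); split; last exact: wU.
  split; first exact: U2.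
  by move=> j; exists (U [:: j; i]); split; [exact: U2|exact: wU].
- move=> psi tpsi; have p2 := test_L2 tpsi; have B2 := test_op_L2 tpsi.
  rewrite -(ae_eq_ip f2 p2 h2 p2 hf (ae_eq_refl _ _ _)) -[RHS]mul1r.
  apply: (L2_cvg_ip_eq (t2 [::]) (U2 [::] isT) B2 (Uc [::] isT) F2 f2 p2 Ff) => k.
  by rewrite mul1r FE; exact: (test_op_sym (tphi k) tpsi).
- rewrite -nf; apply: (L2_cvg_nrm_le _ (t2 [::]) (U2 [::] isT) (Uc [::] isT) F2 f2 Ff).
    by rewrite invr_ge0 ltW.
  by move=> k; rewrite ler_pdivlMl// FE; exact: (test_op_coercive (tphi k)).
Qed.

Lemma weak_partialP i (g v : 'rV[R]_n -> R) : L2 leb v -> is_weak_partial i g v ->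
  L2 leb (weak_partial i g) /\ is_weak_partial i g (weak_partial i g).
Proof. by move=> v2 gv; apply: (@xgetPex _ (cst 0) [set v | L2 leb v /\ is_weak_partial i g v]); exists v. Qed.

(* The second derivatives are found by duality: the weak derivative chosen by
   [weak_partial i g] may be replaced by any other, since both pair in the same
   way with test functions. *)
Lemma sobolev2_weak_partial2 i g : sobolev 2 g ->
  L2 leb (weak_partial i (weak_partial i g)) /\
  forall phi, test_function phi ->
    ip (weak_partial i (weak_partial i g)) phi = ip g (partial i (partial i phi)).
Proof.
move=> [g2 /(_ i)[v [[v2 /(_ i)[w [w2 vw]]] gv]]].
have [p2 gp] := weak_partialP v2 gv.
have pw : is_weak_partial i (weak_partial i g) w.
  move=> phi tphi; rewrite -(vw phi tphi); have tp := test_partial i tphi.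
  by apply: oppr_inj; rewrite -(gp _ tp) -(gv _ tp).
have [pp2 gpp] := weak_partialP w2 pw; split => // phi tphi.
by apply: oppr_inj; rewrite -(gpp _ tphi); apply: oppr_inj; rewrite opprK -(gp _ (test_partial i tphi)).
Qed.

(** On [H^2] the operator is contained in the adjoint of [test_op], so its equations can be checked
    against test functions. *)
Lemma sobolev2_op g : sobolev 2 g ->
  L2 leb (fun x => schrodinger_op theta V g x - lam * g x) /\
  forall phi, test_function phi ->
    ip (fun x => schrodinger_op theta V g x - lam * g x) phi = ip g (Bt phi).
Proof.
move=> Hg; have g2 : L2 leb g by have [] := Hg.
have pp2 i := (sobolev2_weak_partial2 i Hg).1; have pp i := (sobolev2_weak_partial2 i Hg).2.
have l2 : L2 leb (laplacian g) by exact: (L2_sum _ pp2).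
have B2 : L2 leb (schrodinger_op theta V g) by exact: (L2D (L2Z (- theta ^+ 2) l2) (VL2 g2)).
split=> [|phi tphi]; first exact: (L2B B2 (L2Z lam g2)).
have p2 := test_L2 tphi.
rewrite (ipBl B2 (L2Z lam g2) p2) (ipZl lam g2 p2).
rewrite (ipDl (L2Z (- theta ^+ 2) l2) (VL2 g2) p2) (ipZl (- theta ^+ 2) l2 p2).
rewrite (ip_test_op theta lam cV V0 VC tphi g2) -addrA.
have -> : ip (laplacian g) phi = \sum_(i < n) ip g (partial i (partial i phi)).
  by apply: etrans (ip_suml _ pp2 p2) _; apply: eq_bigr => i _; exact: pp.
have -> : ip (fun x => V x * g x) phi = ip g (fun x => V x * phi x).
  by apply: eq_Rintegral => x _; ring.
by [].
Qed.

(** The inverse picks weak solutions. It is a right inverse by the fundamental lemma, tested on test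
    functions, and a left inverse by weak uniqueness, tested on their images under [test_op]. *)
Lemma schrodinger_resolvent :
  resolvent_set leb (sobolev 2) (schrodinger_op theta V) lam.
Proof.
have /choice[S hS] : forall h, exists u, L2 leb h ->
    [/\ sobolev 2 u, forall phi, test_function phi -> ip u (Bt phi) = ip h phi &
      nrm u <= (m - lam)^-1 * nrm h].
  move=> h; have [h2|] := pselect (L2 leb h); last by exists (cst 0).
  by have [u hu] := weak_solution h2; exists u.
exists S, (m - lam)^-1; split.
- move=> h h2; have [Su Sh _] := hS h h2; have [B2 BS] := sobolev2_op Su; split => //.
  have d0 : (fun x => (schrodinger_op theta V (S h) x - lam * S h x) - h x) = cst 0 %[ae leb].
    apply: fundamental_lemma; first exact: L2B.
    move=> phi tphi; have p2 := test_L2 tphi.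
    by rewrite (ipBl B2 h2 p2) (BS _ tphi) (Sh _ tphi) subrr.
  by apply: filterS d0 => x /(_ I)/eqP; rewrite subr_eq0 => /eqP.
- move=> g Hg; have g2 : L2 leb g by have [] := Hg.
  have [B2 Bg] := sobolev2_op Hg; have [[S2 _] SB _] := hS _ B2.
  have d0 : (fun x => S (fun y => schrodinger_op theta V g y - lam * g y) x - g x) = cst 0 %[ae leb].
    apply: (weak_uniqueness cV V0 VC Vunif form lam_m); first exact: L2B.
    move=> phi tphi; have t2 := test_op_L2 tphi.
    by rewrite (ipBl S2 g2 t2) (SB _ tphi) (Bg _ tphi) subrr.
  by apply: filterS d0 => x /(_ I)/eqP; rewrite subr_eq0 => /eqP.
- move=> h h2; have [[S2 _] _ Sh] := hS h h2.
  by rewrite (Lnorm2E S2) (Lnorm2E h2) -EFinM lee_fin.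
Qed.

End resolvent.

(** * Periodic potentials and the conclusion *)

Section periodic.
Context {R : realType} {n : nat}.
Variable V : 'rV[R]_n -> R.
Hypothesis cV : continuous V.
Hypothesis V_periodic : forall (x : 'rV[R]_n) (k : 'rV[int]_n), V (x + map_mx intr k) = V x.

Lemma frac_rV (x : 'rV[R]_n) : exists k : 'rV[int]_n, `|x - map_mx intr k| <= 1.
Proof.
exists (\row_i Num.floor (x ord0 i)); apply/(normrV_le _ ler01) => i; rewrite !mxE.
rewrite ger0_norm ?subr_ge0 ?floor_le// lerBlDl ltW//.
by have := floorD1_gt (x ord0 i); rewrite intrD.
Qed.

Let V_sub x (k : 'rV[int]_n) : V (x - map_mx intr k) = V x.
Proof. by rewrite -[in RHS](subrK (map_mx intr k) x) V_periodic. Qed.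

Lemma periodic_bounded : exists C : R, forall x, V x <= C.
Proof.
have [C _ hC] := continuous_bounded_cball 1 cV; exists C => x.
have [k xk] := frac_rV x; rewrite -(V_sub x k).
exact: le_trans (ler_norm _) (hC _ xk).
Qed.

(** Both points are moved by the same integer vector, which brings [x] into the unit ball while [y]
    stays within [delta] of it. *)
Lemma periodic_uniform (eta : R) : 0 < eta -> exists2 delta : R, 0 < delta &
  forall x y : 'rV[R]_n, `|x - y| <= delta -> `|V x - V y| <= eta.
Proof.
move=> eta0; have [d d0 hd] := uniform_continuous_cball 1 cV eta0; exists d => // x y xy.
have [k xk] := frac_rV x; rewrite -(V_sub x k) -(V_sub y k); apply: hd => //.
by rewrite opprB addrA subrK.
Qed.

End periodic.

Theorem corollary2p6 (R : realType) (d : nat) (V : 'rV[R]_d -> R) (theta : R)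
  (d_ge1 : (1 <= d)%N)
  (V_continuous : continuous V)
  (V_ge0 : forall x : 'rV[R]_d, 0 <= V x)
  (V_periodic : forall (x : 'rV[R]_d) (k : 'rV[int]_d),
    V (x + map_mx intr k) = V x)
  (theta_gt0 : 0 < theta) :
  (inf_set (union_spectrum theta V) <= inf_set (schrodinger_spectrum theta V))%E.
Proof.
apply: le_ereal_inf_tmp => _ [lam Slam <-]; rewrite leNgt; apply/negP => lt.
(* A real [m] strictly above [lam] provides the gap. If the union spectrum is empty, its infimum is
   [+oo] and any larger number will do. *)
have [m lam_m mU] : exists2 m : R, lam < m & (m%:E <= inf_set (union_spectrum theta V))%E.
  move: lt; case: (inf_set _) => [r| |] //.
  - by rewrite lte_fin => lr; exists r.
  - by move=> _; exists (lam + 1); rewrite ?ltrDl// leey.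
have [C VC] := periodic_bounded V_continuous V_periodic.
have Vunif := periodic_uniform V_continuous V_periodic.
(* A point below [m] in the spectrum for any one shift would push the infimum below [m]. *)
have res eta l : l < m -> resolvent_set (@counting (lattice d) R)
    (L2 (@counting (lattice d) R)) (lattice_op theta V eta) l.
  move=> lm; apply: contrapT => nl.
  have : (inf_set (union_spectrum theta V) <= l%:E)%E.
    by apply: ereal_inf_lbound; exists l => //; exists eta.
  by move=> /(le_trans mU); rewrite lee_fin leNgt lm.
apply: Slam; apply: (schrodinger_resolvent theta_gt0 V_continuous V_ge0 VC Vunif _ lam_m).
exact: (test_form_ge theta_gt0 (continuous_measurable_rV V_continuous) V_ge0 VC res).
Qed.
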